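(* There exists a universal constant $C>0$ such that for every positive integer $n$ there exist a measure $\mu$ on $\mathbb{R}^n$ with a continuous density and an origin-symmetric convex body $L\subseteq\mathbb{R}^n$ with $\mu(L)>0$ such that for all $\xi\in\mathbb{S}^{n-1}$ and all $t\ge 0$, $$\mu^+\big(L\cap(\xi^{\perp}+t\xi)\big)\le \frac{C}{\sqrt n}\,\mu(L)\,|L|^{-\frac1n}.$$
   Context: $\mathbb{S}^{n-1}$ is the Euclidean unit sphere in $\mathbb{R}^n$ and $|A|$ is the Lebesgue volume of a measurable set $A\subset\mathbb{R}^n$. A convex body $L$ is origin-symmetric if $L=-L$. For $\xi\in\mathbb{S}^{n-1}$, $\xi^\perp=\{x\in\mathbb{R}^n:\langle x,\xi\rangle=0\}$, and $A+x=\{y+x:y\in A\}$. If $\mu$ is a measure on $\mathbb{R}^n$ with continuous (nonnegative) density $f$ and $A\subseteq\mathbb{R}^n$ has Hausdorff dimension $n-1$, then $\mu^+(A)=\int_A f(x)\,dx$, the integration being with respect to the $(n-1)$-dimensional Hausdorff measure; $\mu^+(\emptyset)=0$. *)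

(* Defs.v *)
From HB Require Import structures.
From mathcomp Require Import all_boot all_order all_algebra.
From mathcomp Require Import all_classical all_reals all_analysis.

Set Implicit Arguments.
Unset Strict Implicit.
Unset Printing Implicit Defensive.

Import Order.TTheory GRing.Theory Num.Theory.
Import numFieldNormedType.Exports.

Local Open Scope classical_set_scope.
Local Open Scope ring_scope.

(* 'rV[T]_n carries the sigma-algebra generated by the coordinates, as
   n.-tuple T does in the library; for T : realType it consists of the Borel
   sets (one inclusion is open_measurable_rV below). *)
Definition measure_rV_display : measure_display -> measure_display.
Proof. exact. Qed.

Section measurable_rV.
Context {d} {T : measurableType d} (n : nat).

Let coords : 'I_n -> 'rV[T]_n -> T := fun i x => x ord0 i.

Let rV_set0 : g_sigma_preimage coords set0.
Proof. exact: sigma_algebra0. Qed.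

Let rV_setC A : g_sigma_preimage coords A -> g_sigma_preimage coords (~` A).
Proof. exact: sigma_algebraC. Qed.

Let rV_bigcup (F : _^nat) : (forall i, g_sigma_preimage coords (F i)) ->
  g_sigma_preimage coords (\bigcup_i (F i)).
Proof. exact: sigma_algebra_bigcup. Qed.

HB.instance Definition _ := @isMeasurable.Build (measure_rV_display d)
  'rV[T]_n (g_sigma_preimage coords) rV_set0 rV_setC rV_bigcup.

Lemma measurable_rV_coord (i : 'I_n) :
  measurable_fun [set: 'rV[T]_n] (fun x => x ord0 i).
Proof.
move=> _ Y mY; rewrite setTI; apply: sub_sigma_algebra => /=.
rewrite -bigcup_seq/=; exists i => /=; first by rewrite mem_index_enum.
by exists Y => //; rewrite setTI.
Qed.

Lemma measurable_fun_rV d' (U : measurableType d') (f : U -> 'rV[T]_n) :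
  (forall i, measurable_fun [set: U] (fun x => f x ord0 i)) ->
  measurable_fun [set: U] f.
Proof.
move=> mf; apply: measurability => //.
move=> _ [B + <-]; rewrite -bigcup_seq/= => -[i _ [A mA <-]].
by rewrite !setTI; have := mf i measurableT A mA; rewrite setTI.
Qed.

End measurable_rV.

Section lebesgue_rV.
Context {R : realType}.

Lemma open_measurable_rV n (U : set 'rV[R]_n) : open U -> measurable U.
Proof.
move=> oU.
pose B (p : 'rV[rat]_n * nat) : set 'rV[R]_n :=
  [set x | forall i, `|ratr (p.1 ord0 i) - x ord0 i| < p.2.+1%:R^-1].
have mB p : measurable (B p).
  have -> : B p = \bigcap_(i in [set: 'I_n])
      ((fun x : 'rV[R]_n => x ord0 i) @^-1`
        ball (ratr (p.1 ord0 i) : R) p.2.+1%:R^-1).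
    by apply/seteqP; split=> [x Bx i _|x Bx i]; [exact: Bx|exact: (Bx i I)].
  apply: fin_bigcap_measurable => // i _.
  rewrite -[X in measurable X]setTI; apply: measurable_rV_coord => //.
  by rewrite ball_itv; exact: measurable_itv.
have -> : U = \bigcup_p (if `[< B p `<=` U >] then B p else set0).
  apply/seteqP; split=> [x Ux|x [p _]]; last first.
    by case: asboolP => // /[apply].
  have /nbhs_ballP[e /= e0 xeU] : nbhs x U by exact: open_nbhs_nbhs.
  have [k ke] : exists k : nat, k.+1%:R^-1 < e / 2.
    have e20 : 0 < e / 2 by rewrite divr_gt0.
    by have [k _ /(_ k (leqnn k))] := near_infty_natSinv_lt (PosNum e20); exists k.
  have /choice[q qP] : forall i : 'I_n, exists q : rat,
      `|ratr q - x ord0 i| < k.+1%:R^-1.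
    move=> i; have : x ord0 i - k.+1%:R^-1 < x ord0 i + k.+1%:R^-1.
      by rewrite ltrBlDr -addrA ltrDl addr_gt0.
    move=> /rat_in_itvoo[q]; rewrite in_itv/= => /andP[q1 q2]; exists q.
    by rewrite ltr_distl q1 q2.
  exists (\row_i q i, k) => //; case: asboolP => [_ i|[]]/=.
    by rewrite mxE.
  move=> y By; apply: xeU; split => // i j; rewrite ord1 /ball/=.
  have := By j; rewrite /= mxE => yj.
  rewrite (splitr e) -(subrK (ratr (q j)) (x ord0 j)) -addrA.
  rewrite (le_lt_trans (ler_normD _ _))// ltrD//.
    by rewrite distrC (lt_trans (qP j)).
  exact: lt_trans yj _.
by apply: countable_bigcupT_measurable => // p; case: ifP.
Qed.

Definition rV_cons n (p : R * 'rV[R]_n) : 'rV[R]_n.+1 := row_mx p.1%:M p.2.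

Lemma measurable_rV_cons n : measurable_fun [set: R * 'rV[R]_n] (@rV_cons n).
Proof.
apply: measurable_fun_rV => i; rewrite /rV_cons.
case: (@split_ordP 1 n i) => j ->.
  rewrite (_ : (fun _ => _) = fst); first exact: measurable_fst.
  apply/funext => p; have := row_mxEl p.1%:M p.2 ord0 j.
  by rewrite (ord1 j) [in RHS]mxE eqxx mulr1n.
rewrite (_ : (fun _ => _) = (fun x : 'rV[R]_n => x ord0 j) \o snd).
  exact: (measurableT_comp (measurable_rV_coord j) measurable_snd).
by apply/funext => p; exact: (row_mxEr p.1%:M p.2 ord0 j).
Qed.

Fixpoint lebesgue_rV n : set 'rV[R]_n -> \bar R :=
  match n with
  | 0 => \d_(0 : 'rV[R]_0)
  | m.+1 => pushforward (@lebesgue_measure R \x @lebesgue_rV m)%E (@rV_cons m)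
  end.

Let lebesgue_rV_sigma_finite_measure n :
  exists m : {sigma_finite_measure set 'rV[R]_n -> \bar R},
    m = @lebesgue_rV n :> (_ -> _).
Proof.
elim: n => [|n [m mE]] /=; first by exists (\d_(0 : 'rV[R]_0)).
rewrite -mE.
pose P : {measure set 'rV[R]_n.+1 -> \bar R} :=
  measure_function_pushforward__canonical__measure_function_Measure
    (@lebesgue_measure R \x m)%E (@measurable_rV_cons n).
have sP : sigma_finite setT P.
  pose g (x : 'rV[R]_n.+1) : R * 'rV[R]_n := (x ord0 ord0, @rsubmx _ 1 1 n x).
  have gK : cancel (@rV_cons n) g.
    move=> [x y]; rewrite /g /rV_cons row_mxKr; congr pair.
    transitivity (row_mx x%:M y ord0 (@lshift 1 n ord0)).
      by congr (row_mx _ _ _ _); exact: val_inj.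
    by rewrite row_mxEl mxE eqxx.
  have mg : measurable_fun setT g.
    apply/measurable_fun_pair; first exact: measurable_rV_coord.
    apply: measurable_fun_rV => i; under eq_fun do rewrite mxE.
    exact: measurable_rV_coord.
  have /sigma_finiteP[F [TF ndF Foo]] := sigma_finiteT (@lebesgue_measure R).
  have /sigma_finiteP[G [TG ndG Goo]] := sigma_finiteT m.
  exists (fun k => g @^-1` (F k `*` G k)).
    rewrite -preimage_bigcup; apply/esym; rewrite -subTset => x _ /=.
    have [i _ Fi] : (\bigcup_k F k) (g x).1 by rewrite -TF.
    have [j _ Gj] : (\bigcup_k G k) (g x).2 by rewrite -TG.
    exists (maxn i j) => //; split.
      by move: Fi; exact/subsetPset/ndF/leq_maxl.
    by move: Gj; exact/subsetPset/ndG/leq_maxr.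
  move=> k; have [? ?] := Foo k; have [? ?] := Goo k; split.
    by rewrite -[X in measurable X]setTI; apply: mg => //; exact: measurableX.
  rewrite /P/= /pushforward -comp_preimage (_ : g \o @rV_cons n = id).
    by rewrite preimage_id product_measure1E// lte_mul_pinfty// ge0_fin_numE.
  by apply/funext => p /=; rewrite gK.
pose S := HB.pack_for (SigmaFiniteMeasure.type 'rV[R]_n.+1 R) (Measure.sort P)
  (Measure_isSigmaFinite.Build _ _ _ (Measure.sort P) sP).
by exists S.
Qed.

Let lebesgue_rV0 n : @lebesgue_rV n set0 = 0%E.
Proof. by have [m <-] := lebesgue_rV_sigma_finite_measure n. Qed.

Let lebesgue_rV_ge0 n A : (0 <= @lebesgue_rV n A)%E.
Proof. by have [m <-] := lebesgue_rV_sigma_finite_measure n. Qed.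

Let lebesgue_rV_sigma_additive n : semi_sigma_additive (@lebesgue_rV n).
Proof.
have [m <-] := lebesgue_rV_sigma_finite_measure n.
exact: measure_semi_sigma_additive.
Qed.

HB.instance Definition _ n := isMeasure.Build _ _ _ (@lebesgue_rV n)
  (@lebesgue_rV0 n) (@lebesgue_rV_ge0 n) (@lebesgue_rV_sigma_additive n).

Let lebesgue_rV_sigma_finite n : sigma_finite setT (@lebesgue_rV n).
Proof.
have [m <-] := lebesgue_rV_sigma_finite_measure n.
exact: sigma_finiteT.
Qed.

HB.instance Definition _ n := Measure_isSigmaFinite.Build _ _ _ (@lebesgue_rV n)
  (@lebesgue_rV_sigma_finite n).

End lebesgue_rV.
Arguments lebesgue_rV {R n} A : rename.

Section euclidean.
Context {R : realType} {n : nat}.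
Implicit Types (x y xi : 'rV[R]_n) (A L : set 'rV[R]_n).

(* The library norm on 'rV[R]_n is the sup norm, hence these. *)
Definition dot x y : R := \sum_i x ord0 i * y ord0 i.

Definition enorm x : R := Num.sqrt (dot x x).

Definition unit_sphere : set 'rV[R]_n := [set x | enorm x = 1].

Definition unit_ball : set 'rV[R]_n := [set x | enorm x <= 1].

Definition perp xi : set 'rV[R]_n := [set x | dot x xi = 0].

Definition translate A x : set 'rV[R]_n := [set y + x | y in A].

Definition convex_body L :=
  [/\ compact L, convex_set (L : set (convex_lmodType 'rV[R]_n)) & L° !=set0].

Definition origin_symmetric L := [set - x | x in L] = L.

End euclidean.
Arguments unit_sphere : clear implicits.
Arguments unit_ball : clear implicits.

Section hausdorff.
Local Open Scope ereal_scope.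
Context {R : realType} {n : nat}.
Implicit Types A U : set 'rV[R]_n.

Definition ediam U : \bar R :=
  ereal_sup [set (enorm (p.1 - p.2))%:E | p in U `*` U].

(* The volume of a d-dimensional ball of the same diameter. The empty set has
   weight 0 also when d = 0. *)
Definition hausdorff_weight (d : nat) U : \bar R :=
  if `[< U = set0 >] then 0
  else lebesgue_rV (unit_ball R d) * ((2^-1)%:E * ediam U) ^+ d.

Definition hausdorff_delta (d : nat) (delta : R) A : \bar R :=
  ereal_inf [set \sum_(k <oo) hausdorff_weight d (U k) | U in
    [set U : (set 'rV[R]_n)^nat |
      (forall k, ediam (U k) <= delta%:E) /\ A `<=` \bigcup_k U k]].

(* The d-dimensional Hausdorff measure on R^n, normalized to agree with
   Lebesgue measure on R^d. As a function on all sets it is an outer measure;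
   it is a measure on the Borel sets, and \int[hausdorff d] only evaluates it
   on those. *)
Definition hausdorff (d : nat) A : \bar R :=
  ereal_sup [set hausdorff_delta d delta A | delta in [set delta | (0 < delta)%R]].

End hausdorff.

Section density.
Local Open Scope ereal_scope.
Context {R : realType} {n : nat}.

Definition has_density (mu : set 'rV[R]_n -> \bar R) (f : 'rV[R]_n -> R) :=
  forall A, measurable A -> mu A = \int[lebesgue_rV]_(x in A) (f x)%:E.

(* mu^+ for the measure mu with continuous density f. *)
Definition mu_plus (f : 'rV[R]_n -> R) (A : set 'rV[R]_n) : \bar R :=
  \int[hausdorff n.-1]_(x in A) (f x)%:E.

End density.

(* Main.v *)
(* Let theta_1, ..., theta_N with N = M n be sqrt n times sign vectors such that
   every unit vector xi has |<theta_i, xi>| >= c sqrt n for a positive fraction of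
   the i, and sum_i |<theta_i, xi>| = O(N sqrt n); random signs do, by Chernoff
   bounds on a net. The measure is a sum of standard Gaussians centered at the
   points a of a finite set A of combinations sum_i y_i theta_i with
   sum_i |y_i| = O(1), such that sum_(a in A) exp (- (t - <a, xi>)^2 / 2) is
   O(|A| / sqrt n) for all unit xi and all t; up to a constant, this sum is the
   integral of the density over the hyperplane. The set A is obtained by repeatedly
   translating along arithmetic progressions in the directions theta_i, with
   geometrically decreasing lengths.

   The body is L = {sum_i y_i theta_i : sum_i |y_i| <= k} + 3 sqrt n B. It contains
   the balls of radius 3 sqrt n around the points of A, so it has measure at least
   |A| / 2, while rounding n y to integer vectors of l^1 norm at most k n covers L
   by exp(O(n)) balls of radius O(sqrt n), hence |L|^(1/n) = O(1). *)

(* The ratio rho of the lengths is the crux. A round at length s leaves a fraction q of the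
   directions uncontrolled; these inherit the bound of the set already built at length s rho, which
   is worse by the factor 1 / rho. If q < rho the recursion closes with a constant independent of
   the number of rounds, and rho < 1 keeps the total length s / (1 - rho) bounded, hence also the
   volume of the body. Enough rounds push the remainder q ^ K below 1 / n. The theta_i have
   Euclidean length n: n steps along one of them then sweep, for a good direction, an interval of
   length of order s sqrt n, and the mesh never exceeds 1, as the Riemann sums require.

   The other obstacle is the meaning of mu^+, an integral against a Hausdorff measure defined by
   coverings. Hyperplanes are charted isometrically by reflections, and only one inequality enters,
   Hausdorff measure at most Lebesgue measure. It is proved at each fixed mesh delta, where the
   covering infimum is already an outer measure. *)
Require Import Defs.
From HB Require Import structures.
From mathcomp Require Import all_boot all_order all_algebra.
From mathcomp Require Import all_classical all_reals all_analysis.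
From mathcomp Require Import measurable_realfun ring lra.
Import Order.TTheory GRing.Theory Num.Theory.
Import numFieldNormedType.Exports.
Local Open Scope classical_set_scope.
Local Open Scope ring_scope.

Set Implicit Arguments.
Unset Strict Implicit.
Unset Printing Implicit Defensive.

(** * Euclidean norm *)

Section euclidean_space.
Context {R : realType} {n : nat}.
Implicit Types x y z : 'rV[R]_n.

Lemma dotC x y : dot x y = dot y x.
Proof. by apply: eq_bigr => i _; rewrite mulrC. Qed.

Lemma dotDl x y z : dot (x + y) z = dot x z + dot y z.
Proof. by rewrite -big_split; apply: eq_bigr => i _; rewrite mxE mulrDl. Qed.

Lemma dotZl a x y : dot (a *: x) y = a * dot x y.
Proof. by rewrite /dot mulr_sumr; apply: eq_bigr => i _; rewrite mxE mulrA. Qed.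

Lemma dotDr x y z : dot x (y + z) = dot x y + dot x z.
Proof. by rewrite dotC dotDl !(dotC _ x). Qed.

Lemma dotZr a x y : dot x (a *: y) = a * dot x y.
Proof. by rewrite dotC dotZl dotC. Qed.

Lemma dotNl x y : dot (- x) y = - dot x y.
Proof. by rewrite -scaleN1r dotZl mulN1r. Qed.

Lemma dotNr x y : dot x (- y) = - dot x y.
Proof. by rewrite dotC dotNl dotC. Qed.

Lemma dotBl x y z : dot (x - y) z = dot x z - dot y z.
Proof. by rewrite dotDl dotNl. Qed.

Lemma dotBr x y z : dot x (y - z) = dot x y - dot x z.
Proof. by rewrite dotDr dotNr. Qed.

Lemma dot0l x : dot 0 x = 0.
Proof. by rewrite -(scale0r 0) dotZl mul0r. Qed.

Lemma dot_suml (I : Type) (r : seq I) (P : pred I) (F : I -> 'rV[R]_n) y :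
  dot (\sum_(i <- r | P i) F i) y = \sum_(i <- r | P i) dot (F i) y.
Proof. exact: (big_morph (dot^~ y) (fun a b => dotDl a b y) (dot0l y)). Qed.

Lemma dotxx_ge0 x : 0 <= dot x x.
Proof. by apply: sumr_ge0 => i _; rewrite -expr2 sqr_ge0. Qed.

Lemma dotxx_eq0 x : dot x x = 0 -> x = 0.
Proof.
move=> /eqP; rewrite psumr_eq0 => [/allP x0|i _]; last by rewrite -expr2 sqr_ge0.
apply/rowP => i; rewrite mxE; apply/eqP; have := x0 i (mem_index_enum i).
by rewrite /= mulf_eq0 orbb.
Qed.

Lemma enorm_ge0 x : 0 <= enorm x. Proof. exact: sqrtr_ge0. Qed.

Lemma sqr_enorm x : enorm x ^+ 2 = dot x x.
Proof. exact: sqr_sqrtr (dotxx_ge0 x). Qed.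

Lemma enormZ a x : enorm (a *: x) = `|a| * enorm x.
Proof.
by rewrite /enorm dotZl dotZr mulrA -expr2 sqrtrM ?sqr_ge0// sqrtr_sqr.
Qed.

Lemma enormN x : enorm (- x) = enorm x.
Proof. by rewrite -scaleN1r enormZ normrN1 mul1r. Qed.

Lemma enorm_distC x y : enorm (x - y) = enorm (y - x).
Proof. by rewrite -enormN opprB. Qed.

Lemma enorm_le x a : 0 <= a -> (enorm x <= a) = (dot x x <= a ^+ 2).
Proof. by move=> a0; rewrite -sqr_enorm ler_sqr ?nnegrE ?enorm_ge0. Qed.

(** The square norm of [dot y y *: x - dot x y *: y] is [dot y y] times the gap in the squared
    Cauchy-Schwarz inequality. *)
Lemma normr_dot_le x y : `|dot x y| <= enorm x * enorm y.
Proof.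
have [y0|y0] := eqVneq (dot y y) 0.
  by rewrite (dotxx_eq0 y0) dotC dot0l normr0 mulr_ge0 ?enorm_ge0.
have yp : 0 < dot y y by rewrite lt_def y0 dotxx_ge0.
rewrite -ler_sqr ?nnegrE ?mulr_ge0 ?enorm_ge0// real_normK ?num_real//.
rewrite exprMn !sqr_enorm -subr_ge0 -(pmulr_rge0 _ yp).
have := dotxx_ge0 (dot y y *: x - dot x y *: y).
rewrite !(dotBl, dotBr, dotZl, dotZr) (dotC y x).
by congr (_ <= _); ring.
Qed.

Lemma ler_enormD x y : enorm (x + y) <= enorm x + enorm y.
Proof.
rewrite enorm_le ?addr_ge0 ?enorm_ge0// dotDl !dotDr (dotC y x).
rewrite sqrrD !sqr_enorm.
have := le_trans (ler_norm _) (normr_dot_le x y); lra.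
Qed.

Lemma ler_coord_enorm x i : `|x ord0 i| <= enorm x.
Proof.
rewrite -ler_sqr ?nnegrE ?enorm_ge0// real_normK ?num_real// sqr_enorm.
rewrite /dot (bigD1 i)//= expr2 lerDl.
by apply: sumr_ge0 => j _; rewrite -expr2 sqr_ge0.
Qed.

Lemma enorm_le_coord x a : 0 <= a -> (forall i, `|x ord0 i| <= a) ->
  enorm x <= Num.sqrt n%:R * a.
Proof.
move=> a0 xa; rewrite enorm_le ?mulr_ge0 ?sqrtr_ge0//.
rewrite exprMn sqr_sqrtr ?ler0n//.
have -> : n%:R * a ^+ 2 = \sum_(i < n) a ^+ 2.
  by rewrite sumr_const card_ord mulr_natl.
apply: ler_sum => i _.
by rewrite -expr2 -real_normK ?num_real// ler_sqr ?nnegrE.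
Qed.

End euclidean_space.

(** * Sign vectors *)

Section lattice_points.
Context {R : realType}.

(** Integers of absolute value at most [B] are coded by sign and magnitude, with two codes for 0.
    Sums of products over all functions into this finite type factor over the coordinates. *)
Definition sgnat (B : nat) (c : bool * 'I_B.+1) : R := (-1) ^+ c.1 * c.2%:R.

Definition mass (p B : nat) (z : {ffun 'I_p -> bool * 'I_B.+1}) : nat :=
  \sum_i (z i).2.

(** Truncating [|x|] rounds toward 0, so an l^1 bound survives when all coordinates are rounded. *)
Lemma round_sgnat (B : nat) (x : R) : `|x| <= B%:R ->
  exists c : bool * 'I_B.+1, `|x - sgnat c| <= 1 /\ c.2%:R <= `|x|.
Proof.
move=> xB; have /andP[k1 k2] := truncn_itv (normr_ge0 x).
have kB : (Num.truncn `|x| < B.+1)%N.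
  by rewrite ltnS -(ler_nat R) (le_trans k1).
exists (x < 0, Ordinal kB); split => //=.
rewrite /sgnat/=; move: k1 k2; rewrite -natr1.
move: (Num.truncn `|x|)%:R => k; case: (ltP x 0) => x0 /=.
  rewrite ltr0_norm// expr1 mulN1r ler_norml; lra.
rewrite ger0_norm// expr0 mul1r ler_norml; lra.
Qed.

Lemma round_mass (p B : nat) (x : 'I_p -> R) : \sum_i `|x i| <= B%:R ->
  exists z : {ffun 'I_p -> bool * 'I_B.+1},
    (mass z <= B)%N /\ forall i, `|x i - sgnat (z i)| <= 1.
Proof.
move=> xB.
have xiB i : `|x i| <= B%:R.
  by apply: le_trans xB; rewrite (bigD1 i)//= lerDl sumr_ge0.
have /choice[z zP] := fun i => round_sgnat (xiB i).
exists (finfun z); split => [|i]; last by rewrite ffunE; have [] := zP i.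
rewrite /mass -(ler_nat R) natr_sum (le_trans _ xB)//.
by apply: ler_sum => i _; rewrite ffunE; have [] := zP i.
Qed.

Lemma sum_half_expr (m : nat) :
  \sum_(k < m) 2^-1 ^+ k = 2 - 2 * 2^-1 ^+ m :> R.
Proof.
elim: m => [|m IH]; first by rewrite big_ord0 expr0; lra.
by rewrite big_ord_recr/= IH exprS; lra.
Qed.

(* Each counted z has weight 2 ^ (B - mass z) >= 1, and these weights sum to a
   product of geometric series. *)
Lemma card_mass_le (p B : nat) :
  (#|[pred z : {ffun 'I_p -> bool * 'I_B.+1} | (mass z <= B)%N]|%:R : R)
    <= 2 ^+ B * 4 ^+ p.
Proof.
(* Two signs for each magnitude, and a geometric series below 2. *)
have sumc : \sum_(c : bool * 'I_B.+1) 2^-1 ^+ c.2 <= 4 :> R.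
  rewrite -(pair_bigA _ (fun (b : bool) (k : 'I_B.+1) => 2^-1 ^+ k))/=.
  rewrite big_bool/= sum_half_expr.
  have : 0 <= 2^-1 ^+ B.+1 :> R by rewrite exprn_ge0.
  lra.
have -> : (#|[pred z : {ffun 'I_p -> bool * 'I_B.+1} | (mass z <= B)%N]|%:R : R)
    = \sum_(z : {ffun 'I_p -> bool * 'I_B.+1} | (mass z <= B)%N) 1.
  by rewrite sumr_const.
apply: (@le_trans _ _ (\sum_(z : {ffun 'I_p -> bool * 'I_B.+1})
    2 ^+ B * \prod_i 2^-1 ^+ (z i).2)).
  rewrite big_mkcond/=; apply: ler_sum => z _; case: ifP => zB; last first.
    by rewrite mulr_ge0 ?exprn_ge0// prodr_ge0// => i _; rewrite exprn_ge0.
  rewrite prodrXr -/(mass z) exprVn -ler_pdivrMr ?invr_gt0 ?exprn_gt0//.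
  by rewrite invrK mul1r ler_eXn2l ?ltr1n.
rewrite -mulr_sumr ler_wpM2l ?exprn_ge0//.
rewrite -(bigA_distr_bigA (fun _ (c : bool * 'I_B.+1) => 2^-1 ^+ c.2 : R)).
rewrite prodr_const card_ord lerXn2r ?nnegrE//.
by apply: sumr_ge0 => c _; rewrite exprn_ge0.
Qed.

End lattice_points.

(** * Elementary inequalities for the exponential *)

Section elementary_exp.
Context {R : realType}.
Implicit Types x : R.

Lemma expR_le_inv x : x < 1 -> expR x <= (1 - x)^-1.
Proof.
move=> x1; rewrite -[x in expR x]opprK expRN lef_pV2 ?posrE ?expR_gt0 ?subr_gt0//.
exact: expR_ge1Dx.
Qed.

(** Sub-Gaussian bound for one random sign. For [|x| <= 1 / 2] the linear terms of e^y <= 1 + y + 2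
    y^2 cancel; beyond that, [|x| <= 2 * x ^+ 2]. *)
Lemma expRD_expRN_le x : expR x + expR (- x) <= 2 * expR (2 * x ^+ 2).
Proof.
have [x1|x1] := leP (2 * `|x|) 1.
  have xlt1 (y : R) : 2 * `|y| <= 1 -> expR y <= 1 + y + 2 * y ^+ 2.
    rewrite mulrC -ler_pdivlMr ?ltr0n// div1r ler_norml => /andP[y1 y2].
    apply: (le_trans (expR_le_inv _)); first by lra.
    rewrite -[X in X <= _]div1r ler_pdivrMr; last by lra.
    have : 0 <= y ^+ 2 * (1 - 2 * y) by rewrite mulr_ge0 ?sqr_ge0//; lra.
    lra.
  have h1 := xlt1 _ x1.
  have h2 : expR (- x) <= 1 + - x + 2 * (- x) ^+ 2 by apply: xlt1; rewrite normrN.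
  have h3 := expR_ge1Dx (2 * x ^+ 2).
  by rewrite sqrrN in h2; lra.
have le_exp (y : R) : 1 < 2 * `|y| -> expR y <= expR (2 * y ^+ 2).
  move=> y1; rewrite ler_expR -[y ^+ 2]real_normK ?num_real//.
  by apply: (le_trans (ler_norm _)); rewrite expr2; nra.
have h2 : expR (- x) <= expR (2 * (- x) ^+ 2) by apply: le_exp; rewrite normrN.
have h1 := le_exp _ x1.
by rewrite sqrrN in h2; lra.
Qed.

Lemma expRN_le_linear x : 0 <= x <= 1 -> expR (- x) <= 1 - x / 2.
Proof.
move=> /andP[x0 x1]; rewrite expRN.
have h : 1 <= (1 - x / 2) * expR x.
  have := expR_ge1Dx x; nra.
by rewrite -[X in X <= _]mul1r ler_pdivrMr ?expR_gt0.
Qed.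

(** A polynomial minorant whose mean over signs is controlled by the second and fourth moments. It
    touches 1 at |x| = 2: 1 minus it is (x^2 - 4)^2 / 16. *)
Lemma min1_ge_quartic x : x ^+ 2 / 2 - x ^+ 4 / 16 <= Num.min 1 `|x|.
Proof.
have e4 (z : R) : z ^+ 4 = (z ^+ 2) ^+ 2 by rewrite -exprM.
have -> : x ^+ 4 = `|x| ^+ 4 by rewrite !e4 real_normK ?num_real.
rewrite -[x ^+ 2]real_normK ?num_real//.
have : 0 <= `|x| by []. move: `|x| => y y0.
rewrite le_min e4; apply/andP; split.
  have := sqr_ge0 (y ^+ 2 - 4); nra.
have [y1|y1] := leP y 1.
  have := sqr_ge0 (y ^+ 2); rewrite expr2; nra.
have := sqr_ge0 (y ^+ 2 - 4); nra.
Qed.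

End elementary_exp.

(** * Moments and exponential moments of random sign sums *)

Section sign_vectors.
Context {R : realType} {n : nat}.
Implicit Types (s : {ffun 'I_n -> bool}) (x y : 'rV[R]_n).

Definition signv s : 'rV[R]_n := \row_j (-1) ^+ s j.

Let flip (i : 'I_n) s : {ffun 'I_n -> bool} := [ffun j => (j == i) (+) s j].

Let flipK i : involutive (flip i).
Proof. by move=> s; apply/ffunP => j; rewrite !ffunE addbA addbb. Qed.

Let sum_odd0 i (g : {ffun 'I_n -> bool} -> R) :
  (forall s, g (flip i s) = - g s) -> \sum_(s : {ffun 'I_n -> bool}) g s = 0.
Proof.
move=> gN; have : \sum_(s : {ffun 'I_n -> bool}) g s =
    - \sum_(s : {ffun 'I_n -> bool}) g s.
  rewrite {1}(reindex_inj (inv_inj (flipK i)))/= -sumrN.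
  by apply: eq_bigr => s _; rewrite gN.
by lra.
Qed.

Let part (r : seq 'I_n) y s : R := \sum_(j <- r) (-1) ^+ s j * y ord0 j.

Let part_flip r y s i : i \notin r -> part r y (flip i s) = part r y s.
Proof.
move=> ir; apply: eq_big_seq => j jr; rewrite ffunE.
by case: eqP => // ji; rewrite -ji jr in ir.
Qed.

(** Flipping sign [i] permutes the sign vectors and leaves [part r] alone; this stands for
    independence. *)
Let sum_sgn_part0 i r y (p : R -> R) : i \notin r ->
  \sum_(s : {ffun 'I_n -> bool}) ((-1) ^+ s i * p (part r y s)) = 0.
Proof.
move=> ir; apply: (@sum_odd0 i) => s.
by rewrite part_flip// ffunE eqxx addTb signrN mulNr.
Qed.

Let expand2 (e u t : R) : e * e = 1 ->
  (e * u + t) ^+ 2 = u ^+ 2 + 2 * u * (e * t) + t ^+ 2.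
Proof.
move=> ee.
have -> : (e * u + t) ^+ 2 = (e * e) * u ^+ 2 + 2 * u * (e * t) + t ^+ 2 by ring.
by rewrite ee mul1r.
Qed.

Let expand4 (e u t : R) : e * e = 1 ->
  (e * u + t) ^+ 4 = u ^+ 4 + 4 * u ^+ 3 * (e * t) + 4 * u * (e * t ^+ 3)
    + 6 * u ^+ 2 * t ^+ 2 + t ^+ 4.
Proof.
move=> ee.
have -> : (e * u + t) ^+ 4 = (e * e) * (e * e) * u ^+ 4
    + (e * e) * (4 * u ^+ 3 * (e * t)) + 4 * u * (e * t ^+ 3)
    + (e * e) * (6 * u ^+ 2 * t ^+ 2) + t ^+ 4 by ring.
by rewrite ee !mul1r.
Qed.

(** Khinchin's moments, one coordinate u at a time. Odd powers of the new sign average out. With m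
    the previous sum of squares, u^4 + 6 u^2 m + 3 m^2 falls short of 3 (u^2 + m)^2 by 2 u^4. *)
Let moment r y : uniq r ->
  \sum_(s : {ffun 'I_n -> bool}) part r y s ^+ 2 =
    2 ^+ n * \sum_(j <- r) y ord0 j ^+ 2 /\
  \sum_(s : {ffun 'I_n -> bool}) part r y s ^+ 4 <=
    2 ^+ n * (3 * (\sum_(j <- r) y ord0 j ^+ 2) ^+ 2).
Proof.
have card2n : (#|{: {ffun 'I_n -> bool}}|%:R : R) = 2 ^+ n.
  by rewrite card_ffun card_bool card_ord natrX.
elim: r => [_|i r IH /= /andP[ir ur]].
  rewrite /part; under eq_bigr do rewrite big_nil expr0n/=.
  under [X in _ /\ X <= _]eq_bigr do rewrite big_nil expr0n/=.
  by rewrite !big1_eq !big_nil !(mulr0, expr0n).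
have [IH2 IH4] := IH ur.
have partE s : part (i :: r) y s = (-1) ^+ s i * y ord0 i + part r y s.
  by rewrite /part big_cons.
have S1 := sum_sgn_part0 y (fun t => t) ir.
have S3 := sum_sgn_part0 y (fun t => t ^+ 3) ir.
have sq1 (s : {ffun 'I_n -> bool}) : (-1) ^+ s i * (-1) ^+ s i = 1 :> R.
  by rewrite -expr2 sqrr_sign.
have sumc c (G : {ffun 'I_n -> bool} -> R) : \sum_s c * G s = c * \sum_s G s.
  by rewrite mulr_sumr.
rewrite big_cons; move: (\sum_(j <- r) _) IH2 IH4 => m IH2 IH4.
split.
  under eq_bigr => s _ do rewrite partE expand2//.
  rewrite !big_split/= (sumc (2 * y ord0 i)) S1 IH2 sumr_const.
  by rewrite -[X in X + _ + _]mulr_natr card2n; ring.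
under eq_bigr => s _ do rewrite partE expand4//.
rewrite !big_split/= (sumc (4 * _ ^+ 3)) (sumc (4 * _)) (sumc (6 * _)).
rewrite S1 S3 IH2 sumr_const -[X in X + _ + _ + _ + _]mulr_natr card2n.
rewrite !mulr0 !addr0; move: (y ord0 i) => u.
have h : 0 <= 2 ^+ n * u ^+ 4 by rewrite mulr_ge0 ?(@exprn_even_ge0 _ 4)// exprn_ge0.
apply: le_trans (lerD (lexx _) IH4) _; rewrite -subr_ge0.
rewrite (_ : _ - _ = 2 * (2 ^+ n * u ^+ 4)); first by rewrite mulr_ge0.
ring.
Qed.

Let dot_part s y : dot (signv s) y = part (enum 'I_n) y s.
Proof. by rewrite /part big_enum/=; apply: eq_bigr => j _; rewrite mxE. Qed.

Let dotxx_enum y : dot y y = \sum_(j <- enum 'I_n) y ord0 j ^+ 2.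
Proof. by rewrite big_enum/=; apply: eq_bigr => j _; rewrite expr2. Qed.

Lemma sum_dot_signv_sqr y :
  \sum_(s : {ffun 'I_n -> bool}) dot (signv s) y ^+ 2 = 2 ^+ n * dot y y.
Proof.
rewrite dotxx_enum -(moment y (enum_uniq _)).1.
by apply: eq_bigr => s _; rewrite dot_part.
Qed.

Lemma sum_dot_signv_quartic y :
  \sum_(s : {ffun 'I_n -> bool}) dot (signv s) y ^+ 4 <= 2 ^+ n * (3 * dot y y ^+ 2).
Proof.
rewrite dotxx_enum (le_trans _ (moment y (enum_uniq _)).2)//.
by under eq_bigr do rewrite dot_part.
Qed.

Let sum_expR_dot y :
  \sum_(s : {ffun 'I_n -> bool}) expR (dot (signv s) y) <= 2 ^+ n * expR (2 * dot y y).
Proof.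
pose F (j : 'I_n) (b : bool) : R := expR ((-1) ^+ b * y ord0 j).
have -> : \sum_(s : {ffun 'I_n -> bool}) expR (dot (signv s) y) =
    \sum_(s : {ffun 'I_n -> bool}) \prod_j F j (s j).
  apply: eq_bigr => s _; rewrite /dot expR_sum.
  by apply: eq_bigr => j _; rewrite mxE.
rewrite -(bigA_distr_bigA F).
rewrite /dot mulr_sumr expR_sum -[n in 2 ^+ n]card_ord -prodr_const -big_split/=.
apply: ler_prod => j _; rewrite big_bool /F/= expr1 expr0 mulN1r mul1r addrC.
by rewrite addr_ge0 ?expR_ge0// -expr2 expRD_expRN_le.
Qed.

Lemma sum_expR_norm_dot y :
  \sum_(s : {ffun 'I_n -> bool}) expR `|dot (signv s) y| <= 2 ^+ n * (2 * expR (2 * dot y y)).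
Proof.
apply: (@le_trans _ _ (\sum_(s : {ffun 'I_n -> bool})
    (expR (dot (signv s) y) + expR (dot (signv s) (- y))))).
  apply: ler_sum => s _; rewrite dotNr.
  case: (ler0P (dot (signv s) y)) => _.
    by rewrite lerDr expR_ge0.
  by rewrite lerDl expR_ge0.
rewrite big_split/=.
have := sum_expR_dot y; have := sum_expR_dot (- y).
rewrite dotNl dotNr opprK => h1 h2.
rewrite mulrCA mulrDl mul1r; exact: lerD.
Qed.

(** With u = [dot y y], the linear bound on the exponential and the quartic minorant give a mean of
    at most 1 - u / 4 + 3 u^2 / 32, which is below 15 / 16 for u in [1 / 2, 2]. The range is wide
    enough for net points near the sphere. *)
Lemma sum_expRN_min_dot y : 2^-1 <= dot y y <= 2 ->
  \sum_(s : {ffun 'I_n -> bool}) expR (- Num.min 1 `|dot (signv s) y|) <= 2 ^+ n * (15 / 16).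
Proof.
move=> /andP[u1 u2].
apply: (@le_trans _ _ (\sum_(s : {ffun 'I_n -> bool}) (1 - (dot (signv s) y ^+ 2 / 4
    - dot (signv s) y ^+ 4 / 32)))).
  apply: ler_sum => s _; apply: (le_trans (expRN_le_linear _)).
    by rewrite le_min ler01 normr_ge0 ge_min lexx.
  by have := min1_ge_quartic (dot (signv s) y); lra.
rewrite !(big_split, sumrN, sumr_const)/= card_ffun card_bool card_ord natrX.
rewrite -!mulr_suml sum_dot_signv_sqr.
have := sum_dot_signv_quartic y; move: (\sum_(s : {ffun 'I_n -> bool}) _) u1 u2 => Q.
move: (dot y y) => u u1 u2 hQ.
have p0 : 0 <= (2 ^+ n : R) by rewrite exprn_ge0.
(* The product of the distances of u to the endpoints bounds u^2 by a linear function of u. *)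
have : 0 <= 2 ^+ n * ((u - 2^-1) * (2 - u)) by rewrite !mulr_ge0// subr_ge0.
move: (2 ^+ n : R) p0 hQ => p p0 hQ; nra.
Qed.

End sign_vectors.

Section chernoff.
Context {R : realType} {T : finType}.

(** Chernoff's bound as a count: every counted [E] has a product of exponentials at least 1, and the
    sum of these products over all functions is an N-th power. *)
Lemma card_sum_ge (N : nat) (g : T -> R) (a b : R) :
  \sum_s expR (g s - a) <= b ->
  (#|[pred E : {ffun 'I_N -> T} | a *+ N <= \sum_i g (E i)]|%:R : R) <= b ^+ N.
Proof.
move=> gb.
have -> : (#|[pred E : {ffun 'I_N -> T} | a *+ N <= \sum_i g (E i)]|%:R : R)
    = \sum_(E : {ffun 'I_N -> T} | a *+ N <= \sum_i g (E i)) 1.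
  by rewrite sumr_const.
apply: (@le_trans _ _ (\sum_(E : {ffun 'I_N -> T}) \prod_i expR (g (E i) - a))).
  rewrite big_mkcond/=; apply: ler_sum => E _; case: ifP => aE; last first.
    by rewrite prodr_ge0// => i _; rewrite expR_ge0.
  rewrite -expR_sum -expR0 ler_expR big_split/= sumrN sumr_const card_ord.
  by rewrite subr_ge0.
rewrite -(bigA_distr_bigA (fun _ s => expR (g s - a))) prodr_const card_ord.
by rewrite lerXn2r// nnegrE ?(le_trans _ gb)// sumr_ge0// => s _; rewrite expR_ge0.
Qed.

End chernoff.

(** * Sign vectors spread evenly over all directions *)

Section random_signs.
Context {R : realType}.

Lemma expr_unbounded (A r : R) : 0 <= A -> 1 < r -> exists M : nat, (0 < M)%N /\ A < r ^+ M.
Proof.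
move=> A0 r1; have r10 : 0 < r - 1 by rewrite subr_gt0.
exists (Num.truncn (A / (r - 1))).+1; split => //.
have h k : 1 + k%:R * (r - 1) <= r ^+ k.
  elim: k => [|k IH]; first by rewrite mul0r addr0 expr0.
  rewrite exprS -natr1.
  have : r * (1 + k%:R * (r - 1)) <= r * r ^+ k.
    by rewrite ler_wpM2l// (le_trans ler01 (ltW r1)).
  have := mulr_ge0 (mulr_ge0 (ler0n R k) (ltW r10)) (ltW r10).
  lra.
have /andP[_ k2] := truncn_itv (divr_ge0 A0 (ltW r10)).
apply: lt_le_trans (h _).
by rewrite ltr_pdivrMr// in k2; lra.
Qed.

Variable n : nat.
Hypothesis n0 : (0 < n)%N.
Let rn : R := Num.sqrt n%:R.
Let rn0 : 0 < rn. Proof. by rewrite sqrtr_gt0 ltr0n. Qed.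
Let rnn : rn * rn = n%:R. Proof. by rewrite -expr2 sqr_sqrtr. Qed.

(** The unit ball lies in the l^1 ball of radius sqrt n. Rounding r sqrt n x therefore gives [mass]
    at most r n and, after rescaling, a Euclidean error of at most 1 / r, with a number of points
    only exponential in n. *)
Definition net_point (r : nat) (z : {ffun 'I_n -> bool * 'I_(r * n).+1}) : 'rV[R]_n :=
  (r%:R * Num.sqrt n%:R)^-1 *: \row_i sgnat (z i).

Lemma sum_normr_coord_le (x : 'rV[R]_n) : \sum_i `|x ord0 i| <= rn * enorm x.
Proof.
pose s : 'rV[R]_n := \row_i (-1) ^+ (x ord0 i < 0)%R.
have -> : \sum_i `|x ord0 i| = dot s x.
  by apply: eq_bigr => i _; rewrite /s mxE; case: (ltP (x ord0 i) 0) => xi;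
    rewrite ?expr1 ?expr0 ?mulN1r ?mul1r ?(ltr0_norm xi) ?(ger0_norm xi).
apply: (le_trans (ler_norm _)); apply: (le_trans (normr_dot_le _ _)).
rewrite ler_wpM2r ?enorm_ge0// -[rn]mulr1.
by apply: enorm_le_coord => // i; rewrite mxE normr_sign.
Qed.

Lemma net_dense (r : nat) (x : 'rV[R]_n) : (0 < r)%N -> enorm x <= 1 ->
  exists z : {ffun 'I_n -> bool * 'I_(r * n).+1},
    (mass z <= r * n)%N /\ enorm (x - net_point z) <= r%:R^-1.
Proof.
move=> r0 x1.
have c0 : 0 < r%:R * rn by rewrite mulr_gt0 ?ltr0n.
have [|z [zm zx]] := @round_mass R n (r * n) (fun i => r%:R * rn * x ord0 i).
  under eq_bigr do rewrite normrM (gtr0_norm c0).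
  rewrite -mulr_sumr natrM -mulrA ler_wpM2l// -rnn ler_wpM2l ?(ltW rn0)//.
  by rewrite (le_trans (sum_normr_coord_le x))// ler_piMr ?(ltW rn0).
exists z; split => //.
have -> : r%:R^-1 = rn * (r%:R * rn)^-1 :> R.
  by rewrite invfM mulrCA divff ?mulr1// gt_eqF.
apply: enorm_le_coord => [|i]; first by rewrite invr_ge0 ltW.
rewrite !mxE -[x ord0 i](mulKf (lt0r_neq0 c0)) -mulrBr normrM.
by rewrite gtr0_norm ?invr_gt0// ler_piMr ?invr_ge0 ?(ltW c0).
Qed.

Let F N (E : 'I_N -> {ffun 'I_n -> bool}) (x : 'rV[R]_n) : R :=
  \sum_i `|dot (signv (E i)) x|.

Let G N (E : 'I_N -> {ffun 'I_n -> bool}) (x : 'rV[R]_n) : R :=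
  \sum_i Num.min 1 `|dot (signv (E i)) x|.

(* Union bound over the net: by Chernoff each of the at most 2 ^ (r n) 4 ^ n
   net points rules out two fractions (30 / 31) ^ (M n) of all choices of E. *)
Lemma net_good_signs (r M : nat) : 2 * (2 ^+ r * 4) < (31 / 30 : R) ^+ M ->
  exists E : 'I_(M * n) -> {ffun 'I_n -> bool},
  forall z : {ffun 'I_n -> bool * 'I_(r * n).+1}, (mass z <= r * n)%N ->
    (dot (net_point z) (net_point z) <= 4 ->
       F E (net_point z) <= 12 * (M * n)%:R) /\
    (2^-1 <= dot (net_point z) (net_point z) <= 2 ->
       (M * n)%:R / 32 <= G E (net_point z)).
Proof.
move=> HM; set N := (M * n)%N.
pose bad1 z (E : {ffun 'I_N -> {ffun 'I_n -> bool}}) :=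
  (dot (@net_point r z) (net_point z) <= 4) && (12 *+ N <= F E (net_point z)).
pose bad2 z (E : {ffun 'I_N -> {ffun 'I_n -> bool}}) :=
  (2^-1 <= dot (@net_point r z) (net_point z) <= 2)
  && ((- (1 / 32)) *+ N <= \sum_i (- Num.min 1 `|dot (signv (E i)) (net_point z)|)).
have b0 : 0 <= 2 ^+ n * (30 / 31) :> R by rewrite mulr_ge0 ?exprn_ge0.
have c1 z : (#|[pred E | bad1 z E]|%:R : R) <= (2 ^+ n * (30 / 31)) ^+ N.
  rewrite /bad1; case: (leP (dot _ _) 4) => /= z4; last first.
    by rewrite (eq_card0 (fun _ => erefl)) exprn_ge0.
  apply: (@card_sum_ge _ _ N (fun s => `|dot (signv s) (net_point z)|)).
  under eq_bigr do rewrite expRD; rewrite -mulr_suml.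
  apply: le_trans (ler_wpM2r (expR_ge0 _) (sum_expR_norm_dot _)) _.
  rewrite -!mulrA ler_wpM2l ?exprn_ge0//.
  (* The exponent is 2 * 4 - 12: square norm at most 4 in the exponential moment, against the
     threshold 12. *)
  apply: (@le_trans _ _ (2 * expR (- 4))).
    by rewrite ler_wpM2l// -expRD ler_expR; lra.
  rewrite expRN ler_pdivrMr ?expR_gt0//.
  have := expR_ge1Dx (4 : R); lra.
have c2 z : (#|[pred E | bad2 z E]|%:R : R) <= (2 ^+ n * (30 / 31)) ^+ N.
  rewrite /bad2; case: (boolP (2^-1 <= _ <= 2)) => /= z4; last first.
    by rewrite (eq_card0 (fun _ => erefl)) exprn_ge0.
  apply: (@card_sum_ge _ _ N (fun s => - Num.min 1 `|dot (signv s) (net_point z)|)).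
  under eq_bigr do rewrite expRD; rewrite -mulr_suml.
  apply: le_trans (ler_wpM2r (expR_ge0 _) (sum_expRN_min_dot z4)) _.
  rewrite -!mulrA ler_wpM2l ?exprn_ge0// opprK.
  (* The origin of the ratio: 15 / 16 * (32 / 31) = 30 / 31. *)
  have h : expR (1 / 32) <= 32 / 31 :> R.
    apply: (le_trans (expR_le_inv _)); first lra.
    by rewrite -[leLHS]div1r ler_pdivrMr; lra.
  lra.
apply: contrapT => nE.
have allbad (E : {ffun 'I_N -> {ffun 'I_n -> bool}}) :
    exists2 z : {ffun 'I_n -> bool * 'I_(r * n).+1},
      (mass z <= r * n)%N & bad1 z E || bad2 z E.
  apply: contrapT => nz; apply: nE; exists E => z zm.
  have nb : ~~ (bad1 z E || bad2 z E).
    by apply/negP => b; apply: nz; exists z.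
  move: nb; rewrite negb_or /bad1 /bad2 => /andP[nb1 nb2]; split.
    move=> z4; move: nb1; rewrite z4/= -ltNge => /ltW.
    by rewrite -mulr_natr.
  move=> z4; move: nb2; rewrite z4/= -ltNge => /ltW.
  rewrite sumrN lerNl => h; apply: le_trans h.
  by rewrite mulNrn opprK -mulr_natr; lra.
have : (2 ^+ n) ^+ N <= \sum_(z : {ffun 'I_n -> bool * 'I_(r * n).+1}
    | (mass z <= r * n)%N) (2 * (2 ^+ n * (30 / 31)) ^+ N) :> R.
  have -> : (2 ^+ n) ^+ N = \sum_(E : {ffun 'I_N -> {ffun 'I_n -> bool}}) 1 :> R.
    by rewrite sumr_const !card_ffun card_bool !card_ord !natrX.
  apply: (@le_trans _ _ (\sum_(E : {ffun 'I_N -> {ffun 'I_n -> bool}})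
     \sum_(z : {ffun 'I_n -> bool * 'I_(r * n).+1} | (mass z <= r * n)%N)
        ((bad1 z E)%:R + (bad2 z E)%:R))).
    apply: ler_sum => E _; have [z zm zb] := allbad E.
    rewrite (bigD1 z)//= -[X in X <= _]addr0 lerD//.
      by case/orP: zb => ->; rewrite ?lerDl ?lerDr ler0n.
    by apply: sumr_ge0 => z' _; rewrite addr_ge0.
  rewrite exchange_big/=; apply: ler_sum => z _.
  rewrite big_split/= mulrDl mul1r lerD// -!natr_sum.
    by rewrite -(big_mkcond (bad1 z) (fun=> 1%N)) sum1_card c1.
  by rewrite -(big_mkcond (bad2 z) (fun=> 1%N)) sum1_card c2.
rewrite sumr_const -[_ *+ #|_|]mulr_natr; apply/negP; rewrite -ltNge.
apply: le_lt_trans (ler_wpM2l _ (@card_mass_le R n (r * n))) _.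
  by rewrite mulr_ge0// exprn_ge0.
rewrite exprMn -mulrA -[ltRHS]mulr1 mulrCA -mulrA ltr_pM2l ?exprn_gt0 ?exprn_gt0//.
have q0 : 0 < 31 / 30 :> R by rewrite divr_gt0.
have -> : 30 / 31 = (31 / 30)^-1 :> R by rewrite invf_div.
move: (31 / 30) q0 HM => q q0 HM.
rewrite [ltLHS]mulrC exprVn ltr_pdivrMr ?exprn_gt0//.
rewrite mul1r exprM -exprMn exprM.
(* The factor 2 counts the two ways to fail; as 2 <= 2 ^ n, both sides can be compared as n-th
   powers. *)
apply: (@le_lt_trans _ _ ((2 * (2 ^+ r * 4)) ^+ n)).
  rewrite [leRHS]exprMn ler_wpM2r ?exprn_ge0 ?mulr_ge0 ?exprn_ge0//.
  by rewrite -[leLHS]expr1 ler_eXn2l ?ltr1n.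
rewrite ltr_pXn2r ?nnegrE ?exprn_ge0 ?mulr_ge0 ?exprn_ge0//; last by lra.
Qed.

(** A net point close to the unit ball has norm at most 2 and costs 12 N, the remainder has norm at
    most 1 / 2, and 24 solves 12 + 24 / 2 = 24. In the limit the dimension-dependent excess
    disappears. *)
Lemma sign_frame_upper (r M : nat) (E : 'I_(M * n) -> {ffun 'I_n -> bool}) :
  (2 <= r)%N ->
  (forall z : {ffun 'I_n -> bool * 'I_(r * n).+1}, (mass z <= r * n)%N ->
    dot (net_point z) (net_point z) <= 4 -> F E (net_point z) <= 12 * (M * n)%:R) ->
  forall x, F E x <= 24 * (M * n)%:R * enorm x.
Proof.
move=> r2 HE; set N := (M * n)%N in E HE *.
have r0 : (0 < r)%N by exact: ltn_trans r2.
have rR : (r%:R : R)^-1 <= 2^-1 by rewrite lef_pV2 ?posrE ?ltr0n// ler_nat.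
have FD x y : F E (x + y) <= F E x + F E y.
  by rewrite -big_split; apply: ler_sum => i _; rewrite dotDr ler_normD.
have FZ a x : F E (a *: x) = `|a| * F E x.
  by rewrite mulr_sumr; apply: eq_bigr => i _; rewrite dotZr normrM.
have Fcrude x : F E x <= N%:R * (rn * enorm x).
  rewrite mulr_natl -[N in leRHS]card_ord -sumr_const; apply: ler_sum => i _.
  apply: (le_trans (normr_dot_le _ _)); rewrite ler_wpM2r ?enorm_ge0//.
  by rewrite -[rn]mulr1; apply: enorm_le_coord => // j; rewrite mxE normr_sign.
(* Writing x = y + (x - y) with y in the net and |x - y| <= 1 / 2 halves the
   error of the crude bound. *)
have Fk k x : enorm x <= 1 -> F E x <= 24 * N%:R + 2^-1 ^+ k * (N%:R * rn).
  elim: k x => [|k IH] x x1.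
    rewrite expr0 mul1r (le_trans (Fcrude x))// ler_wpDl ?mulr_ge0//.
    by rewrite ler_wpM2l// ler_piMr ?(ltW rn0).
  have [z [zm zx]] := net_dense r0 x1; set y := net_point z in zx.
  have y2 : enorm y <= 2.
    rewrite -[y](subrK x) addrC (le_trans (ler_enormD _ _))// enorm_distC.
    by move: zx rR x1; lra.
  have -> : x = y + 2^-1 *: (2 *: (x - y)).
    by rewrite scalerA mulVf// scale1r addrC subrK.
  apply: (le_trans (FD _ _)); rewrite (FZ 2^-1) ger0_norm//.
  have h1 : F E y <= 12 * N%:R.
    by apply: HE => //; rewrite -sqr_enorm (_ : 4 = 2 ^+ 2)// ?ler_sqr ?nnegrE ?enorm_ge0//; ring.
  have h2 : F E (2 *: (x - y)) <= 24 * N%:R + 2^-1 ^+ k * (N%:R * rn).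
    by apply: IH; rewrite enormZ ger0_norm//; move: zx rR; lra.
  by rewrite exprS; move: h1 h2; lra.
have F1 x : enorm x <= 1 -> F E x <= 24 * N%:R.
  move=> x1; apply/ler_addgt0Pr => e e0.
  have a0 : 0 <= N%:R * rn / e by rewrite divr_ge0 ?mulr_ge0// ltW.
  have [k [_ ke]] := expr_unbounded a0 (ltr1n R 2).
  apply: (le_trans (Fk k x x1)); rewrite lerD2l exprVn mulrC.
  by rewrite ler_pdivrMr ?exprn_gt0// [leRHS]mulrC -ler_pdivrMr// ltW.
move=> x; have [x0|x0] := eqVneq (enorm x) 0.
  by apply: (le_trans (Fcrude x)); rewrite x0 !mulr0.
have xp : 0 < enorm x by rewrite lt_def x0 enorm_ge0.
rewrite -[x in F E x](scalerKV x0) FZ (gtr0_norm xp) mulrC ler_wpM2r ?enorm_ge0//.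
by apply: F1; rewrite enormZ gtr0_norm ?invr_gt0// mulVf.
Qed.

(** Truncation at 1 is 1-Lipschitz, so moving from a net point to x costs at most 24 N / 1536 = N /
    64, half of N / 32. Each truncated term is at most 1, and below 1 / 128 outside the counted set;
    a total of N / 64 thus forces at least N / 128 counted indices. *)
Lemma sign_frame_lower (r M : nat) (E : 'I_(M * n) -> {ffun 'I_n -> bool}) :
  (0 < r)%N -> (r%:R : R)^-1 <= 1536^-1 ->
  (forall x, F E x <= 24 * (M * n)%:R * enorm x) ->
  (forall z : {ffun 'I_n -> bool * 'I_(r * n).+1}, (mass z <= r * n)%N ->
    2^-1 <= dot (net_point z) (net_point z) <= 2 ->
    (M * n)%:R / 32 <= G E (net_point z)) ->
  forall x : 'rV[R]_n, enorm x = 1 ->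
    (M * n)%:R / 128 <= #|[pred i | 1 / 128 <= `|dot (signv (E i)) x|]|%:R :> R.
Proof.
move=> r0 rR HF HE x x1; set N := (M * n)%N in E HF HE *.
have x1' : enorm x <= 1 by rewrite x1.
have [z [zm zx]] := net_dense r0 x1'; set y := net_point z in zx.
have y2 : enorm y <= 1 + 1536^-1.
  rewrite -[y](subrK x) addrC (le_trans (ler_enormD _ _))// enorm_distC x1.
  by move: zx rR; lra.
have y1 : 1 - 1536^-1 <= enorm y.
  have := ler_enormD y (x - y); rewrite addrC subrK x1.
  by move: zx rR; lra.
have hG : N%:R / 32 <= G E y.
  by apply: HE => //; rewrite -sqr_enorm expr2; apply/andP; split; nra.
have hxy : G E y <= G E x + F E (x - y).
  rewrite -big_split; apply: ler_sum => i _; rewrite dotBr -/y /=.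
  rewrite distrC; have := ler_normB (dot (signv (E i)) y) (- dot (signv (E i)) x).
  have := ler_normD (dot (signv (E i)) y - dot (signv (E i)) x) (dot (signv (E i)) x).
  rewrite subrK; move: (normr_ge0 (dot (signv (E i)) y - dot (signv (E i)) x)).
  by case: (leP 1 `|dot (signv (E i)) y|); case: (leP 1 `|dot (signv (E i)) x|); lra.
have hF : F E (x - y) <= N%:R / 64.
  apply: le_trans (HF _) _.
  have := ler_wpM2l (ler0n R (24 * N)) (le_trans zx rR).
  by rewrite natrM; lra.
have hx : N%:R / 64 <= G E x by move: hG hxy hF; lra.
have hc : G E x <= \sum_i ((1 / 128 <= `|dot (signv (E i)) x|)%R%:R + 1 / 128).
  apply: ler_sum => i _; case: (leP (1 / 128) `|dot (signv (E i)) x|) => h /=.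
    by rewrite ge_min lerDl divr_ge0.
  by rewrite ge_min add0r (ltW h) orbT.
rewrite big_split/= sumr_const card_ord in hc.
rewrite -natr_sum -(big_mkcond (fun i => _) (fun=> 1%N)) sum1_card in hc.
rewrite -[1 / 128 *+ N]mulr_natl in hc.
by move: hx hc; lra.
Qed.

End random_signs.

(** [M] is determined by the mesh [r] alone, before [n], so that the later constants do not depend
    on the dimension. *)
Lemma sign_frame (R : realType) : exists M : nat, (0 < M)%N /\
  forall n, (0 < n)%N -> exists E : 'I_(M * n) -> {ffun 'I_n -> bool},
  (forall x : 'rV[R]_n,
     \sum_i `|dot (signv (E i)) x| <= 24 * (M * n)%:R * enorm x) /\
  (forall x : 'rV[R]_n, enorm x = 1 ->
    (M * n)%:R / 128 <= #|[pred i | 1 / 128 <= `|dot (signv (E i)) x|]|%:R :> R).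
Proof.
have [k [k0 kb]] := expr_unbounded (ler0n R 1536) (ltr1n R 2).
pose r := (2 ^ k)%N.
have r1 : (2 <= r)%N by rewrite -[leqLHS]expn1 leq_exp2l.
have r0 : (0 < r)%N by exact: ltn_trans r1.
have r2 : (r%:R : R)^-1 <= 1536^-1.
  by rewrite natrX lef_pV2 ?posrE ?ltr0n ?exprn_gt0// ltW.
have A0 : 0 <= 2 * (2 ^+ r * 4) :> R by rewrite !mulr_ge0// exprn_ge0.
have /(expr_unbounded A0)[M [M0 HM]] : 1 < 31 / 30 :> R by lra.
exists M; split => // n n0; have [E HE] := net_good_signs n0 HM.
have HF := sign_frame_upper n0 r1 (fun z zm => (HE z zm).1).
exists E; split; first exact: HF.
exact: (sign_frame_lower n0 r0 r2 HF (fun z zm => (HE z zm).2)).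
Qed.

(** * Flat mixtures of one-dimensional Gaussians *)

Section gauss_sums.
Context {R : realType}.
Implicit Types x h t s : R.

Definition gauss x : R := expR (- (x ^+ 2 / 2)).

Lemma gauss_ge0 x : 0 <= gauss x. Proof. exact: expR_ge0. Qed.

Lemma gauss_le1 x : gauss x <= 1.
Proof. by rewrite /gauss expR_le1 oppr_le0 mulr_ge0 ?sqr_ge0 ?invr_ge0. Qed.

Lemma gaussN x : gauss (- x) = gauss x.
Proof. by rewrite /gauss sqrrN. Qed.

(* The increments of W dominate the Gaussian, so Gaussian sums telescope. *)
Let W x := x / (1 + `|x|).

Let W_bound x : - 1 <= W x <= 1.
Proof.
have x1 : 0 < 1 + `|x| by rewrite ltr_pwDl.
rewrite /W ler_pdivlMr// ler_pdivrMr//.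
have := ler_norm x; have := ler_norm (- x); rewrite normrN; lra.
Qed.

Let W_incr a b : a <= b -> (b - a) / ((1 + `|a|) * (1 + `|b|)) <= W b - W a.
Proof.
move=> ab; have a1 : 0 < 1 + `|a| by rewrite ltr_pwDl.
have b1 : 0 < 1 + `|b| by rewrite ltr_pwDl.
have -> : W b - W a = (b * (1 + `|a|) - a * (1 + `|b|)) / ((1 + `|a|) * (1 + `|b|)).
  by rewrite /W; field; rewrite !gt_eqF.
rewrite ler_pM2r ?invr_gt0 ?mulr_gt0//.
case: (ler0P a) => a0; case: (ler0P b) => b0; nra.
Qed.

(** Since e^(x^2 / 2) >= 1 + x^2 / 2, it suffices that 5 (1 + x^2 / 2) exceeds (1 + |x|) (2 + |x|);
    the difference is 3 / 2 ((|x| - 1)^2 + 1). *)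
Let gauss_le_W x h : 0 < h <= 1 -> h * gauss x <= 5 * (W (x + h) - W x).
Proof.
move=> /andP[h0 h1]; have xh : x <= x + h by rewrite lerDl ltW.
apply: le_trans (ler_wpM2l _ (W_incr xh)); last by [].
have x1 : 0 < 1 + `|x| by rewrite ltr_pwDl.
have y1 : 0 < 1 + `|x + h| by rewrite ltr_pwDl.
have x2 : 0 < 1 + x ^+ 2 / 2 by rewrite ltr_pwDl// mulr_ge0 ?sqr_ge0.
rewrite (addrC x h) addrK mulrCA ler_pM2l// -/(h / _).
rewrite ler_pdivlMr ?mulr_gt0//.
have g1 : gauss x <= (1 + x ^+ 2 / 2)^-1.
  by rewrite /gauss expRN lef_pV2 ?posrE ?expR_gt0// expR_ge1Dx.
apply: le_trans (ler_wpM2r _ g1) _; first by rewrite mulr_ge0// ltW.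
rewrite mulrC ler_pdivrMr//.
have hx : `|h + x| <= `|x| + 1.
  by rewrite (le_trans (ler_normD _ _))// addrC lerD2l gtr0_norm.
have : (1 + `|x|) * (1 + `|h + x|) <= (1 + `|x|) * (2 + `|x|).
  by rewrite ler_pM2l//; lra.
rewrite -[x ^+ 2]real_normK ?num_real//; have := sqr_ge0 (`|x| - 1); nra.
Qed.

Lemma sum_gauss_le (m : nat) x h : 0 < h <= 1 ->
  h * (\sum_(k < m) gauss (x + h * k%:R)) <= 10.
Proof.
move=> h01; rewrite mulr_sumr.
apply: (@le_trans _ _ (\sum_(0 <= k < m)
    (5 * W (x + h * k.+1%:R) - 5 * W (x + h * k%:R)))).
  rewrite big_mkord; apply: ler_sum => k _.
  rewrite -mulrBr (_ : x + h * k.+1%:R = x + h * k%:R + h) ?gauss_le_W//.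
  by rewrite -natr1; ring.
rewrite telescope_sumr//.
(* [W] grows by at most 2 in total, which turns 5 into 10. *)
have := W_bound (x + h * m%:R); have := W_bound (x + h * 0%:R); lra.
Qed.

(** The points form a progression of mesh |s| / m <= 1; as the Gaussian is even, it may be taken
    increasing. *)
Lemma sum_gauss_step_le (m : nat) t s : 0 < `|s| <= m%:R ->
  \sum_(k < m) gauss (t - s * (k%:R / m%:R)) <= 10 * (m%:R / `|s|).
Proof.
move=> /andP[s0 sm]; have m0 : 0 < m%:R :> R by exact: lt_le_trans sm.
have h01 : 0 < `|s| / m%:R <= 1 by rewrite divr_gt0// ler_pdivrMr ?mul1r.
have [x Hx] : exists x, forall k : 'I_m,
    gauss (t - s * (k%:R / m%:R)) = gauss (x + `|s| / m%:R * k%:R).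
  case: (ltrgtP 0 s) => s1.
  - by exists (- t) => k; rewrite -gaussN gtr0_norm//; congr gauss; ring.
  - by exists t => k; rewrite ltr0_norm//; congr gauss; ring.
  - by move: s0; rewrite -s1 normr0 ltxx.
under eq_bigr do rewrite Hx.
rewrite -[leLHS](mulKf (lt0r_neq0 (andP h01).1)) invf_div mulrC ler_wpM2r//.
exact: sum_gauss_le.
Qed.

End gauss_sums.

Section gauss_mixture.
Context {R : realType}.
Variables (n N : nat) (theta : 'I_N -> 'rV[R]_n).
Hypothesis n0 : (0 < n)%N.
Let rn : R := Num.sqrt n%:R.
(** Keeps the mesh s |<theta i, x>| / n of each progression at most 1. *)
Hypothesis theta_le : forall i x, enorm x = 1 -> `|dot (theta i) x| <= n%:R.
Variables c q rho : R.
Hypotheses (c0 : 0 < c) (q0 : 0 <= q) (rho0 : 0 < rho) (rho1 : rho < 1).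
Hypothesis theta_spread : forall x, enorm x = 1 ->
  N%:R * (1 - q) <= #|[pred i | rn * c <= `|dot (theta i) x|]|%:R :> R.
Hypothesis N0 : (0 < N)%N.

(* Going from A to the points a + s (k / n) theta i: the directions i in which
   |<theta i, x>| >= c sqrt n give Riemann sums of a Gaussian, hence the term
   10 / c; the other ones, a fraction q, are left to A, built at scale s rho. *)
Lemma gauss_mixture_flat (C : R) (K : nat) (s : R) :
  0 <= C -> 10 / c + C * (q / rho) <= C -> 0 < s <= 1 ->
  exists A : seq 'rV[R]_n, [/\ (0 < size A)%N,
    (forall a, a \in A -> exists2 y : 'I_N -> R,
       \sum_i `|y i| <= s / (1 - rho) & a = \sum_i y i *: theta i) &
    forall x t, enorm x = 1 -> \sum_(a <- A) gauss (t - dot a x)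
       <= (size A)%:R * (q ^+ K + C / (s * rn))].
Proof.
move=> C0 HC; have rn0 : 0 < rn by rewrite sqrtr_gt0 ltr0n.
elim: K s => [|K IH] s /andP[s0 s1].
  exists [:: 0]; split => [//|a|x t x1].
    rewrite inE => /eqP ->; exists (fun=> 0).
      by rewrite big1 ?divr_ge0 ?(ltW s0) ?subr_ge0 ?(ltW rho1)// => i _; rewrite normr0.
    by rewrite big1// => i _; rewrite scale0r.
  rewrite big_seq1 mul1r expr0 (le_trans (gauss_le1 _))// lerDl.
  by rewrite divr_ge0// mulr_ge0// ltW.
have [|A [A0 AH AG]] := IH (s * rho).
  by rewrite mulr_gt0//= mulr_ile1 ?(ltW s0) ?(ltW rho0) ?(ltW rho1).
pose w (p : 'I_N * 'I_n) : R := s * (p.2%:R / n%:R).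
exists [seq a + w p *: theta p.1 | a <- A, p <- enum {: 'I_N * 'I_n}].
have szE : size [seq a + w p *: theta p.1 | a <- A,
    p <- enum {: 'I_N * 'I_n}] = (size A * (N * n))%N.
  by rewrite size_allpairs -cardE card_prod !card_ord.
split.
- by rewrite szE !muln_gt0 A0 N0 n0.
- move=> _ /allpairsP[[a p] /= [/AH[y ys ->] _ ->]].
  exists (fun i => y i + (if i == p.1 then w p else 0)).
    apply: (@le_trans _ _ (\sum_i (`|y i| + (if i == p.1 then w p else 0)))).
      apply: ler_sum => i _; apply: (le_trans (ler_normD _ _)).
      rewrite lerD2l; case: ifP => _; rewrite ?normr0//.
      by rewrite ger0_norm// mulr_ge0 ?divr_ge0// ltW.
    rewrite big_split/= -big_mkcond/= big_pred1_eq.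
    have : w p <= s.
      rewrite /w ler_piMr ?(ltW s0)// ler_pdivrMr ?ltr0n// mul1r ler_nat.
      exact: ltnW.
    (* The lengths s, s rho, s rho^2, ... add up to s / (1 - rho). *)
    have -> : s / (1 - rho) = s * rho / (1 - rho) + s.
      by field; rewrite subr_eq0 gt_eqF.
    by move=> ws; exact: lerD.
  under [RHS]eq_bigr do rewrite scalerDl.
  rewrite big_split/=; congr (_ + _).
  rewrite (bigD1 p.1)//= eqxx big1 ?addr0// => i /negbTE ->.
  by rewrite scale0r.
move=> x t x1; rewrite szE big_allpairs_dep/=.
under eq_bigr do rewrite big_enum/=.
set g := q ^+ K + C / (s * rho * rn).
have AG' u : \sum_(a <- A) gauss (u - dot a x) <= (size A)%:R * g.
  exact: AG.
have -> : \sum_(a <- A) \sum_p gauss (t - dot (a + w p *: theta p.1) x) =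
    \sum_(i < N) \sum_(k < n) \sum_(a <- A)
      gauss (t - w (i, k) * dot (theta i) x - dot a x).
  rewrite pair_bigA exchange_big/=; apply: eq_bigr => -[i k] _.
  apply: eq_bigr => a _; congr gauss; rewrite dotDl dotZl/=; ring.
pose good := [pred i | rn * c <= `|dot (theta i) x|].
pose u : R := 10 / c / (s * rn).
have nA0 : 0 <= n%:R * (size A)%:R :> R by rewrite mulr_ge0.
have g0 : 0 <= g.
  by rewrite addr_ge0 ?exprn_ge0// divr_ge0// !mulr_ge0 ?ltW.
have u0 : 0 <= u by rewrite !divr_ge0 ?mulr_ge0 ?ltW.
(* For a good direction the sum over k at fixed a is a Riemann sum; for a bad one the sum over a at
   fixed k is bounded by induction, at a shifted height. *)
apply: (@le_trans _ _ (\sum_(i < N) n%:R * (size A)%:R * (u + (~~ good i)%:R * g))).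
  apply: ler_sum => i _; case: (boolP (good i)) => gi /=.
    rewrite mul0r addr0 exchange_big/=.
    have d0 : 0 < `|dot (theta i) x| by apply: lt_le_trans gi; rewrite mulr_gt0.
    apply: (@le_trans _ _ (\sum_(a <- A) n%:R * u)); last first.
      by rewrite big_const_seq count_predT iter_addr_0 -[_ *+ size A]mulr_natr mulrAC.
    apply: ler_sum => a _.
    have sd : `|s * dot (theta i) x| = s * `|dot (theta i) x|.
      by rewrite normrM gtr0_norm.
    have sdn : 0 < `|s * dot (theta i) x| <= n%:R.
      rewrite sd mulr_gt0//= (le_trans _ (theta_le i x1))//.
      by rewrite ler_piMl.
    have := @sum_gauss_step_le R n (t - dot a x) _ sdn.
    rewrite (_ : \sum_(k < n) _ = \sum_(k < n) gauss (t - w (i, k) * dot (theta i) x - dot a x)).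
      move=> /le_trans; apply; rewrite mulrCA ler_wpM2l// sd /u.
      rewrite ler_pdivrMr ?mulr_gt0// mulrAC ler_pdivlMr ?mulr_gt0//.
      have rd : rn <= `|dot (theta i) x| / c by rewrite ler_pdivlMr.
      have -> : 10 / c * (s * `|dot (theta i) x|) = 10 * (s * (`|dot (theta i) x| / c)).
        by ring.
      by rewrite !ler_wpM2l ?(ltW s0).
    by apply: eq_bigr => k _; congr gauss; rewrite /w/=; ring.
  have -> : n%:R * (size A)%:R * (u + 1 * g) = \sum_(k < n) (size A)%:R * (u + g).
    by rewrite sumr_const card_ord mul1r -mulrA mulr_natl.
  apply: ler_sum => k _; apply: (le_trans (AG' _)).
  by rewrite ler_wpM2l// lerDr.
rewrite -mulr_sumr big_split/= sumr_const card_ord -mulr_suml -natr_sum.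
have cb : (\sum_(i < N) ~~ good i)%:R <= N%:R * q :> R.
  have : (\sum_(i < N) ~~ good i + #|good|)%:R = N%:R :> R.
    congr (_%:R); rewrite -(big_mkcond (fun i => ~~ good i) (fun=> 1%N)) sum1_card.
    by rewrite addnC; have := cardC good; rewrite card_ord.
  rewrite natrD; have := theta_spread x1; rewrite -/good; lra.
rewrite natrM natrM (mulrC N%:R) mulrA (mulrC (size A)%:R) -[leRHS]mulrA.
rewrite ler_wpM2l//.
apply: le_trans (lerD (lexx _) (ler_wpM2r g0 cb)) _.
rewrite -[u *+ N]mulr_natl -[N%:R * q * g]mulrA -mulrDr ler_wpM2l//.
(* The inherited term C / (s rho sqrt n) comes with weight q, so the assumption on [C] is what
   closes the recursion. *)
have -> : u + q * g = q ^+ K.+1 + (10 / c + C * (q / rho)) / (s * rn).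
  by rewrite /u /g exprS; field; rewrite !gt_eqF.
by rewrite lerD2l ler_wpM2r// invr_ge0 mulr_ge0// ltW.
Qed.

End gauss_mixture.

(** * Hausdorff measure is at most Lebesgue measure along isometries *)

Section nneseries_pairs.
Local Open Scope ereal_scope.
Context {R : realType}.

(** Merges a sequence of covers into a single one; surjectivity of [f] ensures that no covering set
    is lost. *)
Lemma nneseries_pair (a : nat -> nat -> \bar R) : (forall i j, 0 <= a i j) ->
  exists f : nat -> nat * nat, (forall p, exists k, f k = p) /\
    \sum_(k <oo) a (f k).1 (f k).2 = \sum_(i <oo) \sum_(j <oo) a i j.
Proof.
move=> a0; have /card_esym/ppcard_eqP[f] := card_nat2.
exists f; split.
  by move=> p; exists (f^-1%FUN p); rewrite invK ?inE.
rewrite nneseries_esumT; last by move=> k; exact: a0.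
rewrite -(@reindex_esum _ _ _ [set: nat] [set: nat * nat] f
  (fun p => a p.1 p.2)); last exact: bij.
rewrite nneseries_esumT; last by move=> k; exact: nneseries_ge0.
under [RHS]eq_esum do rewrite nneseries_esumT//.
rewrite esum_esum//; congr esum.
by apply/seteqP; split.
Qed.

End nneseries_pairs.

(** * Covering infima at a fixed mesh as outer measures *)

Section hausdorff_delta_outer.
Local Open Scope ereal_scope.
Context {R : realType} {n : nat}.
Implicit Types (A U : set 'rV[R]_n) (d : nat) (delta : R).

Lemma ediam_ge0 U : U !=set0 -> 0 <= ediam U.
Proof.
move=> [x Ux]; apply: (@le_trans _ _ (enorm (x - x))%:E).
  by rewrite lee_fin enorm_ge0.
by apply: ereal_sup_ubound; exists (x, x).
Qed.

Lemma ediam_le U (r : R) :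
  (forall x y, U x -> U y -> (enorm (x - y) <= r)%R) -> ediam U <= r%:E.
Proof.
by move=> Ur; apply: ge_ereal_sup => _ [[x y] [Ux Uy] <-]; rewrite lee_fin Ur.
Qed.

Lemma ediam_set0 (r : R) : ediam (set0 : set 'rV[R]_n) <= r%:E.
Proof. by apply: ediam_le. Qed.

Lemma hausdorff_weight_ge0 d U : 0 <= hausdorff_weight d U.
Proof.
rewrite /hausdorff_weight; case: asboolP => // U0.
rewrite mule_ge0// expe_ge0// mule_ge0 ?lee_fin//.
by apply: ediam_ge0; apply/set0P/eqP.
Qed.

Lemma hausdorff_weight0 d : hausdorff_weight d (set0 : set 'rV[R]_n) = 0.
Proof. by rewrite /hausdorff_weight; case: asboolP. Qed.

Lemma le_expe (x y : \bar R) k : 0 <= x -> x <= y -> x ^+ k <= y ^+ k.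
Proof.
move=> x0 xy; elim: k => [|k IH]; first by rewrite !expe0.
by rewrite !expeS lee_pmul// expe_ge0.
Qed.

Lemma hausdorff_weight_le d U (r : R) : (0 <= r)%R ->
  (forall x y, U x -> U y -> (enorm (x - y) <= 2 * r)%R) ->
  hausdorff_weight d U <= lebesgue_rV (unit_ball R d) * (r%:E ^+ d).
Proof.
move=> r0 Ur; rewrite /hausdorff_weight; case: asboolP => [U0|/eqP/set0P U0].
  by rewrite mule_ge0// expe_ge0.
rewrite lee_wpmul2l// le_expe//.
  by rewrite mule_ge0 ?lee_fin// ediam_ge0.
rewrite (_ : r%:E = 2^-1%:E * (2 * r)%:E); last first.
  by rewrite -EFinM mulrA mulVf// mul1r.
by rewrite lee_wpmul2l ?lee_fin// ediam_le.
Qed.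

Lemma hausdorff_delta_le_cover d delta A (U : (set 'rV[R]_n)^nat) :
  (forall k, ediam (U k) <= delta%:E) -> A `<=` \bigcup_k U k ->
  hausdorff_delta d delta A <= \sum_(k <oo) hausdorff_weight d (U k).
Proof. by move=> Ud AU; apply: ereal_inf_lbound; exists U. Qed.

Let hausdorff_delta_ge0 d delta A : 0 <= hausdorff_delta d delta A.
Proof.
apply: le_ereal_inf_tmp => _ [U _ <-].
by apply: nneseries_ge0 => k _ _; exact: hausdorff_weight_ge0.
Qed.

Let hausdorff_delta0 d delta : hausdorff_delta d delta (set0 : set 'rV[R]_n) = 0.
Proof.
apply/eqP; rewrite eq_le hausdorff_delta_ge0 andbT.
apply: le_trans (@hausdorff_delta_le_cover d delta _ (fun=> set0) _ _) _ => //.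
  by move=> k; exact: ediam_set0.
by rewrite eseries0// => k _ _; rewrite hausdorff_weight0.
Qed.

Let le_hausdorff_delta d delta :
  {homo @hausdorff_delta R n d delta : A B / A `<=` B >-> A <= B}.
Proof.
move=> A B AB; apply: ereal_inf_le_tmp => _ [U [Ud BU] <-].
by exists U => //; split => //; exact: subset_trans BU.
Qed.

Let hausdorff_delta_subadditive d delta :
  sigma_subadditive (@hausdorff_delta R n d delta).
Proof.
move=> A; set mu := hausdorff_delta d delta.
have [[i ioo]|] := pselect (exists i, mu (A i) = +oo).
  rewrite (eseries_pinfty _ _ ioo) ?leey// => k _.
  by rewrite -ltNye (lt_le_trans _ (hausdorff_delta_ge0 _ _ _)).
rewrite -forallNE => Aoo.
apply/lee_addgt0Pr => e e0.
apply: le_trans (epsilon_trick _ _ (ltW e0)); last first.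
  by move=> k; exact: hausdorff_delta_ge0.
have /choice[G GP] k : exists U : (set 'rV[R]_n)^nat,
    [/\ forall j, ediam (U j) <= delta%:E, A k `<=` \bigcup_j U j &
      \sum_(j <oo) hausdorff_weight d (U j) <= mu (A k) + (e / (2 ^ k.+1)%:R)%:E].
  have ek : (0 < e / (2 ^ k.+1)%:R)%R by rewrite divr_gt0// ltr0n expn_gt0.
  have Afin : mu (A k) \is a fin_num.
    by rewrite ge0_fin_numE ?hausdorff_delta_ge0// ltey; exact/eqP/Aoo.
  have [_ [U [Ud AU] <-] Ue] := lb_ereal_inf_adherent ek Afin.
  by exists U; split => //; exact: ltW.
have w0 i j : 0 <= hausdorff_weight d (G i j) by exact: hausdorff_weight_ge0.
have [f [fsurj fE]] := nneseries_pair w0.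
apply: (@le_trans _ _ (\sum_(i <oo) \sum_(j <oo) hausdorff_weight d (G i j))).
  rewrite -fE; apply: hausdorff_delta_le_cover.
    by move=> k; have [] := GP (f k).1.
  move=> x [i _ Aix]; have [_ /(_ x Aix) [j _ Gij] _] := GP i.
  by have [k kE] := fsurj (i, j); exists k => //; rewrite kE.
apply: lee_nneseries => [i _ _|i _]; first exact: nneseries_ge0.
by have [] := GP i.
Qed.

(** Estimates are made at fixed [delta], where subadditivity is available; the supremum over [delta]
    is taken only in [hausdorff_isometry_le]. *)
HB.instance Definition _ d delta := isOuterMeasure.Build R 'rV[R]_n
  (@hausdorff_delta R n d delta) (@hausdorff_delta0 d delta)
  (@hausdorff_delta_ge0 d delta) (@le_hausdorff_delta d delta)
  (@hausdorff_delta_subadditive d delta).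

Lemma hausdorff_delta_le_weight d delta U : ediam U <= delta%:E ->
  hausdorff_delta d delta U <= hausdorff_weight d U.
Proof.
move=> Ud; pose V (k : nat) : set 'rV[R]_n := if k is 0%N then U else set0.
apply: le_trans (@hausdorff_delta_le_cover d delta U V _ _) _.
- by case=> [|k] /=; [exact: Ud|exact: ediam_set0].
- by move=> x Ux; exists 0%N.
rewrite nneseries_recl//; last by move=> k _; exact: hausdorff_weight_ge0.
rewrite eseries0 ?adde0// => -[|k]//= _ _; exact: hausdorff_weight0.
Qed.

Lemma hausdorff_delta_bigsetU d delta (I : finType) (P : pred I)
    (B : I -> set 'rV[R]_n) :
  hausdorff_delta d delta (\big[setU/set0]_(i | P i) B i)
    <= \sum_(i | P i) hausdorff_delta d delta (B i).
Proof.
elim/big_ind2 : _ => [|A x C y Ax Cy|//]; first by rewrite outer_measure0.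
by apply: (le_trans (outer_measureU2 _ _ _)); exact: leeD.
Qed.

End hausdorff_delta_outer.

Section hausdorff_isometry.
Local Open Scope ereal_scope.
Context {R : realType} {n m : nat}.

(** The image of a cover of [A] covers the image of [A] with the same diameters. *)
Lemma hausdorff_delta_isometry d (delta : R) (f : 'rV[R]_n -> 'rV[R]_m)
    (A : set 'rV[R]_n) :
  (forall x y, enorm (f x - f y) = enorm (x - y)) ->
  hausdorff_delta d delta (f @` A) <= hausdorff_delta d delta A.
Proof.
move=> fi; apply: le_ereal_inf_tmp => _ [U [Ud AU] <-].
have fdiam V : ediam (f @` V) = ediam V.
  rewrite /ediam; congr ereal_sup; apply/seteqP; split.
    by move=> _ [[_ _] [[x Vx <-] [y Vy <-]] <-]; exists (x, y) => //=; rewrite fi.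
  move=> _ [[x y] [Vx Vy] <-]; exists (f x, f y); last by rewrite /= fi.
  by split; [exists x|exists y].
apply: (@le_trans _ _ (\sum_(k <oo) hausdorff_weight d (f @` U k))).
  apply: hausdorff_delta_le_cover => [k|]; first by rewrite fdiam.
  by move=> _ [x /AU[k _ Ukx] <-]; exists k => //; exists x.
apply: lee_nneseries => [k _ _|k _]; first exact: hausdorff_weight_ge0.
rewrite /hausdorff_weight fdiam.
case: asboolP => [_|fU0]; first by rewrite -/(hausdorff_weight d (U k)) hausdorff_weight_ge0.
case: asboolP => // U0; case: fU0.
by rewrite U0 image_set0.
Qed.

End hausdorff_isometry.

Section rV_cons_theory.
Context {R : realType} {n : nat}.
Implicit Types (t : R) (y : 'rV[R]_n).

Lemma rV_cons0 t y : rV_cons (t, y) ord0 ord0 = t.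
Proof.
transitivity (row_mx t%:M y ord0 (@lshift 1 n ord0)).
  by congr (row_mx _ _ _ _); exact: val_inj.
by rewrite row_mxEl mxE eqxx.
Qed.

Lemma rV_consS t y j : rV_cons (t, y) ord0 (lift ord0 j) = y ord0 j.
Proof.
transitivity (row_mx t%:M y ord0 (@rshift 1 n j)); last by rewrite row_mxEr.
by congr (row_mx _ _ _ _); exact: val_inj.
Qed.

Definition rV_uncons (x : 'rV[R]_n.+1) : R * 'rV[R]_n :=
  (x ord0 ord0, \row_j x ord0 (lift ord0 j)).

Lemma rV_unconsK : cancel rV_uncons (@rV_cons R n).
Proof.
move=> x; apply/rowP => i; case: (unliftP ord0 i) => [j|] ->.
  by rewrite rV_consS mxE.
by rewrite rV_cons0.
Qed.

Lemma dot_cons t s y z : dot (rV_cons (t, y)) (rV_cons (s, z)) = t * s + dot y z.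
Proof.
rewrite /dot big_ord_recl !rV_cons0; congr (_ + _).
by apply: eq_bigr => j _; rewrite !rV_consS.
Qed.

Lemma rV_consD p q : @rV_cons R n (p + q) = rV_cons p + rV_cons q.
Proof.
case: p q => [t y] [s z]; change ((t, y) + (s, z)) with (t + s, y + z).
apply/rowP => i.
by case: (unliftP ord0 i) => [j|] ->; rewrite [RHS]mxE ?rV_consS ?rV_cons0 ?mxE.
Qed.

Lemma rV_consB t u y (z : 'rV[R]_n) :
  rV_cons (t, y) - rV_cons (u, z) = rV_cons (t - u, y - z).
Proof.
by apply/eqP; rewrite subr_eq -rV_consD; apply/eqP; congr rV_cons;
  congr pair; rewrite /= subrK.
Qed.

Lemma rV_consZ a t y : rV_cons (a * t, a *: y) = a *: rV_cons (t, y).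
Proof.
apply/rowP => i.
by case: (unliftP ord0 i) => [j|] ->; rewrite [RHS]mxE ?rV_consS ?rV_cons0 ?mxE.
Qed.

End rV_cons_theory.

(** * Lebesgue measure under dilations and translations *)

Section lebesgue_affine.
Local Open Scope ereal_scope.
Context {R : realType}.

(** By uniqueness of Lebesgue measure, as the rescaled image measure has the right value on
    half-open intervals. *)
Lemma lebesgue_measure_affine (c r : R) (A : set R) : (0 < r)%R -> measurable A ->
  lebesgue_measure A = r%:E * lebesgue_measure ((fun x => c + r * x)%R @^-1` A).
Proof.
move=> r0 mA.
have mf0 : measurable_fun [set: R] (fun x => c + r * x)%R.
  by apply: measurable_funD => //; exact: measurable_funM.
pose f : measurableTypeR R -> measurableTypeR R := fun x => (c + r * x)%R.
have mf : measurable_fun [set: measurableTypeR R] f by exact: mf0.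
pose m := [the {measure set (measurableTypeR R) -> \bar R} of
  mscale (NngNum (ltW r0))
    (measure_function_pushforward__canonical__measure_function_Measure
      (@lebesgue_measure R) mf)].
rewrite (@lebesgue_measure_unique R m)// => _ [[x y] _ <-] /=.
rewrite /m /mscale/= /pushforward.
have -> : f @^-1` `]x, y]%classic =
    `]((x - c) / r)%R, ((y - c) / r)%R]%classic :> set R.
  apply/seteqP; split => z /=; rewrite !in_itv/= ltr_pdivrMr// ler_pdivlMr//;
    by rewrite ltrBlDl lerBrDl mulrC.
rewrite !lebesgue_measure_itv/= !lte_fin ltr_pM2r ?invr_gt0// ltrBlDr subrK.
case: ifP => _; last by rewrite mule0.
by rewrite -!EFinB -EFinM; congr EFin; field; rewrite gt_eqF.
Qed.

Lemma lebesgue_rVS n A : @lebesgue_rV R n.+1 A =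
  (@lebesgue_measure R \x @lebesgue_rV R n) (@rV_cons R n @^-1` A).
Proof. by []. Qed.

Lemma measurable_preimage_cons n (A : set 'rV[R]_n.+1) : measurable A ->
  measurable (@rV_cons R n @^-1` A).
Proof. by move=> mA; rewrite -[X in measurable X]setTI; exact: measurable_rV_cons. Qed.

Lemma measurable_rV_affine n (c : 'rV[R]_n) (r : R) :
  measurable_fun [set: 'rV[R]_n] (fun x => c + r *: x)%R.
Proof.
apply: measurable_fun_rV => i; under eq_fun do rewrite !mxE.
by apply: measurable_funD => //; apply: measurable_funM => //; exact: measurable_rV_coord.
Qed.

(** By induction on the dimension: both sides agree on rectangles, which determine a product
    measure. *)
Lemma lebesgue_rV_affine n (c : 'rV[R]_n) (r : R) (A : set 'rV[R]_n) :
  (0 < r)%R -> measurable A ->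
  lebesgue_rV A = (r ^+ n)%:E * lebesgue_rV ((fun x => c + r *: x)%R @^-1` A).
Proof.
move=> r0; elim: n c A => [|n IH] c A mA.
  rewrite expr0 mul1e; congr lebesgue_rV; apply/seteqP.
  by split => x /=; rewrite (thinmx0 (c + r *: x)%R) (thinmx0 x).
pose c0 := c ord0 ord0; pose c1 : 'rV[R]_n := \row_j c ord0 (lift ord0 j).
pose T := (measurableTypeR R * 'rV[R]_n)%type.
pose f (p : T) : T := ((c0 + r * p.1)%R, (c1 + r *: p.2)%R).
have mf : measurable_fun setT f.
  apply/measurable_fun_pair.
    have m0 : measurable_fun [set: R] (fun x => c0 + r * x)%R.
      by apply: measurable_funD => //; exact: measurable_funM.
    pose f0 : measurableTypeR R -> measurableTypeR R := fun x => (c0 + r * x)%R.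
    have mf0 : measurable_fun [set: measurableTypeR R] f0 by exact: m0.
    exact: (measurableT_comp mf0 measurable_fst).
  exact: (measurableT_comp (measurable_rV_affine c1 r) measurable_snd).
have rn0 : (0 <= r ^+ n.+1)%R by rewrite exprn_ge0// ltW.
pose m := [the {measure set T -> \bar R} of
  mscale (NngNum rn0)
    (measure_function_pushforward__canonical__measure_function_Measure
      (@lebesgue_measure R \x @lebesgue_rV R n) mf)].
have mE X : m X = (r ^+ n.+1)%:E *
  (@lebesgue_measure R \x @lebesgue_rV R n) (f @^-1` X) by [].
have fE p : rV_cons (f p) = (c + r *: rV_cons p)%R.
  by case: p => t y; rewrite -[c]rV_unconsK -rV_consZ -rV_consD.
have -> : lebesgue_rV ((fun x => c + r *: x)%R @^-1` A) =
    (@lebesgue_measure R \x @lebesgue_rV R n) (f @^-1` (@rV_cons R n @^-1` A)).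
  rewrite lebesgue_rVS.
  have -> // : @rV_cons R n @^-1` ((fun x => c + r *: x)%R @^-1` A) =
    f @^-1` (@rV_cons R n @^-1` A).
  by apply/seteqP; split => p; rewrite /preimage/= fE.
rewrite lebesgue_rVS -mE; apply: product_measure_unique; last first.
  exact: measurable_preimage_cons.
move=> A1 A2 mA1 mA2; rewrite mE.
pose f0 : measurableTypeR R -> measurableTypeR R := fun x => (c0 + r * x)%R.
have -> : f @^-1` (A1 `*` A2) = (f0 @^-1` A1) `*` ((fun y => c1 + r *: y)%R @^-1` A2).
  by [].
rewrite product_measure1E.
- rewrite -[X in _ = X * _]/(lebesgue_measure A1) -[X in _ = _ * X]/(lebesgue_rV A2).
  rewrite (lebesgue_measure_affine c0 r0 mA1) (IH c1 A2 mA2) exprS EFinM.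
  by rewrite muleACA.
- rewrite -[X in measurable X]setTI.
  have mf0 : measurable_fun [set: R] (fun x => c0 + r * x)%R.
    by apply: measurable_funD => //; exact: measurable_funM.
  exact: mf0.
- by rewrite -[X in measurable X]setTI; exact: measurable_rV_affine.
Qed.

(** Half-open, so that the cubes of a grid are disjoint and leave nothing uncovered. *)
Definition cube n (a : 'rV[R]_n) (s : R) : set 'rV[R]_n :=
  [set x | forall i, (a ord0 i <= x ord0 i < a ord0 i + s)%R].

Lemma measurable_cube n (a : 'rV[R]_n) s : measurable (cube a s).
Proof.
have -> : cube a s = \bigcap_(i in [set: 'I_n])
    ((fun x : 'rV[R]_n => x ord0 i) @^-1` `[a ord0 i, (a ord0 i + s)%R[).
  apply/seteqP; split => x; first by move=> ax i _ /=; rewrite in_itv/=.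
  by move=> ax i; have := ax i I; rewrite /= in_itv.
apply: fin_bigcap_measurable => // i _; rewrite -[X in measurable X]setTI.
by apply: measurable_rV_coord => //; exact: measurable_itv.
Qed.

Lemma lebesgue_cube n (a : 'rV[R]_n) s : (0 <= s)%R ->
  lebesgue_rV (cube a s) = (s ^+ n)%:E.
Proof.
move=> s0; elim: n a => [|n IH] a.
  rewrite expr0 /= diracE mem_set//.
  by move=> [].
pose a1 : 'rV[R]_n := \row_j a ord0 (lift ord0 j).
rewrite lebesgue_rVS.
have -> : @rV_cons R n @^-1` cube a s =
    `[a ord0 ord0, (a ord0 ord0 + s)%R[%classic `*` cube a1 s.
  apply/seteqP; split => -[t y] /=.
    move=> ax; split; first by have := ax ord0; rewrite rV_cons0 /= in_itv.
    by move=> j; have := ax (lift ord0 j); rewrite rV_consS mxE.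
  move=> [] /=; rewrite in_itv/= => ht hy i.
  case: (unliftP ord0 i) => [j|] ->; last by rewrite rV_cons0.
  by rewrite rV_consS; have := hy j; rewrite mxE.
rewrite product_measure1E//; last exact: measurable_cube.
rewrite -[X in _ * X]/(lebesgue_rV (cube a1 s)) IH.
rewrite -[X in X * _]/(lebesgue_measure `[a ord0 ord0, (a ord0 ord0 + s)%R[%classic).
rewrite lebesgue_measure_itv/= lte_fin ltrDl exprS EFinM.
case: ltP => h; first by rewrite -EFinB addrC addKr.
have -> : s = 0%R by apply/eqP; rewrite eq_le h.
by rewrite mul0e.
Qed.

End lebesgue_affine.

Section finite_disjoint_unions.
Local Open Scope ereal_scope.

Lemma bigsetU_memP {T : Type} {I : eqType} (r : seq I) (P : pred I)
    (F : I -> set T) x :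
  (\big[setU/set0]_(i <- r | P i) F i) x <-> exists i, [/\ i \in r, P i & F i x].
Proof.
elim: r => [|i r IH]; first by rewrite big_nil; split => // -[i []].
rewrite big_cons; split.
  case: ifP => Pi.
    case=> [Fi|/IH[j [jr Pj Fj]]]; first by exists i; rewrite mem_head.
    by exists j; rewrite inE jr orbT.
  by move=> /IH[j [jr Pj Fj]]; exists j; rewrite inE jr orbT.
move=> [j []]; rewrite inE => /predU1P[-> Pi Fi|jr Pj Fj].
  by rewrite Pi; left.
by case: ifP => _; [right|]; apply/IH; exists j.
Qed.

Lemma measure_bigsetU_disjoint {d} {T : measurableType d} {R : realType}
    (mu : {measure set T -> \bar R}) {I : finType} (P : pred I) (F : I -> set T) :
  (forall i, measurable (F i)) ->
  (forall i j, P i -> P j -> i != j -> F i `&` F j = set0) ->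
  mu (\big[setU/set0]_(i | P i) F i) = \sum_(i | P i) mu (F i).
Proof.
move=> mF dF; elim: (index_enum I) (index_enum_uniq I) => [_|i r IH /andP[ir ur]].
  by rewrite !big_nil measure0.
rewrite !big_cons; case: ifP => Pi; last exact: IH.
rewrite measureU//; last 2 first.
- exact: bigsetU_measurable.
- apply/seteqP; split => // x [Fi] /bigsetU_memP[j [jr Pj Fj]].
  have ij : i != j by apply: contraNneq ir => ->.
  by rewrite -(dF i j Pi Pj ij).
by congr (_ + _); exact: IH.
Qed.

End finite_disjoint_unions.

Section euclidean_balls.
Local Open Scope ereal_scope.
Context {R : realType} {d : nat}.
Implicit Types (a c x y : 'rV[R]_d) (s r : R).

Definition eball c r : set 'rV[R]_d := [set x | (enorm (x - c) <= r)%R].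

Lemma measurable_dot_sub c : measurable_fun [set: 'rV[R]_d] (fun x => dot (x - c) (x - c))%R.
Proof.
apply: measurable_sum => i; under eq_fun do rewrite !mxE -expr2.
by apply: measurable_funX; apply: measurable_funB => //; exact: measurable_rV_coord.
Qed.

Lemma measurable_eball c r : measurable (eball c r).
Proof.
have [r0|r0] := leP 0%R r; last first.
  have -> : eball c r = set0.
    apply/seteqP; split => // x /= /le_lt_trans/(_ r0).
    by rewrite ltNge enorm_ge0.
  exact: measurable0.
have -> : eball c r = (fun x => dot (x - c) (x - c))%R @^-1` `]-oo, (r ^+ 2)%R].
  by apply/seteqP; split => x; rewrite /eball /= in_itv/= enorm_le.
rewrite -[X in measurable X]setTI; exact: measurable_dot_sub.
Qed.

Lemma unit_ballE : unit_ball R d = eball 0 1.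
Proof. by apply/seteqP; split => x; rewrite /unit_ball /eball /= subr0. Qed.

Lemma lebesgue_eball c r : (0 < r)%R ->
  lebesgue_rV (eball c r) = (r ^+ d)%:E * lebesgue_rV (unit_ball R d).
Proof.
move=> r0; rewrite (lebesgue_rV_affine c r0); last exact: measurable_eball.
congr (_ * lebesgue_rV _); apply/seteqP; split => x;
  by rewrite /eball /unit_ball /= addrC addKr enormZ gtr0_norm// -ler_pdivlMl// mulVf ?gt_eqF.
Qed.

Lemma lebesgue_eball_lty c r : lebesgue_rV (eball c r) < +oo.
Proof.
have [r0|r0] := leP 0%R r; last first.
  have -> : eball c r = set0.
    apply/seteqP; split => // x /= /le_lt_trans/(_ r0).
    by rewrite ltNge enorm_ge0.
  by rewrite measure0 ltry.
have s0 : (0 <= 2 * r + 1)%R by rewrite addr_ge0// mulr_ge0.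
(* Side 2 r + 1 instead of 2 r because the cube is half-open. *)
apply: (@le_lt_trans _ _ (lebesgue_rV (cube (c - const_mx r)%R (2 * r + 1)%R))).
  apply: le_measure; rewrite ?inE; [exact: measurable_eball|exact: measurable_cube|].
  move=> x /= xc i; rewrite !mxE; have := ler_coord_enorm (x - c)%R i.
  rewrite !mxE => /le_trans/(_ xc); rewrite ler_norml.
  by move=> /andP[h1 h2]; apply/andP; split; lra.
by rewrite lebesgue_cube// ltry.
Qed.

Definition ball_volume : R := fine (lebesgue_rV (unit_ball R d)).

Lemma ball_volumeE : lebesgue_rV (unit_ball R d) = ball_volume%:E.
Proof.
by rewrite /ball_volume fineK// ge0_fin_numE// unit_ballE lebesgue_eball_lty.
Qed.

Lemma ball_volume_gt0 : (0 < ball_volume)%R.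
Proof.
(* [d.+1] dominates sqrt d and stays nonzero in dimension 0. *)
have s0 : (0 < (d.+1%:R)^-1 :> R)%R by rewrite invr_gt0.
have : lebesgue_rV (cube (0 : 'rV[R]_d) (d.+1%:R)^-1)
    <= lebesgue_rV (unit_ball R d).
  apply: le_measure; rewrite ?inE; first exact: measurable_cube.
    by rewrite unit_ballE; exact: measurable_eball.
  move=> x /= xc; apply: (@le_trans _ _ (Num.sqrt d%:R * (d.+1%:R)^-1)%R).
    apply: enorm_le_coord => [|i]; first exact: ltW.
    by have := xc i; rewrite mxE add0r => /andP[x0 /ltW x1]; rewrite ger0_norm.
  rewrite ler_pdivrMr ?ltr0n// mul1r.
  have -> : d.+1%:R = Num.sqrt (d.+1%:R ^+ 2) :> R by rewrite sqrtr_sqr ger0_norm.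
  rewrite ler_wsqrtr// (le_trans (_ : d%:R <= d.+1%:R)%R) ?ler_nat//.
  by rewrite expr2 ler_peMl// ler1n.
rewrite lebesgue_cube ?(ltW s0)// ball_volumeE lee_fin; apply: lt_le_trans.
by rewrite exprn_gt0.
Qed.

End euclidean_balls.
Arguments ball_volume : clear implicits.

(** * The covering cost of a cube is at most its volume *)

Section cube_grid.
Local Open Scope ereal_scope.
Context {R : realType} {d : nat}.
Implicit Types (a c x y : 'rV[R]_d) (s r : R) (m : nat).

Definition subcube a s m (z : {ffun 'I_d -> 'I_m}) : set 'rV[R]_d :=
  cube (a + \row_i (s / m%:R * (z i)%:R))%R (s / m%:R)%R.

Lemma cube_diam a s x y : (0 <= s)%R -> cube a s x -> cube a s y ->
  (enorm (x - y) <= Num.sqrt d%:R * s)%R.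
Proof.
move=> s0 ax ay; apply: enorm_le_coord => // i; rewrite !mxE ler_norml.
have := ax i; have := ay i => /andP[h1 h2] /andP[h3 h4].
by apply/andP; split; lra.
Qed.

Lemma cube_subcube a s m x : (0 < m)%N -> (0 < s)%R -> cube a s x ->
  exists z, @subcube a s m z x.
Proof.
move=> m0 s0 ax; have mR : (0 < m%:R :> R)%R by rewrite ltr0n.
have h0 : (0 < s / m%:R)%R by rewrite divr_gt0.
have q0 i : (0 <= (x ord0 i - a ord0 i) / (s / m%:R))%R.
  by have /andP[xa _] := ax i; rewrite divr_ge0 ?subr_ge0// ltW.
have zm i : (Num.truncn ((x ord0 i - a ord0 i) / (s / m%:R)) < m)%N.
  rewrite -(ltr_nat R); have /andP[+ _] := truncn_itv (q0 i).
  move/le_lt_trans; apply; rewrite ltr_pdivrMr// mulrCA divff ?mulr1 ?gt_eqF//.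
  by have /andP[_ xa] := ax i; rewrite ltrBlDl.
exists [ffun i => Ordinal (zm i)] => i; rewrite !mxE ffunE/=.
have /andP[] := truncn_itv (q0 i); set t := Num.truncn _.
rewrite ler_pdivlMr// ltr_pdivrMr// -[t.+1%:R]natr1.
by move=> h1 h2; apply/andP; split; lra.
Qed.

Lemma subcube_sub a s m (z : {ffun 'I_d -> 'I_m}) : (0 < s)%R ->
  subcube a s z `<=` cube a s.
Proof.
move=> s0 x zx i; have := zx i; rewrite !mxE => /andP[h1 h2].
have m0 : (0 < m)%N by apply: leq_ltn_trans (ltn_ord (z i)).
have mR : (0 < m%:R :> R)%R by rewrite ltr0n.
have h0 : (0 < s / m%:R)%R by rewrite divr_gt0.
have hz : (s / m%:R * (z i)%:R + s / m%:R <= s)%R.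
  rewrite -[X in (_ + X)%R]mulr1 -mulrDr natr1 -[leRHS](@divfK _ m%:R) ?gt_eqF//.
  by rewrite ler_wpM2l ?(ltW h0)// ler_nat.
have hz0 : (0 <= s / m%:R * (z i)%:R)%R by rewrite mulr_ge0// ltW.
by apply/andP; split; lra.
Qed.

Lemma subcube_disjoint a s m (z w : {ffun 'I_d -> 'I_m}) : (0 < s)%R ->
  z != w -> subcube a s z `&` subcube a s w = set0.
Proof.
move=> s0 zw; apply/seteqP; split => // x [zx wx]; apply/negP: zw.
rewrite negbK; apply/eqP/ffunP => i; apply/val_inj => /=.
have := zx i; have := wx i; rewrite !mxE.
have m0 : (0 < m)%N by apply: leq_ltn_trans (ltn_ord (z i)).
have h0 : (0 < s / m%:R)%R by rewrite divr_gt0// ltr0n.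
move=> /andP[w1 w2] /andP[z1 z2].
have h (p q : 'I_m) : (a ord0 i + s / m%:R * p%:R <= x ord0 i)%R ->
    (x ord0 i < a ord0 i + s / m%:R * q%:R + s / m%:R)%R -> (p <= q)%N.
  move=> h1 h2; rewrite -ltnS -(ltr_nat R) -natr1 -(ltr_pM2l h0); lra.
by apply/eqP; rewrite eqn_leq (h _ _ z1 w2) (h _ _ w1 z2).
Qed.

(** The side is bounded separately because the diameter bound says nothing about it when [d = 0]. *)
Lemma small_mesh (e : R) : (0 < e)%R -> exists2 m, (0 < m)%N &
  (Num.sqrt d%:R * (1 / m%:R) <= e)%R /\ (1 / m%:R <= e)%R.
Proof.
move=> e0; set q : R := ((Num.sqrt d%:R + 1) / e)%R.
have q0 : (0 <= q)%R by rewrite divr_ge0 ?addr_ge0 ?sqrtr_ge0// ltW.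
exists (Num.truncn q).+1 => //; have /andP[_ /ltW] := truncn_itv q0.
rewrite /q ler_pdivrMr// => h; have := sqrtr_ge0 (d%:R : R).
by rewrite mulrA mulr1 !ler_pdivrMr// => h'; split; lra.
Qed.

Variable delta : R.
Hypothesis delta0 : (0 < delta)%R.
Local Notation hd := (@hausdorff_delta R d d delta).
Local Notation omega := (ball_volume R d).

Lemma hausdorff_delta_cube_le_grid a s m (v : R) : (0 < m)%N -> (0 < s)%R ->
  (forall b, hd (cube b (s / m%:R)%R) <= v%:E) ->
  hd (cube a s) <= (m%:R ^+ d * v)%:E.
Proof.
move=> m0 s0 hv.
apply: (@le_trans _ _ (\sum_(z : {ffun 'I_d -> 'I_m}) v%:E)).
  apply: (@le_trans _ _ (hd (\big[setU/set0]_(z : {ffun 'I_d -> 'I_m}) subcube a s z))).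
    apply: le_outer_measure => x /(cube_subcube m0 s0)[z zx].
    by apply/bigsetU_memP; exists z; split => //; exact: mem_index_enum.
  apply: (le_trans (hausdorff_delta_bigsetU _ _ _ _)).
  by apply: lee_sum => z _; exact: hv.
by rewrite sumEFin sumr_const card_ffun !card_ord -natrX mulr_natl.
Qed.

Lemma hausdorff_delta_small (U : set 'rV[R]_d) r : (0 <= r)%R -> (2 * r <= delta)%R ->
  (forall x y, U x -> U y -> (enorm (x - y) <= 2 * r)%R) ->
  hd U <= (omega * r ^+ d)%:E.
Proof.
move=> r0 rd Ur; apply: (@le_trans _ _ (hausdorff_weight d U)).
  apply: hausdorff_delta_le_weight.
  by apply: ediam_le => x y Ux Uy; rewrite (le_trans (Ur x y Ux Uy)).
by rewrite EFinM EFin_expe -ball_volumeE; exact: hausdorff_weight_le.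
Qed.

(** Each small cube is charged the volume of a ball of the same diameter. This supplies a first
    finite rate, so that the infimum in [hausdorff_delta_cube_le] is over a nonempty set. *)
Lemma hausdorff_delta_cube_crude a s : (0 < s)%R ->
  hd (cube a s) <= (omega * (Num.sqrt d%:R / 2) ^+ d * s ^+ d)%:E.
Proof.
move=> s0; have [m m0 [hm _]] := small_mesh (divr_gt0 delta0 s0).
have mR : (0 < m%:R :> R)%R by rewrite ltr0n.
have -> : (omega * (Num.sqrt d%:R / 2) ^+ d * s ^+ d =
    m%:R ^+ d * (omega * (Num.sqrt d%:R * (s / m%:R) / 2) ^+ d))%R.
  rewrite mulrCA -!exprMn -mulrA -exprMn; congr (_ * _ ^+ _)%R.
  by field; rewrite gt_eqF.
apply: hausdorff_delta_cube_le_grid => // b.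
have sm : (Num.sqrt d%:R * (s / m%:R) <= delta)%R.
  by move: hm; rewrite ler_pdivlMr//; congr (_ <= _)%R; ring.
have h0 : (0 <= s / m%:R)%R by rewrite divr_ge0 ?ltW.
apply: hausdorff_delta_small.
- by rewrite divr_ge0// mulr_ge0 ?sqrtr_ge0.
- by rewrite mulrCA divff ?mulr1.
- by move=> x y; rewrite mulrCA divff ?mulr1//; exact: cube_diam.
Qed.

(* A ball costs its volume, so covering the inscribed ball by itself and the
   rest of the cube at rate K improves the rate K whenever K > 1. *)
Lemma hausdorff_delta_cube_improve a s (K r : R) : (0 < s)%R -> (s <= delta)%R ->
  (0 <= K)%R -> (0 < r < 1)%R ->
  (forall b s', (0 < s')%R -> hd (cube b s') <= (K * s' ^+ d)%:E) ->
  hd (cube a s) <=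
    ((omega / 2 ^+ d + K * (1 - r ^+ d * (omega / 2 ^+ d))) * s ^+ d)%:E.
Proof.
move=> s0 sd K0 /andP[r0 r1] HK.
have e0 : (0 < (1 - r) / 2)%R by rewrite divr_gt0// subr_gt0.
have [m m0 [hm _]] := small_mesh e0.
have mR : (0 < m%:R :> R)%R by rewrite ltr0n.
have h0 : (0 < s / m%:R)%R by rewrite divr_gt0.
have s20 : (0 < s / 2)%R by rewrite divr_gt0.
pose c : 'rV[R]_d := (a + const_mx (s / 2))%R.
pose bad (z : {ffun 'I_d -> 'I_m}) := ~~ `[< subcube a s z `<=` eball c (s / 2)%R >].
pose Bad := \big[setU/set0]_(z | bad z) subcube a s z.
have mBad : measurable Bad by apply: bigsetU_measurable => z _; exact: measurable_cube.
have Bad_cost : hd Bad <= (K * ((s / m%:R) ^+ d * #|bad|%:R))%:E.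
  apply: (le_trans (hausdorff_delta_bigsetU _ _ _ _)).
  apply: (@le_trans _ _ (\sum_(z | bad z) (K * (s / m%:R) ^+ d)%:E)).
    by apply: lee_sum => z _; exact: HK.
  by rewrite sumEFin sumr_const -[(K * _ *+ _)%R]mulr_natr mulrA.
(* Subcubes have diameter at most (1 - r) (s / 2), so one that meets the ball of radius r (s / 2)
   lies in the ball of radius s / 2. Hence the volumes of [Bad] and of the smaller ball add up
   inside the cube. *)
have Bad_far : Bad `&` eball c (r * (s / 2))%R = set0.
  apply/seteqP; split => // y [] /bigsetU_memP[z [_ /asboolP bz zy]] /= yc.
  apply: bz => x zx.
  have := cube_diam (ltW h0) zx zy.
  have := ler_enormD (x - y) (y - c); rewrite addrA subrK => hxc hxy.
  have : (Num.sqrt d%:R * (s / m%:R) <= (1 - r) / 2 * s)%R.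
    by move: hm; rewrite -(ler_pM2r s0); congr (_ <= _)%R; ring.
  rewrite /eball /=; move: yc; rewrite /eball/=; lra.
have Bad_vol : ((s / m%:R) ^+ d * #|bad|%:R + r ^+ d * (omega / 2 ^+ d) * s ^+ d <= s ^+ d)%R.
  rewrite -lee_fin EFinD -(lebesgue_cube a (ltW s0)).
  have -> : ((s / m%:R) ^+ d * #|bad|%:R)%:E = lebesgue_rV Bad.
    rewrite measure_bigsetU_disjoint; last 2 first.
    - by move=> z; exact: measurable_cube.
    - by move=> z w _ _; exact: subcube_disjoint.
    transitivity (\sum_(z | bad z) ((s / m%:R) ^+ d)%:E); last first.
      by apply: eq_bigr => z _; apply/esym; exact: (lebesgue_cube _ (ltW h0)).
    by rewrite sumEFin sumr_const mulr_natr.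
  have -> : (r ^+ d * (omega / 2 ^+ d) * s ^+ d)%:E =
      lebesgue_rV (eball c (r * (s / 2))%R).
    rewrite lebesgue_eball ?mulr_gt0// ball_volumeE -EFinM !exprMn exprVn.
    by congr EFin; ring.
  rewrite -measureU//; [|exact: measurable_eball].
  apply: le_measure; rewrite ?inE.
  - by apply: measurableU => //; exact: measurable_eball.
  - exact: measurable_cube.
  - move=> x [/bigsetU_memP[z [_ _]]|/= xc i]; first exact: subcube_sub.
    have := le_trans (ler_coord_enorm (x - c) i) xc; rewrite !mxE ler_norml.
    have : (r * (s / 2) < s / 2)%R by rewrite gtr_pMl.
    by move=> h /andP[h1 h2]; apply/andP; split; lra.
apply: (@le_trans _ _ (hd (eball c (s / 2)%R `|` Bad))).
  apply: le_outer_measure => x /(cube_subcube m0 s0)[z zx].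
  have [/asboolP bz|bz] := boolP (`[< subcube a s z `<=` eball c (s / 2)%R >]).
    by left; exact: bz.
  by right; apply/bigsetU_memP; exists z; split => //; exact: mem_index_enum.
apply: (le_trans (outer_measureU2 _ _ _)).
have ball_cost : hd (eball c (s / 2)%R) <= (omega * (s / 2) ^+ d)%:E.
  apply: hausdorff_delta_small; first exact: ltW.
    by rewrite mulrCA divff ?mulr1.
  move=> x y; rewrite /eball /= => xc yc.
  have := ler_enormD (x - c) (c - y); rewrite addrA subrK (enorm_distC c).
  by move: xc yc; lra.
apply: (le_trans (leeD ball_cost Bad_cost)); rewrite -EFinD lee_fin.
have -> : (omega * (s / 2) ^+ d = omega / 2 ^+ d * s ^+ d)%R.
  by rewrite exprMn exprVn mulrA mulrAC.
move: (ler_wpM2l K0 Bad_vol); lra.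
Qed.

Lemma bernoulli_le (x : R) k : (0 <= x <= 1)%R -> (1 - k%:R * x <= (1 - x) ^+ k)%R.
Proof.
move=> /andP[x0 x1]; elim: k => [|k IH]; first by rewrite mul0r subr0 expr0.
have h0 : (0 <= 1 - x)%R by lra.
rewrite exprS -natr1; have := ler_wpM2l h0 IH.
have : (0 <= k%:R * (x * x))%R by rewrite !mulr_ge0.
lra.
Qed.

(* Only the upper bound is needed, so no isodiametric inequality: the infimum K0
   of the rates admissible for all cubes is itself admissible, and it could be
   improved if it were > 1. *)
Lemma hausdorff_delta_cube_le a s : (0 < s)%R -> hd (cube a s) <= (s ^+ d)%:E.
Proof.
pose S := [set K : R | (0 <= K)%R /\
  forall b s', (0 < s')%R -> hd (cube b s') <= (K * s' ^+ d)%:E].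
have S0 : S (omega * (Num.sqrt d%:R / 2) ^+ d)%R.
  split; last by move=> *; exact: hausdorff_delta_cube_crude.
  by rewrite mulr_ge0 ?(ltW ball_volume_gt0)// exprn_ge0// divr_ge0 ?sqrtr_ge0.
have lS : has_lbound S by exists 0%R => K [].
set K0 := inf S.
have K00 : (0 <= K0)%R.
  by apply: lb_le_inf; [exists (omega * (Num.sqrt d%:R / 2) ^+ d)%R|move=> K []].
have SK0 : forall b s', (0 < s')%R -> hd (cube b s') <= (K0 * s' ^+ d)%:E.
  move=> b s' s'0; have sd0 : (0 < s' ^+ d)%R by rewrite exprn_gt0.
  have hfin : hd (cube b s') \is a fin_num.
    rewrite ge0_fin_numE ?outer_measure_ge0//.
    by apply: le_lt_trans (S0.2 b s' s'0) _; rewrite ltry.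
  rewrite -(fineK hfin) lee_fin -ler_pdivrMr//.
  apply: lb_le_inf; first by exists (omega * (Num.sqrt d%:R / 2) ^+ d)%R.
  by move=> K [_ HK]; rewrite ler_pdivrMr// -lee_fin (fineK hfin) HK.
set beta := (omega / 2 ^+ d)%R.
have beta0 : (0 < beta)%R by rewrite divr_gt0 ?ball_volume_gt0// exprn_gt0.
(* [K0] is at most the improved rate; cancelling [K0] and then [beta] leaves this bound. *)
have Kr r : (0 < r < 1)%R -> (K0 * r ^+ d <= 1)%R.
  move=> r01; have K'S : (K0 <= beta + K0 * (1 - r ^+ d * beta))%R.
    apply: ge_inf => //; have H b s' : (0 < s')%R ->
        hd (cube b s') <= ((beta + K0 * (1 - r ^+ d * beta)) * s' ^+ d)%:E.
      move=> s'0; have [m m0 [_ hm]] := small_mesh (divr_gt0 delta0 s'0).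
      have mR : (0 < m%:R :> R)%R by rewrite ltr0n.
      have -> : ((beta + K0 * (1 - r ^+ d * beta)) * s' ^+ d = m%:R ^+ d *
          ((beta + K0 * (1 - r ^+ d * beta)) * (s' / m%:R) ^+ d))%R.
        rewrite [RHS]mulrCA -exprMn; congr (_ * _ ^+ _)%R.
        by field; rewrite gt_eqF.
      apply: hausdorff_delta_cube_le_grid => // b'.
      apply: hausdorff_delta_cube_improve => //; first by rewrite divr_gt0.
      by move: hm; rewrite ler_pdivlMr//; congr (_ <= _)%R; ring.
    split => //; have := H 0%R 1%R ltr01; rewrite expr1n mulr1 -lee_fin.
    exact: le_trans (outer_measure_ge0 _ _).
  by rewrite -(ler_pM2r beta0); lra.
have K01 : (K0 <= 1)%R.
  rewrite leNgt; apply/negP => K1.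
  have K0p : (0 < K0)%R by lra.
  (* Chosen so that Bernoulli's inequality gives K0 (1 - x)^d >= K0 (1 - d x) = 1 + (K0 - 1) / (d +
     1) > 1. *)
  set x := ((K0 - 1) / (K0 * d.+1%:R))%R.
  have x0 : (0 < x)%R by rewrite divr_gt0 ?subr_gt0 ?mulr_gt0.
  have x1 : (x < 1)%R.
    rewrite ltr_pdivrMr ?mulr_gt0// mul1r.
    have : (K0 * 1 <= K0 * d.+1%:R)%R by rewrite ler_pM2l// ler1n.
    lra.
  have rx : (0 < 1 - x < 1)%R by apply/andP; split; lra.
  have := Kr _ rx; apply/negP; rewrite -ltNge.
  have : (0 <= x <= 1)%R by apply/andP; split; exact: ltW.
  move=> /(bernoulli_le d) h; have := ler_wpM2l K00 h; apply: lt_le_trans.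
  rewrite -subr_gt0 (_ : _ - _ = (K0 - 1) / d.+1%:R)%R ?divr_gt0 ?subr_gt0//.
  have -> : (d%:R = d.+1%:R - 1 :> R)%R by rewrite -natr1 addrK.
  rewrite /x; have : (d.+1%:R != 0 :> R)%R by rewrite pnatr_eq0.
  by move: (d.+1%:R)%R => D D0; field; rewrite D0 gt_eqF.
move=> s0; apply: (le_trans (SK0 a s s0)); rewrite lee_fin.
by rewrite ler_piMl// exprn_ge0// ltW.
Qed.

End cube_grid.

(** * Dyadic cubes and their unions *)

Section dyadic_cubes.
Local Open Scope ereal_scope.
Context {R : realType} {d : nat}.
Implicit Types (x y : 'rV[R]_d) (k : nat) (U V : set 'rV[R]_d).

Definition dyadic k (z : {ffun 'I_d -> int}) : set 'rV[R]_d :=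
  cube (\row_i ((z i)%:~R / 2 ^+ k))%R (1 / 2 ^+ k)%R.

Definition dyadic_index k x : {ffun 'I_d -> int} :=
  [ffun i => Num.floor (x ord0 i * 2 ^+ k)%R].

Let p2 k : (0 < 2 ^+ k :> R)%R. Proof. by rewrite exprn_gt0. Qed.

Lemma dyadicP k z x : dyadic k z x <-> dyadic_index k x = z.
Proof.
have cubeP i : ((z i)%:~R / 2 ^+ k <= x ord0 i < (z i)%:~R / 2 ^+ k + 1 / 2 ^+ k)%R
    = (Num.floor (x ord0 i * 2 ^+ k)%R == z i).
  rewrite -mulrDl ler_pdivrMr// ltr_pdivlMr// -intrD1.
  apply/idP/eqP => [|<-]; last by rewrite floor_itv.
  by move=> /floor_def.
split=> [zx|xz i].
  apply/ffunP => i; rewrite ffunE; apply/eqP; rewrite -cubeP.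
  by have := zx i; rewrite mxE.
by rewrite mxE cubeP -xz ffunE.
Qed.

Lemma dyadic_indexP k x : dyadic k (dyadic_index k x) x.
Proof. exact/dyadicP. Qed.

(** The floor at the finer scale determines the one at the coarser scale, because z <= t 2^k can be
    tested on the floor of t 2^k'. *)
Lemma dyadic_nested k k' x : (k <= k')%N ->
  dyadic k' (dyadic_index k' x) `<=` dyadic k (dyadic_index k x).
Proof.
move=> kk' y /dyadicP yx; apply/dyadicP/ffunP => i; rewrite !ffunE.
have {}yx : Num.floor (y ord0 i * 2 ^+ k')%R = Num.floor (x ord0 i * 2 ^+ k')%R.
  by have := congr1 (fun f : {ffun 'I_d -> int} => f i) yx; rewrite !ffunE.
have le_dyadic (t : R) (z : int) :
    (z%:~R <= t * 2 ^+ k)%R = (z * 2 ^+ (k' - k) <= Num.floor (t * 2 ^+ k')%R)%R.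
  have e2 : (2 ^+ k' = 2 ^+ k * 2 ^+ (k' - k) :> R)%R by rewrite -exprD subnKC.
  by rewrite floor_ge_int rmorphM/= rmorphXn/= e2 mulrA ler_pM2r.
apply/eqP; rewrite eq_le; apply/andP; split.
  by rewrite floor_ge_int le_dyadic -yx -le_dyadic -floor_ge_int.
by rewrite floor_ge_int le_dyadic yx -le_dyadic -floor_ge_int.
Qed.

Lemma measurable_dyadic k z : measurable (dyadic k z).
Proof. exact: measurable_cube. Qed.

(** Openness in the topology generated by the half-open dyadic cubes; such sets are disjoint unions
    of cubes, without boundary terms. *)
Definition dyadic_open U :=
  forall x, U x -> exists k, dyadic k (dyadic_index k x) `<=` U.

Lemma dyadic_openI U V : dyadic_open U -> dyadic_open V -> dyadic_open (U `&` V).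
Proof.
move=> oU oV x [/oU[k kU] /oV[l lV]]; exists (maxn k l) => y yx; split.
  by apply: kU; exact: (dyadic_nested (leq_maxl k l)).
by apply: lV; exact: (dyadic_nested (leq_maxr k l)).
Qed.

Lemma dyadic_open_bigcup {I : Type} (P : set I) (U : I -> set 'rV[R]_d) :
  (forall i, P i -> dyadic_open (U i)) -> dyadic_open (\bigcup_(i in P) U i).
Proof.
move=> oU x [i Pi /(oU i Pi)[k kU]]; exists k => y yx.
by exists i => //; exact: kU.
Qed.

Lemma dyadic_open_dyadic k z : dyadic_open (dyadic k z).
Proof. by move=> x /dyadicP <-; exists k. Qed.

(* The maximal dyadic cubes inside U partition it. *)
Lemma dyadic_open_partition U : dyadic_open U ->
  exists F : (set 'rV[R]_d)^nat, [/\ trivIset setT F, \bigcup_k F k = U &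
    forall k, F k = set0 \/ exists j z, F k = dyadic j z].
Proof.
move=> oU.
pose T := (nat * {ffun 'I_d -> int})%type.
pose maximal (p : T) := dyadic p.1 p.2 `<=` U /\
  forall j x, (j < p.1)%N -> dyadic p.1 p.2 x ->
    ~ (dyadic j (dyadic_index j x) `<=` U).
pose F k := if (unpickle k : option T) is Some p
  then if `[< maximal p >] && (pickle p == k) then dyadic p.1 p.2 else set0 else set0.
have FP k x : F k x -> exists p : T,
    [/\ pickle p = k, maximal p & p.2 = dyadic_index p.1 x].
  rewrite /F; case: (unpickle k : option T) => [p|//].
  case: asboolP => //= mp; case: eqP => // pk /dyadicP px.
  by exists p.
exists F; split.
- apply/trivIsetP => i j _ _ ij; apply/seteqP; split => // x [/FP + /FP].
  move=> [[k z] /= [ki [zU kmax] zx]] [[l w] /= [lj [wU lmax] wx]].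
  apply/negP: ij; rewrite negbK -ki -lj; apply/eqP.
  have kl : k = l.
    apply/eqP; rewrite eqn_leq; apply/andP; split; rewrite leqNgt; apply/negP => h.
      by apply: (kmax l x) => //=; [exact/dyadicP|rewrite -wx].
    by apply: (lmax k x) => //=; [exact/dyadicP|rewrite -zx].
  by rewrite zx wx kl.
- apply/seteqP; split => [x [k _ /FP[[j z] [_ [+ _] /= zx]]]|x Ux].
    by apply => /=; exact/dyadicP.
  have ex : exists k, `[< dyadic k (dyadic_index k x) `<=` U >].
    by have [k kU] := oU x Ux; exists k; exact/asboolP.
  case: (ex_minnP ex) => k /asboolP kU kmin.
  exists (pickle ((k, dyadic_index k x) : T)) => //; rewrite /F pickleK eqxx andbT.
  case: asboolP => [_|[]]; first exact: dyadic_indexP.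
  split => //= j y jk /dyadicP yx yU.
  have xy : dyadic_index j x = dyadic_index j y.
    apply/dyadicP; apply: (dyadic_nested (ltnW jk)).
    by rewrite yx; exact: dyadic_indexP.
  have /kmin : `[< dyadic j (dyadic_index j x) `<=` U >].
    by apply/asboolP; rewrite xy.
  by rewrite leqNgt jk.
- move=> k; rewrite /F; case: (unpickle k : option T) => [p|]; last by left.
  by case: ifP => _; [right; exists p.1, p.2|left].
Qed.

Lemma measurable_dyadic_open U : dyadic_open U -> measurable U.
Proof.
move=> /dyadic_open_partition[F [_ <- Fc]]; apply: bigcupT_measurable => k.
by case: (Fc k) => [->|[j [z ->]]]; [exact: measurable0|exact: measurable_dyadic].
Qed.

Lemma hausdorff_delta_dyadic_open (delta : R) U : (0 < delta)%R -> dyadic_open U ->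
  hausdorff_delta d delta U <= lebesgue_rV U.
Proof.
move=> delta0 /dyadic_open_partition[F [tF <- Fc]].
have mF k : measurable (F k).
  by case: (Fc k) => [->|[j [z ->]]]; [exact: measurable0|exact: measurable_dyadic].
rewrite measure_bigcup//.
apply: (le_trans (outer_measure_sigma_subadditive _ F)).
rewrite [leRHS](eq_eseriesl (Q := xpredT)); last by move=> k; rewrite in_setT.
apply: lee_nneseries => [k _ _|k _]; first exact: outer_measure_ge0.
case: (Fc k) => [->|[j [z ->]]]; first by rewrite outer_measure0.
have h0 : (0 < 1 / 2 ^+ j :> R)%R by rewrite divr_gt0.
apply: (le_trans (hausdorff_delta_cube_le delta0 _ h0)).
by rewrite [leRHS](lebesgue_cube _ (ltW h0)).
Qed.

End dyadic_cubes.

(** * Approximation of Borel sets by dyadic open sets *)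

Section dyadic_regularity.
Local Open Scope ereal_scope.
Context {R : realType} {d : nat}.
Implicit Types (x y : 'rV[R]_d) (k : nat) (A B U V : set 'rV[R]_d).
Local Notation mu := (@lebesgue_rV R d).

Lemma lebesgue_rV_shrink (A : (set 'rV[R]_d)^nat) (e : R) :
  (forall k, measurable (A k)) -> {homo A : k l / (k <= l)%N >-> l `<=` k} ->
  \bigcap_k A k = set0 -> mu (A 0%N) < +oo -> (0 < e)%R ->
  exists k, mu (A k) <= e%:E.
Proof.
move=> mA dA A0 Afin e0.
have := @nonincreasing_cvg_mu _ _ _ mu A Afin mA.
rewrite A0 measure0 => /(_ measurable0).
have dA' : {homo A : k l / (k <= l)%N >-> (l <= k)%O}.
  by move=> k l kl; rewrite subsetEset; exact: dA.
move=> /(_ dA') /fine_cvgP[Afine /cvgrPdist_le/(_ e e0)].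
move=> Ae; have := filterI Afine Ae => -[k _ /(_ k (leqnn k)) [fk]] /=.
rewrite sub0r normrN => h; exists k.
by rewrite -(@fineK _ (mu (A k)) fk) lee_fin (le_trans (ler_norm _)).
Qed.

Lemma dyadic_open_setT : dyadic_open [set: 'rV[R]_d].
Proof. by move=> x _; exists 0%N. Qed.

Lemma dyadic_open_bigcap_lt (V : (set 'rV[R]_d)^nat) m :
  (forall k, dyadic_open (V k)) -> dyadic_open (\bigcap_(k in `I_m) V k).
Proof.
move=> oV; elim: m => [|m IH].
  by rewrite II0 bigcap_set0; exact: dyadic_open_setT.
by rewrite IIS bigcap_setU bigcap_set1; exact: dyadic_openI.
Qed.

Variables (j : nat) (z : {ffun 'I_d -> int}).
(** Working inside one cube keeps measures finite, as continuity from above requires. *)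
Let W : set 'rV[R]_d := dyadic j z.

Let mW : measurable W. Proof. exact: measurable_dyadic. Qed.

Let W_lty A : measurable A -> A `<=` W -> mu A < +oo.
Proof.
move=> mA AW; apply: (@le_lt_trans _ _ (mu W)).
  by apply: le_measure; rewrite ?inE.
by rewrite [ltLHS](lebesgue_cube _ _) ?ltry// divr_ge0// exprn_ge0.
Qed.

(* The condition is symmetric under complement and stable under countable unions,
   so that all Borel sets satisfy it. *)
Definition dyadic_regular B := forall e : R, (0 < e)%R -> exists U V,
  [/\ dyadic_open U, dyadic_open V, B `&` W `<=` U, W `\` B `<=` V &
      mu (U `&` V `&` W) <= e%:E].

Let regularC B : dyadic_regular B -> dyadic_regular (~` B).
Proof.
move=> rB e /rB[U [V [oU oV BU BV UVe]]]; exists V, U; split => //.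
- by move=> x [nBx Wx]; apply: BV.
- by move=> x [Wx nnBx]; apply: BU; split => //; exact: contrapT.
- by rewrite (setIC V U).
Qed.

(** The full intersection of the [V k] need not be dyadic open, so it is cut at a finite [m]. The
    overlap is then covered by the individual overlaps, of total measure at most e / 2, and by the
    part [P m] of the union not reached before [m], made smaller than e / 2. *)
Let regular_bigcup (B : (set 'rV[R]_d)^nat) :
  (forall k, dyadic_regular (B k)) -> dyadic_regular (\bigcup_k B k).
Proof.
move=> rB e e0.
have e20 : (0 < e / 2)%R by rewrite divr_gt0.
have ek k : (0 < e / 2 / (2 ^ k.+1)%:R)%R by rewrite divr_gt0// ltr0n expn_gt0.
have /choice[UV UVP] k : exists UV : set 'rV[R]_d * set 'rV[R]_d,
  [/\ dyadic_open UV.1, dyadic_open UV.2, B k `&` W `<=` UV.1, W `\` B k `<=` UV.2 &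
      mu (UV.1 `&` UV.2 `&` W) <= (e / 2 / (2 ^ k.+1)%:R)%:E].
  by have [U [V H]] := rB k _ (ek k); exists (U, V).
pose U k := (UV k).1; pose V k := (UV k).2.
have oU k : dyadic_open (U k) by have [] := UVP k.
have oV k : dyadic_open (V k) by have [] := UVP k.
have mU k : measurable (U k) by exact: measurable_dyadic_open.
have mV k : measurable (V k) by exact: measurable_dyadic_open.
pose P m := (\bigcup_k U k `\` \bigcup_(k in `I_m) U k) `&` W.
have mP m : measurable (P m).
  apply: measurableI => //; apply: measurableD; first exact: bigcupT_measurable.
  exact: bigcup_measurable.
have [m Pm] : exists m, mu (P m) <= (e / 2)%:E.
  apply: lebesgue_rV_shrink => //.
  - move=> k l kl x [[Ux nUx] Wx]; split => //; split => //.
    by move=> [i /= ik Uix]; apply: nUx; exists i => //=; exact: leq_trans kl.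
  - apply/seteqP; split => // x Px; have [[[i _ Uix] _] _] := Px 0%N I.
    by have [[_ nUx] _] := Px i.+1 I; apply: nUx; exists i => //=.
  - by apply: W_lty => //; exact: subIsetr.
exists (\bigcup_k U k), (\bigcap_(k in `I_m) V k); split.
- by apply: dyadic_open_bigcup => k _.
- exact: dyadic_open_bigcap_lt.
- move=> x [[k _ Bkx] Wx]; exists k => //.
  by have [_ _ + _ _] := UVP k; apply.
- move=> x [Wx nBx] k _; have [_ _ _ + _] := UVP k; apply; split => //.
  by move=> Bkx; apply: nBx; exists k.
apply: (@le_trans _ _ (mu (\bigcup_k (U k `&` V k `&` W) `|` P m))).
  apply: le_measure; rewrite ?inE.
  - apply: measurableI => //; apply: measurableI; first exact: bigcupT_measurable.
    by apply: measurable_dyadic_open; exact: dyadic_open_bigcap_lt.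
  - by apply: measurableU => //; apply: bigcupT_measurable => k; do 2 apply: measurableI => //.
  - move=> x [[[i _ Uix] Vx] Wx].
    have [[l lm Ulx]|nU] := pselect (exists2 l, (l < m)%N & U l x).
      by left; exists l => //; split => //; split => //; exact: Vx.
    right; split => //; split; first by exists i.
    by move=> [l lm Ulx]; apply: nU; exists l.
have mUVW k : measurable (U k `&` V k `&` W) by do 2 apply: measurableI => //.
apply: (@le_trans _ _ (mu (\bigcup_k (U k `&` V k `&` W)) + mu (P m))).
  by apply: measureU2 => //; exact: bigcupT_measurable.
rewrite (splitr e) EFinD leeD//.
apply: (@le_trans _ _ (\sum_(k <oo) mu (U k `&` V k `&` W))).
  by apply: measure_sigma_subadditive => //; exact: bigcupT_measurable.
apply: (@le_trans _ _ (\sum_(k <oo) (0 + (e / 2 / (2 ^ k.+1)%:R)%:E))).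
  apply: lee_nneseries => [k _ _//|k _]; rewrite add0e.
  by have [] := UVP k.
apply: (le_trans (@epsilon_trick R (fun=> 0) _ _ _ (ltW e20))) => //.
by rewrite eseries0// add0e.
Qed.

Let regular0 : dyadic_regular set0.
Proof.
move=> e e0; exists set0, setT; split => //.
- exact: dyadic_open_setT.
- by rewrite !set0I measure0 lee_fin ltW.
Qed.

(** The half-space is its own outer set, and its complement is enlarged by 1 / (k + 1); the overlaps
    are slabs that decrease to the empty set. *)
Let regular_gt i (q : R) : dyadic_regular [set x | (q < x ord0 i)%R].
Proof.
move=> e e0; pose U : set 'rV[R]_d := [set x | (q < x ord0 i)%R].
pose V k : set 'rV[R]_d := [set x | (x ord0 i < q + k.+1%:R^-1)%R].
have small (t : R) : (0 < t)%R -> exists k, (1 / 2 ^+ k < t)%R.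
  move=> t0; have t10 : (0 <= t^-1)%R by rewrite invr_ge0 ltW.
  have [k [_ kt]] := expr_unbounded t10 (ltr1n R 2).
  by exists k; rewrite div1r invf_plt ?posrE ?exprn_gt0.
have dx k x y : dyadic k (dyadic_index k x) y ->
    (`|y ord0 i - x ord0 i| < 1 / 2 ^+ k)%R.
  move=> yx; have := yx i; have := dyadic_indexP k x i.
  by move=> /andP[h1 h2] /andP[h3 h4]; rewrite ltr_norml; apply/andP; split; lra.
have oU : dyadic_open U.
  move=> x /= qx; have [k kx] := small _ (eq_ind_r is_true qx (subr_gt0 _ _)).
  by exists k => y /dx; rewrite /U /= ltr_norml => /andP[h1 h2]; lra.
have oVr (r : R) : dyadic_open [set x : 'rV[R]_d | (x ord0 i < r)%R].
  move=> x /= qx; have [l lx] := small _ (eq_ind_r is_true qx (subr_gt0 _ _)).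
  by exists l => y /dx; rewrite /= ltr_norml => /andP[h1 h2]; lra.
have oV k : dyadic_open (V k) by exact: oVr.
have [k ke] : exists k, mu (U `&` V k `&` W) <= e%:E.
  apply: (@lebesgue_rV_shrink (fun k => U `&` V k `&` W)) => //.
  - move=> k; do 2 apply: measurableI => //; exact: measurable_dyadic_open.
  - move=> k l kl x [[Ux Vx] Wx]; split => //; split => //.
    apply: (lt_le_trans Vx); rewrite lerD2l lef_pV2 ?posrE//.
    by rewrite ler_nat ltnS.
  - apply/seteqP; split => // x Hx; have [[qx _] _] := Hx 0%N I.
    have qx0 : (0 < x ord0 i - q)%R by rewrite subr_gt0.
    have [k _ /(_ k (leqnn k)) /= kq] := near_infty_natSinv_lt (PosNum qx0).
    have [[_ hV] _] := Hx k I; move: hV.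
    by rewrite /V /= -ltrBlDl => /lt_trans/(_ kq); rewrite ltxx.
  - apply: W_lty; last exact: subIsetr.
    by do 2 apply: measurableI => //; exact: measurable_dyadic_open.
exists U, (V k); split => //.
move=> x [_ /= /negP]; rewrite -leNgt => xq; rewrite /V /=.
  by rewrite (le_lt_trans xq)// ltrDl.
Qed.

Let regular_measurable B : measurable B -> dyadic_regular B.
Proof.
apply: smallest_sub => /=.
  split => [|A rA|F rF]; [exact: regular0| |exact: regular_bigcup].
  by rewrite setTD; exact: regularC.
move=> _ /bigsetU_memP[i [_ _ [Y mY <-]]]; rewrite setTI.
move: Y mY; suff : @measurable _ R `<=`
    [set Y | dyadic_regular ((fun x : 'rV[R]_d => x ord0 i) @^-1` Y)] by exact.
have -> : @measurable _ R = <<s @RGenOInfty.G R >> by exact: RGenOInfty.measurableE.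
apply: smallest_sub => /=.
  split => [|A rA|F rF] /=.
  - by rewrite preimage_set0; exact: regular0.
  - by rewrite setTD preimage_setC; exact: regularC.
  - by rewrite preimage_bigcup; exact: regular_bigcup.
move=> _ [q ->] /=.
have -> : (fun x : 'rV[R]_d => x ord0 i) @^-1` `]q, +oo[%classic =
    [set x | (q < x ord0 i)%R].
  by apply/seteqP; split => x /=; rewrite in_itv/= andbT.
exact: regular_gt.
Qed.

(** The outer set [U] exceeds [B] inside [W] only within the overlap [U]&[V], of measure at most
    e. *)
Lemma hausdorff_delta_dyadic_le (delta : R) B : (0 < delta)%R -> measurable B ->
  hausdorff_delta d delta (B `&` W) <= mu (B `&` W).
Proof.
move=> delta0 mB; apply/lee_addgt0Pr => e e0.
have [U [V [oU oV BU BV UVe]]] := regular_measurable mB e0.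
have oW : dyadic_open W by exact: dyadic_open_dyadic.
apply: (@le_trans _ _ (mu (U `&` W))).
  apply: le_trans (hausdorff_delta_dyadic_open delta0 (dyadic_openI oU oW)).
  by apply: le_outer_measure => x BWx; split; [exact: BU|case: BWx].
have mU := measurable_dyadic_open oU; have mV := measurable_dyadic_open oV.
apply: (@le_trans _ _ (mu ((B `&` W) `|` (U `&` V `&` W)))).
  apply: le_measure; rewrite ?inE.
  - exact: measurableI.
  - by apply: measurableU; [exact: measurableI|do 2 apply: measurableI => //].
  - move=> x [Ux Wx]; have [Bx|nBx] := pselect (B x); first by left.
    by right; split => //; split => //; apply: BV.
apply: (@le_trans _ _ (mu (B `&` W) + mu (U `&` V `&` W))).
  by apply: measureU2; [exact: measurableI|do 2 apply: measurableI => //].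
exact: leeD.
Qed.

End dyadic_regularity.

Section hausdorff_le_lebesgue.
Local Open Scope ereal_scope.
Context {R : realType}.

Lemma hausdorff_delta_le_lebesgue d (delta : R) (B : set 'rV[R]_d) :
  (0 < delta)%R -> measurable B -> hausdorff_delta d delta B <= lebesgue_rV B.
Proof.
move=> delta0 mB.
have [F [tF FT Fc]] := dyadic_open_partition (@dyadic_open_setT R d).
have mF k : measurable (F k).
  by case: (Fc k) => [->|[j [z ->]]]; [exact: measurable0|exact: measurable_dyadic].
have BE : B = \bigcup_k (B `&` F k) by rewrite -setI_bigcupr FT setIT.
rewrite [in leRHS]BE measure_bigcup//; last 2 first.
- by move=> k _; exact: measurableI.
- exact: trivIset_setIl.
rewrite [leRHS](eq_eseriesl (Q := xpredT)); last by move=> k; rewrite in_setT.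
rewrite [in leLHS]BE.
apply: (le_trans (outer_measure_sigma_subadditive _ (fun k => B `&` F k))).
apply: lee_nneseries => [k _ _|k _]; first exact: outer_measure_ge0.
case: (Fc k) => [->|[j [z ->]]]; first by rewrite setI0 outer_measure0.
exact: hausdorff_delta_dyadic_le.
Qed.

Lemma hausdorff_isometry_le d n (f : 'rV[R]_d -> 'rV[R]_n) (A : set 'rV[R]_n) :
  (forall x y, enorm (f x - f y) = enorm (x - y)) ->
  measurable (f @^-1` A) -> A `<=` range f ->
  hausdorff d A <= lebesgue_rV (f @^-1` A).
Proof.
move=> fi mA Af; apply: ge_ereal_sup => _ [delta /= delta0 <-].
have -> : hausdorff_delta d delta A = hausdorff_delta d delta (f @` (f @^-1` A)).
  congr hausdorff_delta; apply/seteqP; split => [y Ay|_ [x Ax <-]//].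
  by have [x _ xy] := Af y Ay; exists x => //=; rewrite xy.
apply: le_trans (hausdorff_delta_le_lebesgue delta0 mA).
exact: hausdorff_delta_isometry.
Qed.

End hausdorff_le_lebesgue.

(** * From the measure of sets to integrals *)

Section integral_hausdorff.
Local Open Scope ereal_scope.
Context {R : realType}.
Import HBNNSimple.

Lemma hausdorff_ge0 d n (A : set 'rV[R]_n) : 0 <= hausdorff d A.
Proof.
apply: (@le_trans _ _ (hausdorff_delta d 1%R A)); first exact: outer_measure_ge0.
by apply: ereal_sup_ubound; exists 1%R => //=.
Qed.

Lemma hausdorff_set0 d n : hausdorff d (set0 : set 'rV[R]_n) = 0.
Proof.
apply/eqP; rewrite eq_le hausdorff_ge0 andbT.
by apply: ge_ereal_sup => _ [delta _ <-]; rewrite outer_measure0.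
Qed.

(* The additivity of [hausdorff d] is not used: the integral unfolds to a supremum
   over simple functions, whose sums are compared term by term. *)
Lemma integral_hausdorff_le d n (f : 'rV[R]_d -> 'rV[R]_n) (g : 'rV[R]_n -> R)
    (D : set 'rV[R]_n) :
  (forall x y, enorm (f x - f y) = enorm (x - y)) -> measurable_fun setT f ->
  measurable D -> D `<=` range f ->
  measurable_fun setT g -> (forall x, (0 <= g x)%R) ->
  \int[hausdorff d]_(x in D) (g x)%:E <= \int[lebesgue_rV]_y (g (f y))%:E.
Proof.
move=> fi mf mD Df mg g0; rewrite [leLHS]/integral.
set gD := (fun x => (g x)%:E) \_ D.
have gD0 x : 0 <= gD x by rewrite /gD patchE; case: ifP => _; rewrite lee_fin.
have -> : gD ^\+ = gD.
  by apply/funext => x; rewrite (@ge0_funeposE _ _ setT)// ?in_setT.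
have s0 : sintegral (@hausdorff R n d) (@nnsfun0 _ 'rV[R]_n R) = 0.
  rewrite /sintegral fsbig1// => r _ /=.
  have [->|r0] := eqVneq r 0%R; first by rewrite mul0e.
  have -> : (@cst 'rV[R]_n R 0%R) @^-1` [set r] = set0.
    by apply/seteqP; split => // x /= /esym/eqP; rewrite (negbTE r0).
  by rewrite hausdorff_set0 mule0.
(* The subtracted supremum, for the negative part, is nonnegative since the zero function competes
   in it. *)
apply: (@le_trans _ _ (ereal_sup [set sintegral (@hausdorff R n d) h |
    h in [set h : {nnsfun 'rV[R]_n >-> R} | forall x, (h x)%:E <= gD x]])).
  rewrite geeDl// oppe_le0 -s0; apply: ereal_sup_ubound; exists nnsfun0 => // x.
  by rewrite /= funeneg_ge0.
pose nu : {measure set 'rV[R]_n -> \bar R} :=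
  measure_function_pushforward__canonical__measure_function_Measure
    (@lebesgue_rV R d) mf.
have -> : \int[lebesgue_rV]_y (g (f y))%:E = \int[nu]_x (g x)%:E.
  rewrite ge0_integral_pushforward//.
  - exact/measurable_EFinP.
  - by move=> x _; rewrite lee_fin.
apply: ge_ereal_sup => _ [h /= hg <-].
apply: (@le_trans _ _ (sintegral nu h)); last first.
  rewrite -integralT_nnsfun; apply: ge0_le_integral => //.
  - by move=> x _; rewrite lee_fin.
  - by apply/measurable_EFinP; exact: measurable_funP.
  - exact/measurable_EFinP.
  - move=> x _; apply: (le_trans (hg x)); rewrite /gD patchE; case: ifP => // _.
    by rewrite lee_fin.
(* Gives the two sums the same finite index set, so that they compare termwise. *)
have widen (m : set 'rV[R]_n -> \bar R) : m set0 = 0 ->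
    sintegral m h = \sum_(r \in range h) (r%:E * m (h @^-1` [set r])).
  move=> m0; rewrite /sintegral; apply/esym/fsbig_widen => // r [_ nhr] /=.
  have -> : h @^-1` [set r] = set0; last by rewrite m0 mule0.
  by apply/seteqP; split => // x hx; apply: nhr; exists x.
rewrite !widen//; last exact: hausdorff_set0.
apply: lee_fsum => // r [x _ <-]; set r0 := h x.
have r00 : (0 <= r0)%R by exact: fun_ge0.
(* The level set of 0 may leave the range of [f], but its term vanishes; any other level set lies in
   [D], because [h] is below [gD]. *)
have [->|rn0] := eqVneq r0 0%R; first by rewrite !mul0e.
apply: lee_pmul => //; [exact: hausdorff_ge0|].
apply: hausdorff_isometry_le => //.
  by rewrite -[X in measurable X]setTI; apply: (mf measurableT); exact: measurable_sfunP.
move=> y /= hy; apply: Df; apply: contrapT => nDy.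
have := hg y; rewrite hy /gD patchE memNset// lee_fin => r0le.
by move/eqP: rn0; apply; apply/eqP; rewrite eq_le r00 r0le.
Qed.

End integral_hausdorff.

(** * Reflections and isometric charts of hyperplanes *)

Section reflections.
Context {R : realType} {n : nat}.
Implicit Types v x y : 'rV[R]_n.

(* For [v = 0] the coefficient is [0 / 0 = 0], so [reflection 0] is the identity. *)
Definition reflection v x : 'rV[R]_n := x - (2 * dot x v / dot v v) *: v.

Lemma reflection_dot v x y : dot (reflection v x) (reflection v y) = dot x y.
Proof.
rewrite /reflection !(dotBl, dotBr, dotZl, dotZr) (dotC v y).
have [v0|v0] := eqVneq (dot v v) 0; first by rewrite v0 invr0; ring.
by field.
Qed.

Lemma reflectionK v : involutive (reflection v).
Proof.
move=> x; rewrite {1}/reflection; set r := reflection v x.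
have -> : dot r v = - dot x v.
  rewrite /r /reflection dotBl dotZl; have [v0|v0] := eqVneq (dot v v) 0.
    by rewrite (dotxx_eq0 v0) (dotC x 0) !dot0l !mulr0 subr0 oppr0.
  by field.
by rewrite mulrN mulNr scaleNr opprK /r /reflection subrK.
Qed.

Lemma reflectionB v x y : reflection v x - reflection v y = reflection v (x - y).
Proof.
rewrite /reflection dotBl mulrBr mulrBl scalerBl.
by rewrite !opprB addrACA [RHS]addrACA [in RHS](addrC (- y)).
Qed.

Lemma reflection_swap x y : dot x x = dot y y -> reflection (x - y) x = y.
Proof.
move=> xy; rewrite /reflection; have [v0|v0] := eqVneq (dot (x - y) (x - y)) 0.
  by apply/esym/eqP; rewrite v0 invr0 mulr0 scale0r subr0 eq_sym -subr_eq0 (dotxx_eq0 v0).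
rewrite (_ : _ / _ = 1) ?scale1r ?subKr//.
apply: (mulIf v0); rewrite divfK// mul1r !(dotBl, dotBr) (dotC y x) -xy.
ring.
Qed.

Lemma measurable_reflection d' (T : measurableType d') v (f : T -> 'rV[R]_n) :
  (forall i, measurable_fun [set: T] (fun t => f t ord0 i)) ->
  measurable_fun [set: T] (fun t => reflection v (f t)).
Proof.
move=> mf; apply: measurable_fun_rV => i.
under eq_fun do rewrite !mxE.
apply: measurable_funB => //; do 3 apply: measurable_funM => //.
apply: measurable_sum => j; exact: measurable_funM.
Qed.

End reflections.

Section hyperplane_parametrization.
Context {R : realType} {d : nat}.
Implicit Types (xi a : 'rV[R]_d.+1) (t : R) (y z : 'rV[R]_d).

Let e0 : 'rV[R]_d.+1 := rV_cons (1, 0).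

Let dot_e0 x : dot x e0 = x ord0 ord0.
Proof. by rewrite -[x]rV_unconsK dot_cons dotC dot0l addr0 mulr1 rV_cons0. Qed.

Let swap_e0 xi : enorm xi = 1 -> reflection (e0 - xi) e0 = xi.
Proof.
by move=> xi1; apply: reflection_swap; rewrite dot_e0 rV_cons0 -sqr_enorm xi1 expr1n.
Qed.

(* The reflection exchanging e_0 and xi maps {x_0 = t} onto {<x, xi> = t}. *)
Definition hyperplane_param xi t y : 'rV[R]_d.+1 :=
  reflection (rV_cons (1, 0) - xi) (rV_cons (t, y)).

Lemma hyperplane_param_isometry xi t y z :
  enorm (hyperplane_param xi t y - hyperplane_param xi t z) = enorm (y - z).
Proof.
by rewrite /enorm reflectionB reflection_dot rV_consB dot_cons subrr mul0r add0r.
Qed.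

Lemma range_hyperplane_param xi t (x : 'rV[R]_d.+1) : enorm xi = 1 ->
  dot x xi = t -> exists y, hyperplane_param xi t y = x.
Proof.
move=> xi1 xt; set v := e0 - xi.
exists (rV_uncons (reflection v x)).2.
have -> : t = (rV_uncons (reflection v x)).1.
  by rewrite /= -dot_e0 -xt -{1}(swap_e0 xi1) -{1}(reflectionK v x) reflection_dot.
rewrite /hyperplane_param -[RHS](reflectionK v); congr (reflection _ _).
by rewrite -[RHS]rV_unconsK; case: (rV_uncons _).
Qed.

(** Pythagoras: [b] is the projection of [a] in the chart, so a Gaussian restricted to the
    hyperplane is a multiple of a Gaussian centered at [b]. *)
Lemma hyperplane_param_dist xi t a : enorm xi = 1 ->
  exists b : 'rV[R]_d, forall y,
    dot (hyperplane_param xi t y - a) (hyperplane_param xi t y - a) =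
    (t - dot a xi) ^+ 2 + dot (y - b) (y - b).
Proof.
move=> xi1; set v := e0 - xi.
exists (rV_uncons (reflection v a)).2 => y.
rewrite -{1 2}(reflectionK v a) /hyperplane_param -/e0 -/v !reflectionB reflection_dot.
have -> : dot a xi = (rV_uncons (reflection v a)).1.
  by rewrite /= -dot_e0 -{1}(swap_e0 xi1) -{1}(reflectionK v a) reflection_dot.
rewrite -{1 2}[reflection v a]rV_unconsK.
case: (rV_uncons (reflection v a)) => u b /=.
by rewrite rV_consB dot_cons expr2.
Qed.

Lemma measurable_hyperplane_param xi t :
  measurable_fun [set: 'rV[R]_d] (hyperplane_param xi t).
Proof.
apply: measurable_reflection => i.
case: (unliftP ord0 i) => [j|] ->.
  by under eq_fun do rewrite rV_consS; exact: measurable_rV_coord.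
by under eq_fun do rewrite rV_cons0; exact: measurable_cst.
Qed.

End hyperplane_parametrization.

(** * Gaussian densities *)

Section gaussian_density.
Local Open Scope ereal_scope.
Context {R : realType}.

(** Product of one-dimensional normal densities of deviation [s]. The mixture has deviation 1;
    deviation 2 serves as a comparison for the tail. *)
Definition gaussian n (s : R) (a x : 'rV[R]_n) : R :=
  (normal_peak s ^+ n * expR (- dot (x - a) (x - a) / (s ^+ 2 *+ 2)))%R.

Lemma gaussian_ge0 n (s : R) (a x : 'rV[R]_n) : (0 <= gaussian s a x)%R.
Proof. by rewrite mulr_ge0 ?expR_ge0// exprn_ge0// normal_peak_ge0. Qed.

Lemma measurable_gaussian n (s : R) (a : 'rV[R]_n) :
  measurable_fun [set: 'rV[R]_n] (gaussian s a).
Proof.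
apply: measurable_funM => //; apply: measurableT_comp => //.
apply: measurable_funM => //; apply: measurable_funN.
exact: measurable_dot_sub.
Qed.

Lemma gaussian_cons n (s t u : R) (a x : 'rV[R]_n) : s != 0%R ->
  gaussian s (rV_cons (t, a)) (rV_cons (u, x)) = (normal_pdf t s u * gaussian s a x)%R.
Proof.
move=> s0; rewrite /gaussian normal_pdfE// /normal_fun.
rewrite rV_consB dot_cons exprS -expr2 opprD mulrDl expRD; ring.
Qed.

Lemma integral_gaussian n (s : R) (a : 'rV[R]_n) : s != 0%R ->
  \int[lebesgue_rV]_x (gaussian s a x)%:E = 1.
Proof.
move=> s0; elim: n a => [|n IH] a.
  rewrite integral_dirac//; last by apply/measurable_EFinP; exact: measurable_gaussian.
  rewrite diracE in_setT mul1e /gaussian expr0 mul1r.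
  by rewrite /dot big_ord0 oppr0 mul0r expR0.
rewrite -[a]rV_unconsK; case: (rV_uncons a) => t b.
have -> : \int[lebesgue_rV]_x (gaussian s (rV_cons (t, b)) x)%:E =
  \int[pushforward (@lebesgue_measure R \x @lebesgue_rV R n) (@rV_cons R n)]_x
    (gaussian s (rV_cons (t, b)) x)%:E by [].
pose c : measurableTypeR R * 'rV[R]_n -> 'rV[R]_n.+1 := @rV_cons R n.
have mc : measurable_fun [set: measurableTypeR R * 'rV[R]_n] c.
  exact: measurable_rV_cons.
rewrite (@ge0_integral_pushforward _ _ _ _ R _ mc
  (@lebesgue_measure R \x @lebesgue_rV R n) setT)//; last 2 first.
- by apply/measurable_EFinP; exact: measurable_gaussian.
- by move=> x _; rewrite lee_fin gaussian_ge0.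
rewrite preimage_setT fubini_tonelli1; last 2 first.
- apply: measurableT_comp; last exact: mc.
  by apply/measurable_EFinP; exact: measurable_gaussian.
- by move=> x; rewrite lee_fin gaussian_ge0.
rewrite -[RHS](integral_normal_pdf t s); apply: eq_integral => u _.
rewrite /fubini_F /=.
under eq_integral do rewrite gaussian_cons// EFinM.
rewrite ge0_integralZl//.
- by rewrite [X in _ * X](IH b) mule1.
- by apply/measurable_EFinP; exact: measurable_gaussian.
- by move=> x _; rewrite lee_fin gaussian_ge0.
- by rewrite lee_fin normal_pdf_ge0.
Qed.

Lemma gaussian_section n (xi : 'rV[R]_n.+1) (t : R) (a : 'rV[R]_n.+1) : enorm xi = 1%R ->
  \int[lebesgue_rV]_y (gaussian 1 a (hyperplane_param xi t y))%:E =
  (normal_peak 1 * gauss (t - dot a xi))%:E.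
Proof.
move=> xi1; have [b hb] := hyperplane_param_dist t a xi1.
under eq_integral => y _.
  have -> : gaussian 1 a (hyperplane_param xi t y) =
      (normal_peak 1 * gauss (t - dot a xi) * gaussian 1 b y)%R.
    rewrite /gaussian /gauss hb expr1n opprD mulrDl expRD exprS mulNr; ring.
  rewrite EFinM; over.
rewrite ge0_integralZl//.
- by rewrite [X in _ * X](@integral_gaussian n 1 b) ?mule1// oner_neq0.
- by apply/measurable_EFinP; exact: measurable_gaussian.
- by move=> x _; rewrite lee_fin gaussian_ge0.
- by rewrite lee_fin mulr_ge0 ?normal_peak_ge0 ?gauss_ge0.
Qed.

End gaussian_density.

Section gaussian_continuity.
Context {R : realType}.

Lemma continuous_sum (T : topologicalType) (I : Type) (r : seq I) (f : I -> T -> R) :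
  (forall i, continuous (f i)) -> continuous (fun x => \sum_(i <- r) f i x).
Proof.
move=> cf; elim: r => [|i r IH] x.
  rewrite (_ : (fun _ => _) = cst 0); first exact: cst_continuous.
  by apply/funext => y; rewrite big_nil.
rewrite (_ : (fun _ => _) = f i + (fun y => \sum_(j <- r) f j y)).
  by apply: continuousD; [exact: cf|exact: IH].
by apply/funext => y; rewrite big_cons.
Qed.

Lemma continuous_dot_sub n (a : 'rV[R]_n) :
  continuous (fun x : 'rV[R]_n => dot (x - a) (x - a)).
Proof.
apply: continuous_sum => i x.
have ci : {for x, continuous (fun y : 'rV[R]_n => (y - a) ord0 i)}.
  have -> : (fun y : 'rV[R]_n => (y - a) ord0 i) =
      (fun y : 'rV[R]_n => y ord0 i) - cst (a ord0 i).
    by apply/funext => y; rewrite !mxE.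
  by apply: continuousB; [exact: coord_continuous|exact: cst_continuous].
exact: (continuousM ci ci).
Qed.

Lemma continuous_gaussian n (s : R) (a : 'rV[R]_n) : continuous (gaussian s a).
Proof.
pose h := - (fun x : 'rV[R]_n => dot (x - a) (x - a)) \* cst (s ^+ 2 *+ 2)^-1.
have ch : continuous h.
  move=> x; apply: continuousM; last exact: cst_continuous.
  by apply: (@continuousN R R^o); exact: continuous_dot_sub.
have -> : gaussian s a = cst (normal_peak s ^+ n) \* (expR \o h) by [].
move=> x; apply: continuousM; first exact: cst_continuous.
by apply: continuous_comp; [exact: ch|exact: continuous_expR].
Qed.

End gaussian_continuity.

Section density_measures.
Local Open Scope ereal_scope.
Context {R : realType} {n : nat}.

Lemma measure_of_density (f : 'rV[R]_n -> R) : measurable_fun setT f ->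
  (forall x, (0 <= f x)%R) ->
  exists mu : {measure set 'rV[R]_n -> \bar R}, has_density mu f.
Proof.
move=> mf f0.
pose nu (A : set 'rV[R]_n) := \int[lebesgue_rV]_(x in A) (f x)%:E.
have nu0 : nu set0 = 0 by rewrite /nu integral_set0.
have nu_ge0 A : 0 <= nu A by apply: integral_ge0 => x _; rewrite lee_fin.
have nus : semi_sigma_additive nu.
  apply: semi_sigma_additive_nng_induced; first exact/measurable_EFinP.
  by move=> x; rewrite lee_fin.
pose m : {measure set 'rV[R]_n -> \bar R} :=
  HB.pack_for {measure set 'rV[R]_n -> \bar R} nu
    (isMeasure.Build _ _ _ nu nu0 nu_ge0 nus).
by exists m.
Qed.

End density_measures.

Section gaussian_balls.
Local Open Scope ereal_scope.
Context {R : realType} {n : nat}.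
Implicit Types (a c : 'rV[R]_n).

Lemma normal_peak2 : (normal_peak 1 = 2 * normal_peak 2 :> R)%R.
Proof.
rewrite /normal_peak expr1n mul1r.
have -> : (2 ^+ 2 * pi *+ 2 = 2 ^+ 2 * (pi *+ 2) :> R)%R by ring.
by rewrite sqrtrM ?sqr_ge0// sqrtr_sqr ger0_norm// invfM mulrA divff ?mul1r.
Qed.

(** Comparison with deviation 2: where the squared distance D is at least 9 n, the ratio of
    densities 2^n e^(- 3 D / 8) is at most (2 e^(-3))^n <= 2^(-n), and the wider Gaussian has mass
    1. *)
Lemma gaussian_tail a : (0 < n)%N ->
  \int[lebesgue_rV]_(x in ~` eball a (3 * Num.sqrt n%:R)%R) (gaussian 1 a x)%:E
    <= 2^-1%:E.
Proof.
move=> n0.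
have mB : measurable (~` eball a (3 * Num.sqrt n%:R)%R).
  by apply: measurableC; exact: measurable_eball.
have mg s : measurable_fun [set: 'rV[R]_n] (fun x => (gaussian s a x)%:E).
  by apply/measurable_EFinP; exact: measurable_gaussian.
apply: (@le_trans _ _ (\int[lebesgue_rV]_(x in ~` eball a (3 * Num.sqrt n%:R)%R)
    (2^-1%:E * (gaussian 2 a x)%:E))).
  apply: ge0_le_integral => //.
  - by move=> x _; rewrite lee_fin gaussian_ge0.
  - exact: measurable_funTS.
  - by apply: measurable_funeM; exact: measurable_funTS.
  move=> x /= /negP; rewrite -ltNge => xa; rewrite -EFinM lee_fin.
  have D9 : (9 * n%:R <= dot (x - a) (x - a))%R.
    rewrite -sqr_enorm -[X in (_ * X)%R](@sqr_sqrtr R)// (_ : 9 = 3 ^+ 2)%R; last by ring.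
    by rewrite -exprMn ler_sqr ?nnegrE ?enorm_ge0 ?mulr_ge0 ?sqrtr_ge0// ltW.
  rewrite /gaussian normal_peak2 exprMn; move: (dot _ _) D9 => D D9.
  have -> : (- D / (1 ^+ 2 *+ 2) = - D / (2 ^+ 2 *+ 2) + - (3 / 8) * D)%R.
    by rewrite expr1n; field.
  have p0 : (0 <= normal_peak (2 : R) ^+ n)%R by rewrite exprn_ge0 ?normal_peak_ge0.
  rewrite expRD [leLHS](_ : _ = (2 ^+ n * expR (- (3 / 8) * D)) *
     (normal_peak 2 ^+ n * expR (- D / (2 ^+ 2 *+ 2))))%R; last by ring.
  rewrite ler_wpM2r ?mulr_ge0 ?expR_ge0//.
  apply: (@le_trans _ _ (2 ^+ n * expR (- 3) ^+ n)%R).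
    rewrite ler_wpM2l ?exprn_ge0// -expRM_natl ler_expR.
    have : (0 <= n%:R :> R)%R by []. lra.
  rewrite -exprMn; apply: (@le_trans _ _ (2^-1 ^+ n)%R).
    rewrite lerXn2r ?nnegrE ?mulr_ge0 ?expR_ge0//.
    by rewrite expRN ler_pdivrMr ?expR_gt0//; have := expR_ge1Dx (3 : R); lra.
  have h2 : (2^-1 <= 1 :> R)%R by lra.
  by rewrite -(prednK n0) exprS ler_piMr// exprn_ile1.
rewrite ge0_integralZl//; last 2 first.
- exact: measurable_funTS.
- by move=> x _; rewrite lee_fin gaussian_ge0.
rewrite -[leRHS]mule1 lee_wpmul2l// -(@integral_gaussian R n 2 a) ?pnatr_eq0//.
apply: ge0_subset_integral => //.
by move=> x _; rewrite lee_fin gaussian_ge0.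
Qed.

Lemma gaussian_mass_ball a : (0 < n)%N ->
  2^-1%:E <=
  \int[lebesgue_rV]_(x in eball a (3 * Num.sqrt n%:R)%R) (gaussian 1 a x)%:E.
Proof.
move=> n0; set B := eball _ _.
have mB : measurable B by exact: measurable_eball.
rewrite leNgt; apply/negP => hB.
have : \int[lebesgue_rV]_x (gaussian 1 a x)%:E < 1.
  rewrite -(setUv B) ge0_integral_setU//.
  - rewrite (_ : 1 = 2^-1%:E + 2^-1%:E); last by rewrite -EFinD; congr EFin; field.
    have tail := gaussian_tail a n0.
    apply: lte_leD => //; rewrite ge0_fin_numE ?(le_lt_trans tail) ?ltry//.
    by apply: integral_ge0 => x _; rewrite lee_fin gaussian_ge0.
  - exact: measurableC.
  - by rewrite setUv; apply/measurable_EFinP; exact: measurable_gaussian.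
  - by move=> x _; rewrite lee_fin gaussian_ge0.
  - by rewrite disj_set2E setICr.
by rewrite integral_gaussian ?oner_neq0// ltxx.
Qed.

(* On the ball the standard Gaussian density is at least the inverse of the bound. *)
Lemma lebesgue_eball_le c (H : R) : (0 <= H)%R ->
  lebesgue_rV (eball c (H * Num.sqrt n%:R)%R) <=
    ((expR (H ^+ 2 / 2) / normal_peak 1) ^+ n)%:E.
Proof.
move=> H0; set B := eball _ _; set K := (_ ^+ n)%R.
have p0 : (0 < normal_peak (1 : R))%R by rewrite normal_peak_gt0// oner_neq0.
have K0 : (0 <= K)%R by rewrite exprn_ge0// divr_ge0 ?expR_ge0// ltW.
have mB : measurable B by exact: measurable_eball.
have mg : measurable_fun [set: 'rV[R]_n] (fun x => (gaussian 1 c x)%:E).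
  by apply/measurable_EFinP; exact: measurable_gaussian.
rewrite -[leLHS]mul1e -integral_cst//.
apply: (@le_trans _ _ (\int[lebesgue_rV]_(x in B) (K%:E * (gaussian 1 c x)%:E))).
  apply: ge0_le_integral => //; first by apply: measurable_funeM; exact: measurable_funTS.
  move=> x /= xB; rewrite -EFinM lee_fin /gaussian /K mulrA -exprMn divfK ?gt_eqF//.
  rewrite -expRM_natl -expRD -[leLHS]expR0 ler_expR expr1n.
  have : (dot (x - c) (x - c) <= (H * Num.sqrt n%:R) ^+ 2)%R.
    by rewrite -enorm_le// mulr_ge0// sqrtr_ge0.
  rewrite exprMn sqr_sqrtr//; lra.
rewrite ge0_integralZl//; last 2 first.
- exact: measurable_funTS.
- by move=> x _; rewrite lee_fin gaussian_ge0.
rewrite -[leRHS]mule1 lee_wpmul2l// -(@integral_gaussian R n 1 c) ?oner_neq0//.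
apply: ge0_subset_integral => //.
by move=> x _; rewrite lee_fin gaussian_ge0.
Qed.

End gaussian_balls.

(** * The convex body *)

Section convex_hull_body.
Context {R : realType} {n N : nat}.
Variables (theta : 'I_N -> 'rV[R]_n) (kappa r : R).
Hypotheses (kappa0 : 0 <= kappa) (r0 : 0 < r).

Definition hull_body : set 'rV[R]_n := [set x | exists y : 'I_N -> R,
  \sum_i `|y i| <= kappa /\ enorm (x - \sum_i y i *: theta i) <= r].

(** Presents the body as a linear image of a closed bounded set [K] of coefficients, from which
    compactness follows. *)
Let coef (k : 'I_(N + n)) : 'rV[R]_n :=
  match fintype.split k with inl i => theta i | inr j => delta_mx ord0 j end.

Let S (v : 'rV[R]_(N + n)) : 'rV[R]_n := \sum_k v ord0 k *: coef k.

Let SE v : S v = \sum_i v ord0 (lshift n i) *: theta i + rsubmx v.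
Proof.
rewrite /S big_split_ord/=; congr (_ + _).
  by apply: eq_bigr => i _; rewrite /coef (unsplitK (inl i)).
rewrite [RHS]row_sum_delta; apply: eq_bigr => j _.
by rewrite /coef (unsplitK (inr j)) mxE.
Qed.

Let K : set 'rV[R]_(N + n) := [set v : 'rV[R]_(N + n) | \sum_i `|v ord0 (lshift n i)| <= kappa /\
  dot (rsubmx v - 0) (rsubmx v - 0) <= r ^+ 2].

Let hull_bodyE : hull_body = S @` K.
Proof.
apply/seteqP; split => [x [y [yk xr]]|_ [v [vk vr] <-]].
  exists (row_mx (\row_i y i) (x - \sum_i y i *: theta i)).
    split; last by rewrite row_mxKr subr0 -enorm_le// ltW.
    by under eq_bigr do rewrite row_mxEl mxE.
  rewrite SE row_mxKr; under eq_bigr do rewrite row_mxEl mxE.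
  by rewrite addrC subrK.
exists (fun i => v ord0 (lshift n i)); split => //.
by rewrite SE addrC addKr enorm_le ?(ltW r0)//; move: vr; rewrite subr0.
Qed.

Let continuous_S : continuous S.
Proof.
rewrite /S; elim: (index_enum _) => [|k s IH] v.
  rewrite (_ : (fun _ => _) = cst 0); first exact: cst_continuous.
  by apply/funext => w; rewrite big_nil.
have -> : (fun w : 'rV[R]_(N + n) => \sum_(k <- k :: s) w ord0 k *: coef k) =
    (fun w : 'rV[R]_(N + n) => w ord0 k *: coef k) +
    (fun w : 'rV[R]_(N + n) => \sum_(k <- s) w ord0 k *: coef k).
  by apply/funext => w; rewrite big_cons.
apply: continuousD; last exact: IH.
by apply: continuousZr_tmp; exact: coord_continuous.
Qed.

Let closed_sublevel (f : 'rV[R]_(N + n) -> R) c : continuous f ->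
  closed [set v | f v <= c].
Proof.
move=> cf; have := @continuous_closedP _ _ f.
move=> [/(_ cf) h _]; exact: (h _ (@closed_le R c)).
Qed.

Lemma hull_body_compact : compact hull_body.
Proof.
rewrite hull_bodyE; apply: continuous_compact.
  by apply: continuous_subspaceT; exact: continuous_S.
apply: (@subclosed_compact _ K
  [set v | forall k, `[- (kappa + r), kappa + r]%classic (v ord0 k)]).
- have -> : K = [set v : 'rV[R]_(N + n) | \sum_i `|v ord0 (lshift n i)| <= kappa] `&`
    [set v : 'rV[R]_(N + n) | dot (rsubmx v - 0) (rsubmx v - 0) <= r ^+ 2] by [].
  apply: closedI; apply: closed_sublevel.
    apply: continuous_sum => i v.
    by apply: (@continuous_comp _ _ _
      (fun v : 'rV[R]_(N + n) => v ord0 (lshift n i)) (fun u : R => `|u|));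
      [exact: coord_continuous|exact: norm_continuous].
  apply: continuous_sum => j v.
  have cj : {for v, continuous (fun v : 'rV[R]_(N + n) => (rsubmx v - 0) ord0 j)}.
    have -> : (fun v : 'rV[R]_(N + n) => (rsubmx v - 0) ord0 j) =
      (fun v : 'rV[R]_(N + n) => v ord0 (rshift N j)).
      by apply/funext => w; rewrite subr0 mxE.
    exact: coord_continuous.
  exact: (continuousM cj cj).
- apply: (@rV_compact _ _ (fun=> `[- (kappa + r), kappa + r]%classic)) => k.
  exact: segment_compact.
- move=> v [v1 v2] k /=; rewrite in_itv/= -ler_norml.
  have {}v2 : enorm (rsubmx v) <= r by rewrite enorm_le ?(ltW r0)//; move: v2; rewrite subr0.
  case: (split_ordP k) => [i ->|j ->].
    apply: (@le_trans _ _ kappa); last by rewrite lerDl ltW.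
    by apply: le_trans v1; rewrite (bigD1 i)//= lerDl sumr_ge0.
  apply: (@le_trans _ _ r); last by rewrite lerDr.
  by have := ler_coord_enorm (rsubmx v) j; rewrite mxE => /le_trans; apply.
Qed.

Lemma hull_body_convex : convex_set (hull_body : set (convex_lmodType 'rV[R]_n)).
Proof.
apply/convex_setW => x y /[!inE] -[u [uk ur]] [w [wk wr]] l l0 l1.
rewrite inE; exists (fun i => l%:num * u i + (1 - l%:num) * w i).
have l1' : 0 < 1 - l%:num by rewrite subr_gt0.
split.
  apply: (@le_trans _ _ (l%:num * (\sum_i `|u i|) + (1 - l%:num) * (\sum_i `|w i|))).
    rewrite !mulr_sumr -big_split; apply: ler_sum => i _.
    by rewrite (le_trans (ler_normD _ _))// !normrM (gtr0_norm l0) (gtr0_norm l1').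
  have := ler_wpM2l (ltW l0) uk; have := ler_wpM2l (ltW l1') wk; lra.
have -> : (conv l x y : 'rV[R]_n) - \sum_i (l%:num * u i + (1 - l%:num) * w i) *: theta i =
    l%:num *: (x - \sum_i u i *: theta i) + (1 - l%:num) *: (y - \sum_i w i *: theta i).
  under [X in _ - X = _]eq_bigr do rewrite scalerDl -!scalerA.
  by rewrite big_split/= -!scaler_sumr !scalerBr opprD addrACA.
apply: (le_trans (ler_enormD _ _)); rewrite !enormZ (gtr0_norm l0) (gtr0_norm l1').
have := ler_wpM2l (ltW l0) ur; have := ler_wpM2l (ltW l1') wr; lra.
Qed.

Lemma hull_body_interior : hull_body° !=set0.
Proof.
(* The topology is that of the sup norm, hence the division by sqrt n; adding 1 keeps the divisor
   positive for [n = 0]. *)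
exists 0; apply/nbhs_ballP; exists (r / (Num.sqrt n%:R + 1)) => /=.
  by rewrite divr_gt0// ltr_wpDl ?sqrtr_ge0.
move=> x xb; exists (fun=> 0); split; first by rewrite big1// => i _; rewrite normr0.
rewrite big1 => [|i _]; last by rewrite scale0r.
rewrite subr0; set e := r / _ in xb.
have q0 : 0 < Num.sqrt n%:R + 1 :> R by rewrite ltr_wpDl ?sqrtr_ge0.
have e0 : 0 <= e by rewrite divr_ge0// ltW.
apply: (@le_trans _ _ (Num.sqrt n%:R * e)).
  apply: enorm_le_coord => // i; case: xb => _ /(_ ord0 i).
  by rewrite /ball/= mxE sub0r normrN => /ltW.
rewrite /e mulrCA ler_piMr ?(ltW r0)//.
by rewrite ler_pdivrMr// mul1r lerDl.
Qed.

Lemma hull_body_sym : origin_symmetric hull_body.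
Proof.
have sub x : hull_body x -> hull_body (- x).
  move=> [y [yk xr]]; exists (fun i => - y i); split.
    by under eq_bigr do rewrite normrN.
  under eq_bigr do rewrite scaleNr.
  by rewrite sumrN opprK -enormN opprD opprK.
apply/seteqP; split => [_ [x /sub Lx <-]//|x /sub Lx].
by exists (- x) => //; rewrite opprK.
Qed.

Lemma hull_body_convex_body : convex_body hull_body.
Proof.
by split; [exact: hull_body_compact|exact: hull_body_convex|exact: hull_body_interior].
Qed.

Lemma measurable_hull_body : measurable hull_body.
Proof.
rewrite -[hull_body]setCK; apply: measurableC; apply: open_measurable_rV.
apply: closed_openC; apply: compact_closed; last exact: hull_body_compact.
exact: norm_hausdorff.
Qed.

Lemma hull_body_eball (y : 'I_N -> R) : \sum_i `|y i| <= kappa ->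
  eball (\sum_i y i *: theta i) r `<=` hull_body.
Proof. by move=> yk x xr; exists y. Qed.

End convex_hull_body.

Section hull_body_volume.
Context {R : realType} {n M k : nat}.
Variables (E : 'I_(M * n) -> {ffun 'I_n -> bool}) (h : R).
Hypotheses (n0 : (0 < n)%N) (h0 : 0 <= h).
Hypothesis Eh : forall x : 'rV[R]_n,
  \sum_i `|dot (signv (E i)) x| <= h * n%:R * enorm x.

Let theta i : 'rV[R]_n := Num.sqrt n%:R *: signv (E i).

Let nR : 0 < n%:R :> R. Proof. by rewrite ltr0n. Qed.

(** Duality: pairing the combination v with itself gives |v|^2 <= (1 / n) sqrt n h n |v|. *)
Let enorm_theta_comb (w : 'I_(M * n) -> R) : (forall i, `|w i| <= n%:R^-1) ->
  enorm (\sum_i w i *: theta i) <= h * Num.sqrt n%:R.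
Proof.
move=> w1; set v := \sum_i _.
have c0 : 0 <= h * Num.sqrt n%:R by rewrite mulr_ge0// sqrtr_ge0.
have [->//|v0] := eqVneq (enorm v) 0.
have vp : 0 < enorm v by rewrite lt_def v0 enorm_ge0.
rewrite -(ler_pM2r vp) -expr2 sqr_enorm {1}/v dot_suml.
have H i : dot (w i *: theta i) v <=
    n%:R^-1 * Num.sqrt n%:R * `|dot (signv (E i)) v|.
  rewrite /theta !dotZl mulrA (le_trans (ler_norm _))// !normrM.
  by rewrite (ger0_norm (sqrtr_ge0 _)) !ler_wpM2r ?sqrtr_ge0.
apply: (le_trans (ler_sum _ (fun i _ => H i))); rewrite -mulr_sumr.
apply: le_trans (ler_wpM2l _ (Eh v)) _; first by rewrite mulr_ge0 ?sqrtr_ge0// invr_ge0 ltW.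
by rewrite le_eqVlt; apply/orP; left; apply/eqP; field; rewrite gt_eqF.
Qed.

Let center (z : {ffun 'I_(M * n) -> bool * 'I_(k * n).+1}) : 'rV[R]_n :=
  \sum_i (sgnat (z i) / n%:R) *: theta i.

Let net := [set z : {ffun 'I_(M * n) -> bool * 'I_(k * n).+1} | (mass z <= k * n)%N].

(* Rounding the coordinates n y_i to integers moves the center by at most
   h sqrt n, by the assumption on E. *)
Let cover : hull_body theta k%:R (3 * Num.sqrt n%:R) `<=`
  \bigcup_(z in net) eball (center z) ((3 + h) * Num.sqrt n%:R).
Proof.
move=> x [y [yk xr]].
have : \sum_i `|n%:R * y i| <= (k * n)%:R.
  under eq_bigr do rewrite normrM (ger0_norm (ltW nR)).
  by rewrite -mulr_sumr natrM mulrC ler_wpM2r ?(ltW nR).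
move=> /round_mass[z [zm zy]]; exists z => //=.
rewrite /eball/= -(subrK (\sum_i y i *: theta i) x) -addrA mulrDl.
apply: (le_trans (ler_enormD _ _)); rewrite lerD// /center -sumrB.
under eq_bigr do rewrite -scalerBl.
apply: enorm_theta_comb => i.
have -> : y i - sgnat (z i) / n%:R = (n%:R * y i - sgnat (z i)) / n%:R.
  by field; rewrite gt_eqF.
by rewrite normrM normfV (ger0_norm (ltW nR)) ler_piMl// invr_ge0 ltW.
Qed.

(** [2 ^+ k * 4 ^+ M] counts the centers and the last factor bounds a covering ball, both as n-th
    powers. *)
Lemma lebesgue_hull_body_le :
  (lebesgue_rV (hull_body theta k%:R (3 * Num.sqrt n%:R)) <=
    ((2 ^+ k * 4 ^+ M * (expR ((3 + h) ^+ 2 / 2) / normal_peak 1)) ^+ n)%:E)%E.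
Proof.
set V := expR _ / _.
have V0 : 0 <= V by rewrite divr_ge0 ?expR_ge0 ?normal_peak_ge0.
have r0 : 0 < 3 * Num.sqrt n%:R :> R by rewrite mulr_gt0// sqrtr_gt0.
apply: (@le_trans _ _ (\sum_(z \in net)
    lebesgue_rV (eball (center z) ((3 + h) * Num.sqrt n%:R)))%E).
  apply: content_sub_fsum => //; first exact: finite_finset.
  - by move=> z _; exact: measurable_eball.
  - exact: measurable_hull_body.
apply: (@le_trans _ _ (\sum_(z \in net) (V ^+ n)%:E)%E).
  apply: lee_fsum => [|z _]; first exact: finite_finset.
  by apply: lebesgue_eball_le; rewrite addr_ge0.
have -> : net = [set` [pred z : {ffun 'I_(M * n) -> bool * 'I_(k * n).+1} | (mass z <= k * n)%N]].
  by apply/seteqP; split.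
rewrite -(@bigfs _ _ _ _ (index_enum _)) ?index_enum_uniq//; last first.
  by move=> z _; rewrite mem_index_enum.
rewrite sumEFin lee_fin sumr_const -[_ *+ _]mulr_natl.
apply: le_trans (ler_wpM2r _ (@card_mass_le R _ _)) _; first by rewrite exprn_ge0.
by rewrite !exprM -!exprMn.
Qed.
End hull_body_volume.

Section gaussian_mixtures.
Local Open Scope ereal_scope.
Context {R : realType}.

Definition gaussian_mixture n (A : seq 'rV[R]_n) (x : 'rV[R]_n) : R :=
  (\sum_(a <- A) gaussian 1 a x)%R.

Lemma gaussian_mixture_ge0 n (A : seq 'rV[R]_n) x : (0 <= gaussian_mixture A x)%R.
Proof. by apply: sumr_ge0 => a _; exact: gaussian_ge0. Qed.

Lemma continuous_gaussian_mixture n (A : seq 'rV[R]_n) : continuous (gaussian_mixture A).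
Proof. by apply: continuous_sum => a; exact: continuous_gaussian. Qed.

Lemma measurable_gaussian_mixture n (A : seq 'rV[R]_n) :
  measurable_fun setT (gaussian_mixture A).
Proof. by apply: measurable_sum => a; exact: measurable_gaussian. Qed.

Lemma translate_perp n (xi : 'rV[R]_n) t : enorm xi = 1%R ->
  translate (perp xi) (t *: xi)%R = [set x | dot x xi = t].
Proof.
move=> xi1; have xx : dot xi xi = 1%R by rewrite -sqr_enorm xi1 expr1n.
apply/seteqP; split => [_ [y yx <-]|x /= xt].
  by rewrite /= dotDl dotZl xx mulr1 yx add0r.
exists (x - t *: xi)%R; last by rewrite subrK.
by rewrite /perp/= dotBl dotZl xx mulr1 xt subrr.
Qed.

Lemma measurable_hyperplane n (xi : 'rV[R]_n) t : measurable [set x | dot x xi = t].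
Proof.
have m : measurable_fun [set: 'rV[R]_n] (fun x => dot x xi).
  apply: measurable_sum => i; apply: measurable_funM => //.
  exact: measurable_rV_coord.
by rewrite -[X in measurable X]setTI; exact: (m measurableT _ (measurable_set1 t)).
Qed.

(** The section is enlarged to the whole hyperplane, over which each Gaussian integrates exactly. *)
Lemma mu_plus_gaussian_mixture_le n (A : seq 'rV[R]_n.+1) L xi t :
  measurable L -> enorm xi = 1%R ->
  mu_plus (gaussian_mixture A) (L `&` translate (perp xi) (t *: xi)%R) <=
    (normal_peak 1 * \sum_(a <- A) gauss (t - dot a xi))%:E.
Proof.
move=> mL xi1; rewrite translate_perp// /mu_plus.
apply: (@le_trans _ _ (\int[lebesgue_rV]_y
    (gaussian_mixture A (hyperplane_param xi t y))%:E)).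
  apply: integral_hausdorff_le.
  - exact: hyperplane_param_isometry.
  - exact: measurable_hyperplane_param.
  - by apply: measurableI => //; exact: measurable_hyperplane.
  - by move=> x [_ xt]; have [y <-] := range_hyperplane_param xi1 xt; exists y.
  - exact: measurable_gaussian_mixture.
  - exact: gaussian_mixture_ge0.
under eq_integral do rewrite /gaussian_mixture -sumEFin.
rewrite ge0_integral_sum//; last 2 first.
- move=> a; apply/measurable_EFinP.
  apply: (measurableT_comp (measurable_gaussian _ _)).
  exact: measurable_hyperplane_param.
- by move=> a y _; rewrite lee_fin gaussian_ge0.
rewrite mulr_sumr -sumEFin; apply: lee_sum => a _.
by rewrite gaussian_section.
Qed.

Lemma gaussian_mixture_mass n (A : seq 'rV[R]_n) L : (0 < n)%N -> measurable L ->
  {in A, forall a, eball a (3 * Num.sqrt n%:R)%R `<=` L} ->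
  ((size A)%:R / 2)%:E <= \int[lebesgue_rV]_(x in L) (gaussian_mixture A x)%:E.
Proof.
move=> n0 mL AL.
under eq_integral do rewrite /gaussian_mixture -sumEFin.
rewrite ge0_integral_sum//; last 2 first.
- by move=> a; apply/measurable_funTS/measurable_EFinP; exact: measurable_gaussian.
- by move=> a x _; rewrite lee_fin gaussian_ge0.
have -> : ((size A)%:R / 2)%:E = \sum_(a <- A) (2^-1 : R)%:E.
  by rewrite sumEFin big_const_seq count_predT iter_addr_0 mulr_natl.
rewrite !big_seq; apply: lee_sum => a aA.
apply: le_trans (gaussian_mass_ball a n0) _.
apply: ge0_subset_integral => //.
- exact: measurable_eball.
- by apply/measurable_funTS/measurable_EFinP; exact: measurable_gaussian.
- by move=> x _; rewrite lee_fin gaussian_ge0.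
- exact: AL.
Qed.

End gaussian_mixtures.

(** * Choice of the constants and conclusion *)

Lemma inv_le_powR (R : realType) (n : nat) (v V : R) : (0 < n)%N ->
  0 < v -> 0 < V -> v <= V ^+ n -> V^-1 <= v `^ (- n%:R^-1).
Proof.
move=> n0 v0 V0 vV; rewrite powRN lef_pV2 ?posrE ?powR_gt0//.
apply: (@le_trans _ _ ((V ^+ n) `^ n%:R^-1)).
  by apply: ge0_ler_powR; rewrite ?nnegrE ?invr_ge0 ?exprn_ge0// ltW.
rewrite -powR_mulrn ?(ltW V0)// -powRrM divff ?pnatr_eq0 ?gt_eqF//.
by rewrite powRr1 ?(ltW V0).
Qed.

Lemma flat_mixture_body (R : realType) : exists C V : R, [/\ 0 < C, 0 < V &
  forall n : nat, (0 < n)%N ->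
  exists (A : seq 'rV[R]_n) (L : set 'rV[R]_n),
    [/\ (0 < size A)%N,
        {in A, forall a, eball a (3 * Num.sqrt n%:R) `<=` L} &
        forall x t, enorm x = 1 -> \sum_(a <- A) gauss (t - dot a x) <=
          (size A)%:R * (C / Num.sqrt n%:R)] /\
    [/\ convex_body L, origin_symmetric L, measurable L &
        (lebesgue_rV L <= (V ^+ n)%:E)%E]].
Proof.
have [M [M0 HM]] := sign_frame R.
(* In [sign_frame] the same 1 / 128 is the size threshold and the guaranteed fraction. *)
have [c [c0 c1 cE]] : exists c : R, [/\ 0 < c, c < 1 & c = 1 / 128].
  by exists (1 / 128); split=> //; lra.
(* [rho] lies strictly between [q] and 1: the first makes the recursion contract, the second makes
   the lengths summable. [C] below is the fixed point of the recursion. *)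
pose q := 1 - c; pose rho := 1 - c / 2.
have q0 : 0 < q by rewrite /q; lra.
have q1 : q < 1 by rewrite /q; lra.
have rho0 : 0 < rho by rewrite /rho; lra.
have rho1 : rho < 1 by rewrite /rho; lra.
have qrho : 0 < 1 - q / rho.
  by rewrite subr_gt0 ltr_pdivrMr// mul1r /q /rho; lra.
pose C := 10 / c / (1 - q / rho).
have C0 : 0 < C by rewrite !divr_gt0.
have HC : 10 / c + C * (q / rho) <= C.
  have : C * (1 - q / rho) = 10 / c by rewrite divfK// gt_eqF.
  by rewrite mulrBr mulr1; lra.
pose k := Num.bound (1 / (1 - rho)).
have kP : 1 / (1 - rho) <= k%:R.
  by rewrite ltW// archi_boundP// divr_ge0// subr_ge0 ltW.
pose h : R := 24 * M%:R.
have h0 : 0 <= h by rewrite mulr_ge0.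
pose V := 2 ^+ k * 4 ^+ M * (expR ((3 + h) ^+ 2 / 2) / normal_peak 1).
have V0 : 0 < V.
  by rewrite !mulr_gt0 ?exprn_gt0 ?expR_gt0// invr_gt0 normal_peak_gt0// oner_neq0.
exists (1 + C), V; split=> // [|n n0]; first exact: addr_gt0.
have [E [EH EL]] := HM n n0.
have nR : 0 < n%:R :> R by rewrite ltr0n.
have rn : 0 < Num.sqrt n%:R :> R by rewrite sqrtr_gt0.
pose theta i : 'rV[R]_n := Num.sqrt n%:R *: signv (E i).
have theta_le i (x : 'rV[R]_n) : enorm x = 1 -> `|dot (theta i) x| <= n%:R.
  move=> x1; apply: le_trans (normr_dot_le _ _) _; rewrite x1 mulr1 enormZ.
  rewrite (gtr0_norm rn) -[leRHS](@sqr_sqrtr R)// expr2 ler_wpM2l ?(ltW rn)//.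
  by rewrite -[leRHS]mulr1; apply: enorm_le_coord => // j; rewrite mxE normrX normrN1 expr1n.
have theta_spread (x : 'rV[R]_n) : enorm x = 1 -> (M * n)%:R * (1 - q) <=
    #|[pred i | Num.sqrt n%:R * c <= `|dot (theta i) x|]|%:R :> R.
  move=> x1; have := EL x x1; rewrite /q subKr cE div1r => /le_trans; apply.
  rewrite ler_nat; apply/eq_leq/eq_card => i; rewrite !inE dotZl normrM (gtr0_norm rn).
  by rewrite ler_pM2l.
have N0 : (0 < M * n)%N by rewrite muln_gt0 M0.
(* Enough rounds for q ^ K <= 1 / n <= 1 / sqrt n. Only [K] depends on [n]; the constants do not see
   it. *)
have [K [_ HK]] : exists K, (0 < K)%N /\ n%:R < q^-1 ^+ K.
  by apply: expr_unbounded; rewrite ?(ltW nR)// invf_gt1.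
have s01 : 0 < (1 : R) <= 1 by rewrite ltr01 lexx.
have [A [A0 AE AG]] := gauss_mixture_flat n0 theta_le c0 (ltW q0) rho0 rho1
  theta_spread N0 K (ltW C0) HC s01.
have r0 : 0 < 3 * Num.sqrt n%:R :> R by rewrite mulr_gt0.
exists A, (hull_body theta k%:R (3 * Num.sqrt n%:R)); split; split => //.
- move=> a /AE[y yk ->]; apply: hull_body_eball.
  exact: le_trans yk kP.
- move=> x t x1; apply: le_trans (AG x t x1) _.
  rewrite ler_wpM2l// mul1r mulrDl lerD2r div1r.
  apply: (@le_trans _ _ n%:R^-1).
    rewrite exprVn in HK.
    by rewrite -[leLHS]invrK lef_pV2 ?posrE ?invr_gt0 ?exprn_gt0// ltW.
  rewrite lef_pV2 ?posrE// -[leRHS](@sqr_sqrtr R)// expr2 ler_peMl ?(ltW rn)//.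
  by rewrite -[leLHS]sqrtr1 ler_wsqrtr// ler1n.
- exact: hull_body_convex_body.
- exact: hull_body_sym.
- exact: measurable_hull_body.
- apply: lebesgue_hull_body_le => // x.
  by apply: le_trans (EH x) _; rewrite natrM /h mulrA.
Qed.

Theorem theorem1p1 (R : realType) :
  exists C : R, 0 < C /\
  forall n : nat, (0 < n)%N ->
  exists (mu : {measure set 'rV[R]_n -> \bar R}) (f : 'rV[R]_n -> R)
    (L : set 'rV[R]_n),
    [/\ continuous f, (forall x, 0 <= f x) & has_density mu f] /\
    [/\ convex_body L, origin_symmetric L & (0 < mu L)%E] /\
    forall xi : 'rV[R]_n, unit_sphere R n xi ->
    forall t : R, 0 <= t ->
      (mu_plus f (L `&` translate (perp xi) (t *: xi)) <=
         (C / Num.sqrt n%:R)%:E * mu L *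
         (fine (lebesgue_rV L) `^ (- n%:R^-1))%:E)%E.
Proof.
have [C [V [C0 V0 HCV]]] := flat_mixture_body R.
have pk : 0 < normal_peak (1 : R) by rewrite normal_peak_gt0// oner_neq0.
(* [normal_peak 1 * C] bounds the sections, 2 pays for [mu L] being at least half of [size A], and
   [V] for |L|^(-1/n) being at least [V^-1]. *)
exists (2 * normal_peak 1 * C * V); split; first by rewrite !mulr_gt0.
(* With the dimension a successor, [n.-1] computes and the charts of hyperplanes have the right
   dimension. *)
move=> [//|n] n0; have [A [L [[A0 AL AG] [Lc Ls mL LV]]]] := HCV _ n0.
have [mu muE] := measure_of_density (measurable_gaussian_mixture A)
  (gaussian_mixture_ge0 A).
have muA : (((size A)%:R / 2)%:E <= mu L)%E.
  by rewrite muE//; exact: gaussian_mixture_mass.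
have rn : 0 < Num.sqrt n.+1%:R :> R by rewrite sqrtr_gt0 ltr0n.
exists mu, (gaussian_mixture A), L; split; [|split].
- split; [exact: continuous_gaussian_mixture|exact: gaussian_mixture_ge0|exact: muE].
- split => //; apply: lt_le_trans muA.
  by rewrite lte_fin divr_gt0// ltr0n.
move=> xi xi1 t _; apply: le_trans (mu_plus_gaussian_mixture_le A t mL xi1) _.
set v := fine _.
have vE : lebesgue_rV L = v%:E.
  by rewrite /v fineK// ge0_fin_numE// (le_lt_trans LV)// ltry.
have v0 : 0 < v.
  have [a aA] : exists a, a \in A by case: (A) A0 => // a s _; exists a; rewrite mem_head.
  have r0 : 0 < 3 * Num.sqrt n.+1%:R :> R by rewrite mulr_gt0.
  rewrite -lte_fin -vE.
  apply: (@lt_le_trans _ _ (lebesgue_rV (eball a (3 * Num.sqrt n.+1%:R)))).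
    by rewrite lebesgue_eball// ball_volumeE -EFinM lte_fin mulr_gt0 ?exprn_gt0 ?ball_volume_gt0.
  by apply: le_measure; rewrite ?inE//; [exact: measurable_eball|exact: AL].
have vV : V^-1 <= v `^ (- n.+1%:R^-1).
  by apply: inv_le_powR => //; rewrite -lee_fin -vE.
apply: (@le_trans _ _ ((2 * normal_peak 1 * C * V / Num.sqrt n.+1%:R)%:E *
    ((size A)%:R / 2)%:E * (V^-1)%:E)%E).
  rewrite -!EFinM lee_fin [leRHS](_ : _ =
      normal_peak 1 * ((size A)%:R * (C / Num.sqrt n.+1%:R))); last first.
    by field; rewrite !gt_eqF.
  by rewrite ler_pM2l// AG.
have K0 : 0 <= 2 * normal_peak 1 * C * V / Num.sqrt n.+1%:R.
  by apply: ltW; rewrite divr_gt0// !mulr_gt0.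
apply: lee_pmul; rewrite ?lee_fin ?invr_ge0 ?(ltW V0)//.
  by rewrite mulr_ge0// divr_ge0.
by apply: lee_wpmul2l; rewrite ?lee_fin.
Qed.
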